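(* Let $K\in L^\infty(\mathbb{R})$. Given $u:\mathbb{R}\to\mathbb{R}$, set $$\lambda(\theta):=u(\Pi(\theta))-\log(1+\sin\theta).$$ Then $u\in L_{\frac12}(\mathbb{R})$ if and only if $\lambda\in L^1(S^1)$, and $(-\Delta)^{\frac12}u\in L^1(\mathbb{R})$ if and only if $(-\Delta)^{\frac12}\lambda\in L^1(S^1\setminus\{-i\})$. In this case $u$ solves $$(-\Delta)^{\frac12}u=Ke^u\quad\text{in }\mathbb{R}$$ if and only if $\lambda$ solves $$(-\Delta)^{\frac12}\lambda=\kappa e^\lambda-1+(2\pi-c)\delta_{-i}\quad\text{in }S^1,$$ with $\kappa=K\circ\Pi$ and $c=\|(-\Delta)^{\frac12}u\|_{L^1(\mathbb{R})}$.
   Context: $S^1$ is the unit circle in $\mathbb{C}$ with measure $d\theta$; $\Pi:S^1\setminus\{-i\}\to\mathbb{R}$ is the stereographic projection $\Pi(\xi+i\eta)=\frac{\xi}{1+\eta}$, i.e. $\Pi(\theta)=\Pi(e^{i\theta})=\frac{\cos\theta}{1+\sin\theta}$. $L_{\frac12}(\mathbb{R}):=\{u\in L^1_{\mathrm{loc}}(\mathbb{R}):\int_{\mathbb{R}}\frac{|u(x)|}{1+x^2}dx<\infty\}$, and for $u\in L_{\frac12}(\mathbb{R})$ the tempered distribution $(-\Delta)^{\frac12}u$ is defined by $\langle(-\Delta)^{\frac12}u,\varphi\rangle:=\int_{\mathbb{R}}u\,\mathcal{F}^{-1}(|\xi|\hat\varphi)\,dx$ for Schwartz $\varphi$, with $\hat\varphi(\xi)=\int_{\mathbb{R}}\varphi(x)e^{-ix\xi}dx$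 and $\mathcal{F}^{-1}$ the inverse Fourier transform. On $S^1$: for $\varphi\in C^\infty(S^1)$, $(-\Delta)^{\frac12}\varphi(\theta)=\sum_{n\in\mathbb{Z}}|n|\hat\varphi(n)e^{in\theta}$ with $\hat\varphi(n)=\frac1{2\pi}\int_{S^1}\varphi(\theta) e^{-in\theta}d\theta$, and for $v\in L^1(S^1)$, $\langle(-\Delta)^{\frac12}v,\varphi\rangle:=\int_{S^1}v(-\Delta)^{\frac12}\varphi\,d\theta$ for $\varphi\in C^\infty(S^1)$. ''$(-\Delta)^{\frac12}\lambda\in L^1(S^1\setminus\{-i\})$'' means that the restriction of this distribution to $S^1\setminus\{-i\}$ is an $L^1$ function. Equations are in the sense of distributions; $\delta_{-i}$ is the Dirac mass at $-i$.
   Formalization: With c the L^1 norm, ''u solves implies λ solves'' is false for sign-changing K (testing with 1 forces c = ∫(-Δ)^{1/2}u), so it is claimed only for K ≥ 0 a.e.; the converse holds for all K, as does the full equivalence with c = ∫(-Δ)^{1/2}u. *)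

(* Defs.v *)
From mathcomp Require Export all_boot all_order all_algebra.
From mathcomp Require Export complex.
From mathcomp Require Export all_classical all_reals all_analysis.

Set Implicit Arguments.
Unset Strict Implicit.
Unset Printing Implicit Defensive.

Export Order.TTheory GRing.Theory Num.Theory.
Export numFieldNormedType.Exports.

Global Open Scope classical_set_scope.
Global Open Scope ring_scope.
Global Open Scope complex_scope.

Section ComplexValued.
Context {R : realType}.
Local Notation mu := (@lebesgue_measure R).

(* Integrals, limits and regularity of complex-valued functions are taken
   componentwise, as R[i] is not a normed R-module in the library. *)
Definition cintegrable (D : set R) (f : R -> R[i]) : Prop :=
  mu.-integrable D (EFin \o (fun x => complex.Re (f x))) /\
  mu.-integrable D (EFin \o (fun x => complex.Im (f x))).

Definition cintegral (D : set R) (f : R -> R[i]) : R[i] :=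
  (\int[mu]_(x in D) complex.Re (f x))%R +i*
  (\int[mu]_(x in D) complex.Im (f x))%R.

Definition clim (s : nat -> R[i]) : R[i] :=
  lim ((fun N => complex.Re (s N)) @ \oo) +i*
  lim ((fun N => complex.Im (s N)) @ \oo).

Definition expi (t : R) : R[i] := cos t +i* sin t.

Definition rsmooth (f : R -> R) : Prop :=
  forall (n : nat) (x : R), derivable (derive1n n f) x 1.

Definition smooth (phi : R -> R[i]) : Prop :=
  rsmooth (fun x => complex.Re (phi x)) /\ rsmooth (fun x => complex.Im (phi x)).

End ComplexValued.

Section Line.
Context {R : realType}.
Local Notation mu := (@lebesgue_measure R).

Definition rschwartz (f : R -> R) : Prop :=
  rsmooth f /\
  forall m n : nat, exists C : R, forall x : R, `|x| ^+ m * `|derive1n n f x| <= C.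

Definition schwartz (phi : R -> R[i]) : Prop :=
  rschwartz (fun x => complex.Re (phi x)) /\
  rschwartz (fun x => complex.Im (phi x)).

Definition fourier (phi : R -> R[i]) (xi : R) : R[i] :=
  cintegral setT (fun x => phi x * expi (- (x * xi))).

Definition inv_fourier (psi : R -> R[i]) (x : R) : R[i] :=
  ((2 * pi)^-1)%:C * cintegral setT (fun xi => psi xi * expi (x * xi)).

Definition half_lap_line (phi : R -> R[i]) : R -> R[i] :=
  inv_fourier (fun xi => `|xi|%:C * fourier phi xi).

Definition L_half (u : R -> R) : Prop :=
  locally_integrable setT u /\
  (\int[mu]_x (`|u x| / (1 + x ^+ 2))%:E < +oo)%E.

(* The pairing of the tempered distribution (-Delta)^(1/2) u with phi. *)
Definition half_lap_line_pairing (u : R -> R) (phi : R -> R[i]) : R[i] :=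
  cintegral setT (fun x => (u x)%:C * half_lap_line phi x).

(* (-Delta)^(1/2) u = g as tempered distributions; the integrability clause
   says that g does define a distribution. *)
Definition half_lap_line_eq (u g : R -> R) : Prop :=
  forall phi : R -> R[i], schwartz phi ->
    cintegrable setT (fun x => (g x)%:C * phi x) /\
    half_lap_line_pairing u phi = cintegral setT (fun x => (g x)%:C * phi x).

Definition half_lap_line_L1 (u : R -> R) : Prop :=
  exists f : R -> R,
    mu.-integrable setT (EFin \o f) /\ half_lap_line_eq u f.

End Line.

(* Functions on S^1 are 2pi-periodic functions of the angle theta, and
   integrals over S^1 are integrals over one period. The period starts at the
   angle -pi/2 of the point -i. *)
Section Circle.
Context {R : realType}.
Local Notation mu := (@lebesgue_measure R).

Definition minus_i_angle : R := - (pi / 2).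

Definition circle : set R := `[minus_i_angle, minus_i_angle + 2 * pi[.

Definition periodic2pi (phi : R -> R[i]) : Prop :=
  forall t : R, phi (t + 2 * pi) = phi t.

Definition circle_test (phi : R -> R[i]) : Prop :=
  smooth phi /\ periodic2pi phi.

(* C^oo functions with compact support in S^1 \ {-i}. *)
Definition punctured_circle_test (phi : R -> R[i]) : Prop :=
  circle_test phi /\ \forall t \near minus_i_angle, phi t = 0.

Definition fourier_coef (phi : R -> R[i]) (n : int) : R[i] :=
  ((2 * pi)^-1)%:C *
  cintegral circle (fun t => phi t * expi (- (n%:~R * t))).

(* The sum over Z is the limit of the sums over -N <= n <= N. *)
Definition half_lap_circle (phi : R -> R[i]) (t : R) : R[i] :=
  clim (fun N : nat =>
    \sum_(k < N.*2.+1)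
      let n : int := k%:Z - N%:Z in
      (`|n|%:~R)%:C * fourier_coef phi n * expi (n%:~R * t)).

Definition L1_circle (v : R -> R) : Prop :=
  mu.-integrable circle (EFin \o v).

Definition half_lap_circle_pairing (v : R -> R) (phi : R -> R[i]) : R[i] :=
  cintegral circle (fun t => (v t)%:C * half_lap_circle phi t).

Definition half_lap_circle_punctured_L1 (v : R -> R) : Prop :=
  exists g : R -> R, L1_circle g /\
    forall phi : R -> R[i], punctured_circle_test phi ->
      half_lap_circle_pairing v phi =
      cintegral circle (fun t => (g t)%:C * phi t).

(* (-Delta)^(1/2) v = g + a delta_{-i} as distributions on S^1. *)
Definition half_lap_circle_eq (v g : R -> R) (a : R) : Prop :=
  L1_circle g /\
  forall phi : R -> R[i], circle_test phi ->
    half_lap_circle_pairing v phi =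
    cintegral circle (fun t => (g t)%:C * phi t) + a%:C * phi minus_i_angle.

(* The stereographic projection from -i, as a function of the angle; its value
   at -i, given by division by 0, plays no role. *)
Definition stereo (t : R) : R := cos t / (1 + sin t).

Definition lift_circle (u : R -> R) (t : R) : R :=
  u (stereo t) - ln (1 + sin t).

End Circle.

Section Equations.
Context {R : realType}.

Definition solves_line (K u : R -> R) : Prop :=
  half_lap_line_eq u (fun x => K x * expR (u x)).

(* Testing with phi = 1 forces c to be the integral of (-Delta)^(1/2) u = K e^u.
   It is the L^1 norm of (-Delta)^(1/2) u only if K e^u >= 0 a.e., hence the
   parameter c. *)
Definition solves_circle (kappa lambda : R -> R) (c : R) : Prop :=
  half_lap_circle_eq lambda
    (fun t => kappa t * expR (lambda t) - 1) (2 * pi - c).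

End Equations.

(* Main.v *)
From HB Require Import structures.
Require Import Defs.
From mathcomp Require Import measurable_realfun zify ring lra.

(** Write T for (-Delta)^(1/2), on the line or on the circle, and Pi for the
    stereographic projection. The proof rests on the conformal covariance of T:
    if a = psi o Pi^-1 is a test function of the line, then
      T a (x) = 2 / (1 + x^2) * (T psi) (Pi^-1 x)      ([line_hlap_circle]),
    and 2 / (1 + x^2) dx is the image of d theta. So the pairing of u with T a
    is the pairing of u o Pi with T psi, and T u = f becomes, away from the
    pole, T (u o Pi) = G with the density G = (f o Pi) / (1 + sin).

    The covariance holds because both operators are the same singular
    integral. On the circle, T psi (th) is -1 / (2 pi) times the integral of
      (psi (th + s) - psi th - psi' th * sin s) / (1 - cos s)
    ([fourier_circle_hlap]): multiplying by 1 - cos s takes second differences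
    of Fourier coefficients, and these make the sums of n * a_n telescope. On
    the line, Abel summation of the Fourier integral ([line_hlap_abel]) gives
    kernels of mean zero that tend to -1 / t^2. The projection turns
    1 - cos (tau - th) into 2 (y - x)^2 / ((1 + x^2) (1 + y^2)), and the
    compensator sin contributes nothing in the limit ([conformal_limit]).

    Three more facts give the equations.

    - T (ln (1 + sin)) = 1 - 2 pi delta at the pole ([circle_hlap_ln]), which
      is where the terms -1 and 2 pi of the equation on the circle come from.
      It is obtained from T sin = sin by dilating the line by a factor a and
      integrating over a: one side integrates to the logarithm, the other to
      a Poisson kernel that concentrates at the pole.

    - If v and G are integrable and T v = G against the test functions that
      vanish near the pole, then T v = G - (int G) delta
      ([extend_through_pole]). A distribution supported at the pole is a sum of
      multiples of derivatives of delta; the integrability of v leaves only delta itself,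
      and the constants, which T kills, give its weight. This moves the
      equation from the punctured circle to the whole circle, and back to
      Schwartz functions, whose transfers to the circle are smooth but do not
      vanish near the pole. It also explains the weight 2 pi - int f of delta.

    - By the fundamental lemma of the calculus of variations, both equations
      say that K e^u = f almost everywhere; the equation on the circle says so
      with any weight in front of delta ([solves_line_ae], [circle_ae],
      [ae_circle]). When K is nonnegative, f is then nonnegative and int f is
      its L^1 norm.

    T maps real functions to real functions on both sides, so that real test
    functions suffice. *)

Set Implicit Arguments.
Unset Strict Implicit.
Unset Printing Implicit Defensive.

(** * Integration of real functions *)

Section Toolkit.
Context {R : realType}.
Local Notation mu := (@lebesgue_measure R).
Implicit Types (D : set R) (f g F : R -> R).

Definition intg D f := mu.-integrable D (EFin \o f).

Lemma intg_meas D f : intg D f -> measurable_fun D f.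
Proof. by move=> /integrableP[/measurable_EFinP]. Qed.

Lemma meas_EFin D f : measurable_fun D f -> measurable_fun D (fun x => (f x)%:E).
Proof. by move=> ?; exact/measurable_EFinP. Qed.

Lemma cont_meas D f : continuous f -> measurable_fun D f.
Proof. by move=> cf; apply: measurable_funTS; exact: continuous_measurable_fun. Qed.

Lemma intg_le D f g : measurable D -> measurable_fun D f ->
  (forall x, D x -> `|f x| <= g x) -> intg D g -> intg D f.
Proof.
move=> mD mf fg ig; apply: (@le_integrable _ _ _ mu D mD _ (EFin \o g) _ _ ig) => /=.
  exact/measurable_EFinP.
by move=> x Dx; rewrite /= lee_fin (le_trans (fg _ Dx))// ler_norm.
Qed.

Lemma intgD D f g : measurable D -> intg D f -> intg D g ->
  intg D (fun x => f x + g x).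
Proof. by move=> mD If Ig; exact: (@integrableD _ _ _ mu D mD (EFin \o f) (EFin \o g) If Ig). Qed.

Lemma intgB D f g : measurable D -> intg D f -> intg D g ->
  intg D (fun x => f x - g x).
Proof. by move=> mD If Ig; exact: (@integrableB _ _ _ mu D mD (EFin \o f) (EFin \o g) If Ig). Qed.

Lemma intgZ D r f : measurable D -> intg D f -> intg D (fun x => r * f x).
Proof. by move=> mD If; exact: (@integrableZl _ _ _ mu D mD r (EFin \o f) If). Qed.

Lemma intgN D f : measurable D -> intg D f -> intg D (fun x => - f x).
Proof. by move=> mD If; exact: (@integrableN _ _ _ mu D (EFin \o f) If). Qed.

Lemma eq_intg D f g : measurable D -> (forall x, D x -> f x = g x) ->
  intg D f -> intg D g.
Proof.
by move=> mD fg; apply: eq_integrable => // x; rewrite inE => /fg /= ->.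
Qed.

Lemma intgS D E f : measurable D -> measurable E -> D `<=` E -> intg E f -> intg D f.
Proof. by move=> mD mE DE; apply: integrableS. Qed.

Lemma intg_norm D f : intg D f -> intg D (fun x => `|f x|).
Proof. by move=> /integrable_norm. Qed.

Lemma intg_cst D (k : R) : measurable D -> (mu D < +oo)%E -> intg D (cst k).
Proof.
move=> mD Dfin; apply/integrableP; split; first exact/measurable_EFinP.
rewrite /= integral_cst//.
by apply: lte_mul_pinfty => //; rewrite lee_fin.
Qed.

Lemma intg_bounded D f C : measurable D -> (mu D < +oo)%E -> measurable_fun D f ->
  (forall x, D x -> `|f x| <= C) -> intg D f.
Proof.
move=> mD Dfin mf fC; apply: (@intg_le _ _ (cst C)) => //.
exact: intg_cst.
Qed.

Lemma eq_Rint D f g : (forall x, D x -> f x = g x) ->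
  (\int[mu]_(x in D) f x = \int[mu]_(x in D) g x)%R.
Proof. by move=> fg; apply: eq_Rintegral => x; rewrite inE => /fg. Qed.

Lemma RintN D f : measurable D -> intg D f ->
  (\int[mu]_(x in D) (- f x) = - \int[mu]_(x in D) f x)%R.
Proof.
move=> mD If; rewrite -[RHS]mulN1r -RintegralZl//.
by apply: eq_Rint => x _; rewrite mulN1r.
Qed.

Lemma Rint_D D f g : measurable D -> intg D f -> intg D g ->
  (\int[mu]_(x in D) (f x + g x) = \int[mu]_(x in D) f x + \int[mu]_(x in D) g x)%R.
Proof. by move=> mD If Ig; exact: RintegralD. Qed.

Lemma Rint_B D f g : measurable D -> intg D f -> intg D g ->
  (\int[mu]_(x in D) (f x - g x) = \int[mu]_(x in D) f x - \int[mu]_(x in D) g x)%R.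
Proof. by move=> mD If Ig; exact: RintegralB. Qed.

Lemma Rint_Z D f (r : R) : measurable D -> intg D f ->
  (\int[mu]_(x in D) (r * f x) = r * \int[mu]_(x in D) f x)%R.
Proof. by move=> mD If; exact: RintegralZl. Qed.

Lemma Rint0 D : (\int[mu]_(x in D) (0 : R))%R = 0.
Proof. by rewrite /Rintegral integral0. Qed.

Lemma Rint_dct D (f : nat -> R -> R) (h g : R -> R) : measurable D ->
  (forall n, measurable_fun D (f n)) ->
  (forall x, D x -> f ^~ x @ \oo --> h x) ->
  (forall n x, D x -> `|f n x| <= g x) -> intg D g ->
  intg D h /\ (fun n => \int[mu]_(x in D) f n x)%R @ \oo --> (\int[mu]_(x in D) h x)%R.
Proof.
move=> mD mf fh fg ig.
have mh : measurable_fun D h by apply: (measurable_fun_cvg mf).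
have ih : intg D h.
  apply: (intg_le mD mh _ ig) => x Dx.
  have fhx : (fun n => `|f n x|) @ \oo --> `|h x| by apply: cvg_norm; exact: fh.
  rewrite -(cvg_lim _ fhx)//; apply: limr_le; first by apply/cvg_ex; eexists; exact: fhx.
  by apply: nearW => n; exact: fg.
split=> //.
suff H : (fun n => \int[mu]_(x in D) (f n x)%:E)%E @ \oo -->
    ((\int[mu]_(x in D) h x)%R)%:E by exact: (fine_cvg H).
rewrite [X in _ --> X](_ : _ = \int[mu]_(x in D) (h x)%:E)%E; last first.
  by rewrite /Rintegral fineK//; exact: integrable_fin_num.
apply: (@dominated_cvg _ _ _ mu D mD (fun n x => (f n x)%:E) (EFin \o h) (EFin \o g)) => //.
- by move=> n; have /measurable_EFinP := mf n.
- by move=> x Dx /=; apply: cvg_EFin; [exact: nearW|exact: fh].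
Qed.

Lemma Rint_FTC f F (a b : R) : a <= b -> (forall x : R, is_derive x 1 F (f x)) ->
  continuous f -> (\int[mu]_(x in `[a, b]) f x)%R = F b - F a.
Proof.
move=> ab dF cf.
have cF : continuous F.
  by move=> x; apply: differentiable_continuous; apply/derivable1_diffP; apply: ex_derive.
move: ab; rewrite le_eqVlt => /predU1P[->|ab].
  by rewrite set_itv1 Rintegral_set1 subrr.
rewrite /Rintegral (@continuous_FTC2 _ f F)//.
- exact: continuous_subspaceT.
- split.
  + by move=> x _; exact: ex_derive.
  + by apply: cvg_at_right_filter; exact: cF.
  + by apply: cvg_at_left_filter; exact: cF.
- by move=> x _; rewrite derive1E; apply: derive_val.
Qed.

Lemma mu_itv_lty (a b : R) (c d : bool) :
  (mu [set` Interval (BSide c a) (BSide d b)] < +oo)%E.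
Proof. by rewrite lebesgue_measure_itv/=; case: ifP => // _; rewrite -EFinB ltry. Qed.

Lemma intg_mkcond D f : measurable D -> intg D f -> intg setT (f \_ D).
Proof.
move=> mD If; rewrite /intg -restrict_EFin.
exact: (@integrable_mkcond _ _ _ mu D (EFin \o f) mD).1 If.
Qed.

Lemma Rint_itvNn f : intg setT f ->
  (fun n : nat => \int[mu]_(x in `[- n%:R, n%:R]) f x)%R @ \oo -->
  (\int[mu]_x f x)%R.
Proof.
move=> If.
rewrite (_ : (fun n => _) =
   (fun n : nat => \int[mu]_x (f \_ (`[- n%:R, n%:R])) x)%R); last first.
  by apply/funext => n; rewrite Rintegral_mkcond.
apply: (@Rint_dct setT _ f (fun x => `|f x|) _ _ _ _ _).2 => //.
- move=> n; apply/(measurable_restrictT _ _).1 => //.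
  by apply: measurable_funTS; exact: intg_meas If.
- move=> x _; apply: (@cvg_near_cst _ _ _ _ _ _).
  near=> n; rewrite patchE ifT// inE/= in_itv/= -ler_norml.
  by near: n; exact: nbhs_infty_ger.
- by move=> n x _; rewrite patchE; case: ifP => // _; rewrite normr0.
- exact: intg_norm.
Unshelve. all: by end_near. Qed.

Lemma Rint_improper f F (l m : R) : (forall x : R, is_derive x 1 F (f x)) ->
  continuous f -> intg setT f ->
  (fun n : nat => F n%:R) @ \oo --> l -> (fun n : nat => F (- n%:R)) @ \oo --> m ->
  (\int[mu]_x f x)%R = l - m.
Proof.
move=> dF cf If Fl Fm.
have h := Rint_itvNn If.
rewrite -(cvg_lim _ h)//; apply: cvg_lim => //.
rewrite (_ : (fun n => _) = (fun n : nat => F n%:R - F (- n%:R))).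
  exact: cvgB.
apply/funext => n; apply: Rint_FTC => //.
by rewrite (le_trans _ (ler0n _ n))// oppr_le0.
Qed.

(** Limits are taken along the integers because the integral over the half-line
    is already known to converge. *)
Lemma Rint_improper0 f F (l : R) : (forall x : R, is_derive x 1 F (f x)) ->
  continuous f -> intg `[0, +oo[ f ->
  (fun n : nat => F n%:R) @ \oo --> l ->
  (\int[mu]_(x in `[0%R, +oo[) f x)%R = l - F 0.
Proof.
move=> dF cf If Fl.
have h := Rint_itvNn (intg_mkcond (measurable_itv _) If).
rewrite -Rintegral_mkcond in h.
rewrite -(cvg_lim _ h)//; apply: cvg_lim => //.
rewrite (_ : (fun n => _) = (fun n : nat => F n%:R - F 0)).
  by apply: cvgB => //; exact: cvg_cst.
apply/funext => n; rewrite -Rintegral_mkcondr.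
rewrite (_ : `[- n%:R, n%:R] `&` _ = `[0, n%:R]%classic); first exact: Rint_FTC.
apply/seteqP; split=> x /=; rewrite !in_itv/= ?andbT.
  by move=> [/andP[? ?] ?]; apply/andP.
by move=> /andP[x0 xn]; rewrite x0 xn andbT (le_trans _ x0)// oppr_le0.
Qed.

End Toolkit.

(** * Derivative calculus *)

Section Derivatives.
Context {R : realType}.
Implicit Types (f g : R -> R) (x a b : R).

Lemma dC (c x : R) : is_derive x 1 (fun _ : R => c) 0.
Proof. exact: is_derive_cst. Qed.

Lemma dI x : is_derive x 1 (fun y : R => y) 1.
Proof. exact: is_derive_id. Qed.

Lemma dD f g x a b : is_derive x 1 f a -> is_derive x 1 g b ->
  is_derive x 1 (fun y => f y + g y) (a + b).
Proof. by move=> df dg; exact: (is_deriveD df dg). Qed.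

Lemma dN f x a : is_derive x 1 f a -> is_derive x 1 (fun y => - f y) (- a).
Proof. by move=> df; exact: (is_deriveN df). Qed.

Lemma dB f g x a b : is_derive x 1 f a -> is_derive x 1 g b ->
  is_derive x 1 (fun y => f y - g y) (a - b).
Proof. by move=> df dg; exact: (is_deriveB df dg). Qed.

Lemma dM f g x a b : is_derive x 1 f a -> is_derive x 1 g b ->
  is_derive x 1 (fun y => f y * g y) (a * g x + f x * b).
Proof.
move=> df dg; apply: (is_derive_eq (is_deriveM df dg)).
by rewrite /GRing.scale/= addrC mulrC.
Qed.

Lemma dZ (c : R) f x a : is_derive x 1 f a -> is_derive x 1 (fun y => c * f y) (c * a).
Proof. by move=> df; apply: (is_derive_eq (dM (dC c x) df)); rewrite mul0r add0r. Qed.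

Lemma dcomp f g x a b : is_derive (g x) 1 f a -> is_derive x 1 g b ->
  is_derive x 1 (fun y => f (g y)) (a * b).
Proof. by move=> df dg; exact: is_derive1_comp. Qed.

Lemma dV f x a : f x != 0 -> is_derive x 1 f a ->
  is_derive x 1 (fun y => (f y)^-1) (- a / f x ^+ 2).
Proof.
move=> fx0 df; apply: (is_derive_eq (is_deriveV fx0 df)).
by rewrite /GRing.scale/= mulNr [RHS]mulNr mulrC.
Qed.

Lemma dX f x a (n : nat) : is_derive x 1 f a ->
  is_derive x 1 (fun y => f y ^+ n) (n%:R * f x ^+ n.-1 * a).
Proof.
move=> df; rewrite (_ : (fun y => _) = f ^+ n); last by apply/funext => y; rewrite exprfctE.
apply: (is_derive_eq (is_deriveX n df)).
by [].
Qed.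

Lemma deriv_cont f f' : (forall x : R, is_derive x 1 f (f' x)) -> continuous f.
Proof.
by move=> df x; apply: differentiable_continuous; apply/derivable1_diffP; apply: ex_derive.
Qed.

(** The bound on f' is asked between x and y, in either order: [taylor2]
    applies it to a derivative that is small near one of them. *)
Lemma MVT_bound f f' (C x y : R) : (forall x : R, is_derive x 1 f (f' x)) ->
  (forall z, Num.min x y <= z <= Num.max x y -> `|f' z| <= C) -> `|f y - f x| <= C * `|y - x|.
Proof.
move=> df fC.
wlog xy : x y fC / x < y.
  move=> H; case: (ltgtP x y) => [xy|yx|->].
  - exact: H.
  - by rewrite -normrN opprB -(normrN (y - x)) opprB; apply: H => // z; rewrite minC maxC; exact: fC.
  - by rewrite !subrr normr0 mulr0.
have [c cxy ->] := MVT xy (fun z _ => df z) (continuous_subspaceT (deriv_cont df)).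
rewrite normrM ler_wpM2r// fC//.
move: cxy; rewrite in_itv/= => /andP[xc cy].
by rewrite ge_min (ltW xc)/= le_max (ltW cy) orbT.
Qed.

End Derivatives.

(** * Iterated integrals *)

Section Fubini.
Context {R : realType}.
Local Notation mu := (@lebesgue_measure R).

(** Domination by a product g x * h y is how every double integral of the proof
    is seen to be absolutely convergent; it spares a separate integrability
    argument on the product space. *)
Lemma Rint_Fubini (D E : set R) (f : R -> R -> R) (g h : R -> R) :
  measurable D -> measurable E ->
  measurable_fun setT (fun z : R * R => f z.1 z.2) ->
  (forall x y, D x -> E y -> `|f x y| <= g x * h y) ->
  intg D g -> intg E h ->
  intg D (fun x => \int[mu]_(y in E) f x y)%R /\
  (\int[mu]_(x in D) \int[mu]_(y in E) f x y = \int[mu]_(y in E) \int[mu]_(x in D) f x y)%R.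
Proof.
move=> mD mE mf fgh ig ih.
pose F (z : R * R) := \1_D z.1 * \1_E z.2 * f z.1 z.2.
pose G (z : R * R) := (g \_ D) z.1 * (h \_ E) z.2.
have igT : intg setT (g \_ D) by exact: intg_mkcond.
have ihT : intg setT (h \_ E) by exact: intg_mkcond.
have mG : measurable_fun setT G.
  by apply: measurable_funM; apply: measurableT_comp => //; exact: intg_meas.
have mF : measurable_fun setT F.
  apply: measurable_funM => //; apply: measurable_funM;
    by apply: measurableT_comp => //; exact: measurable_indic.
have GF x y : `|F (x, y)| <= G (x, y).
  rewrite /F /G !patchE !indicE; case: ifPn => Dx; case: ifPn => Ey;
    rewrite /= ?mul1r ?mul0r ?mulr0 ?mul0r ?normr0//.
  by apply: fgh; [rewrite inE in Dx|rewrite inE in Ey].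
have iG : (mu \x mu)%E.-integrable setT (EFin \o G).
  apply/integrable12ltyP; first exact/measurable_EFinP.
  under eq_integral => x _.
    rewrite (_ : (fun y => _) = fun y => (`|(g \_ D) x|%:E * `|(h \_ E) y|%:E)%E);
      last by apply/funext => y; rewrite /G /= normrM EFinM.
    rewrite ge0_integralZl//; first over.
    - by apply/measurable_EFinP; apply: measurableT_comp => //; exact: intg_meas.
  rewrite ge0_integralZr//=.
  - apply: lte_mul_pinfty => //.
    + exact: integral_ge0.
    + by have := integrable_fin_num measurableT (intg_norm igT); rewrite /=.
    + by have /integrableP[_] := ihT.
  - by apply/measurable_EFinP; apply: measurableT_comp => //; exact: intg_meas.
  - exact: integral_ge0.
have iF : (mu \x mu)%E.-integrable setT (EFin \o F).
  apply: (le_integrable _ _ _ iG) => //; first exact/measurable_EFinP.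
  by move=> [x y] _; rewrite /= lee_fin (le_trans (GF x y))// ler_norm.
have FD x : (\int[mu]_y (EFin \o F) (x, y) = (((fun x => \int[mu]_(y in E) f x y)%R \_ D) x)%:E)%E.
  rewrite patchE; case: ifPn => Dx; last first.
    rewrite integral0_eq// => y _.
    by rewrite /F/= indicE (negbTE Dx) !mul0r.
  rewrite /Rintegral fineK.
    rewrite [RHS]integral_mkcond; apply: eq_integral => y _.
    rewrite /F/= indicE Dx mul1r patchE indicE; case: ifP => _.
      by rewrite mul1r.
    by rewrite mul0r.
  apply: integrable_fin_num => //.
  apply: (@intg_le _ _ _ (fun y => g x * h y)) => //.
  - have := measurableT_comp mf (pair1_measurable x).
    by apply: measurable_funTS.
  - by move=> y Ey; apply: fgh => //; rewrite inE in Dx.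
  - exact: intgZ.
have FE y : (\int[mu]_x (EFin \o F) (x, y) = (((fun y => \int[mu]_(x in D) f x y)%R \_ E) y)%:E)%E.
  rewrite patchE; case: ifPn => Dx; last first.
    rewrite integral0_eq// => x _.
    by rewrite /F/= !indicE (negbTE Dx) mulr0 !mul0r.
  rewrite /Rintegral fineK.
    rewrite [RHS]integral_mkcond; apply: eq_integral => x _.
    rewrite /F/= !indicE Dx mulr1 patchE; case: ifP => _.
      by rewrite mul1r.
    by rewrite mul0r.
  apply: integrable_fin_num => //.
  apply: (@intg_le _ _ _ (fun x => h y * g x)) => //.
  - have := measurableT_comp mf (pair2_measurable y).
    by apply: measurable_funTS.
  - by move=> x Ey; rewrite mulrC; apply: fgh => //; rewrite inE in Dx.
  - exact: intgZ.
have iFD := integrable_fubini_F iF.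
split.
- apply: (@integrable_mkcond _ _ _ mu D (EFin \o _) mD).2.
  rewrite restrict_EFin; apply: eq_integrable iFD => // x _.
  by rewrite /fubini_F FD.
- have := Fubini iF.
  under eq_integral do rewrite FD.
  under [in RHS]eq_integral do rewrite FE.
  move=> H; rewrite Rintegral_mkcond [RHS]Rintegral_mkcond.
  exact: (congr1 fine H).
Qed.

End Fubini.

(** * Change of variables *)

Section ChangeOfVariables.
Context {R : realType}.
Local Notation mu := (@lebesgue_measure R).
Variables (D : set R) (P w : R -> R).
Hypotheses (mD : measurable D) (mP : measurable_fun setT P)
  (mw : measurable_fun D w) (w0 : forall x, D x -> 0 <= w x).
Hypothesis wP : forall a b : R, a < b ->
  (\int[mu]_(x in D `&` P @^-1` `]a, b]) (w x)%:E)%E = (b - a)%:E.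

Let mPre (A : set R) : measurable A ->
  measurable (D `&` P @^-1` A : set (measurableTypeR R)).
Proof. by move=> mA; apply: measurableI => //; rewrite -[X in measurable X]setTI; exact: mP. Qed.

Let nu (A : set R) : \bar R := (\int[mu]_(x in D `&` P @^-1` A) (w x)%:E)%E.

Let nu0 : nu set0 = 0%E.
Proof. by rewrite /nu preimage_set0 setI0 integral_set0. Qed.

Let nu_ge0 A : (0 <= nu A)%E.
Proof. by apply: integral_ge0 => x [Dx _]; rewrite lee_fin w0. Qed.

Let nu_additive : semi_sigma_additive (nu : set (measurableTypeR R) -> \bar R).
Proof.
move=> A mA tA mUA; rewrite /nu preimage_bigcup setI_bigcupr ge0_integral_bigcup//=.
- apply: is_cvg_ereal_nneg_natsum_cond => n _ _; exact: nu_ge0.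
- by move=> k; exact: (mPre (mA k)).
- apply/measurable_EFinP; apply: measurable_funS mw => //.
  by move=> x [n _ []].
- by move=> x [n _ [Dx _]]; rewrite lee_fin w0.
- apply/trivIsetP => i j _ _ ij; move/trivIsetP : tA => /(_ i j I I ij) Aij.
  rewrite -setIIr -preimage_setI (_ : A i `&` A j = set0)//.
  by rewrite preimage_set0 setI0.
Qed.

Let cov_measure A : measurable A -> mu A = nu A.
Proof.
move=> mA.
pose m : {measure set (measurableTypeR R) -> \bar R} :=
  HB.pack (nu : set (measurableTypeR R) -> \bar R)
    (isMeasure.Build _ _ _ (nu : set (measurableTypeR R) -> \bar R) nu0 nu_ge0 nu_additive).
apply: (@lebesgue_measure_unique R m) => // _ [[a b] _ <-]/=.
rewrite /nu; have [ab|ba] := ltP a b.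
  by rewrite wP// lebesgue_measure_itv/= lte_fin ab.
by rewrite set_itv_ge ?bnd_simp -?leNgt// measure0 preimage_set0 setI0 integral_set0.
Qed.

Import HBNNSimple.

(** The push-forward by P of the measure w dx on D agrees with the Lebesgue
    measure on half-open intervals, hence is the Lebesgue measure. Stating the
    hypothesis on intervals covers affine maps and the stereographic projection
    alike. *)
Lemma cov_ge0 (f : R -> \bar R) : measurable_fun setT f -> (forall x, 0 <= f x)%E ->
  (\int[mu]_x f x = \int[mu]_(x in D) (f (P x) * (w x)%:E))%E.
Proof.
move=> mf f0.
pose h := nnsfun_approx measurableT mf.
have mhP n : measurable_fun D (fun x => h n (P x)).
  by apply: measurable_funTS; apply: measurableT_comp.
have fE x : f x = lim ((EFin \o h n) x @[n --> \oo]).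
  by apply/esym/cvg_lim => //; exact: cvg_nnsfun_approx.
have -> : (\int[mu]_x f x)%E = lim ((\int[mu]_x (h n x)%:E)%E @[n --> \oo]).
  under eq_integral do rewrite fE.
  apply: monotone_convergence => //.
  - by move=> n; apply/measurable_EFinP; have := @measurable_funPT _ _ _ _ (h n).
  - by move=> n x _ /=; rewrite lee_fin.
  - by move=> x _ a b ab; rewrite lee_fin; exact: (lefP _ _ (nd_nnsfun_approx measurableT mf ab)).
have -> : (\int[mu]_(x in D) (f (P x) * (w x)%:E))%E =
    lim ((\int[mu]_(x in D) (h n (P x) * w x)%:E)%E @[n --> \oo]).
  have fg x : (f (P x) * (w x)%:E)%E = lim (((h n (P x))%:E * (w x)%:E)%E @[n --> \oo]).
    apply/esym/cvg_lim => //; apply: cvgeZr => //; exact: cvg_nnsfun_approx.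
  under eq_integral do rewrite fg.
  under [in RHS]eq_fun => n do under eq_integral do rewrite EFinM.
  apply: monotone_convergence => //.
  - move=> n; by apply: emeasurable_funM; apply: meas_EFin.
  - by move=> n x Dx /=; rewrite -EFinM lee_fin mulr_ge0// w0.
  - move=> x Dx a b ab; rewrite -!EFinM lee_fin ler_wpM2r// ?w0//.
    exact: (lefP _ _ (nd_nnsfun_approx measurableT mf ab)).
suff suf n : (\int[mu]_x (h n x)%:E = \int[mu]_(x in D) (h n (P x) * w x)%:E)%E.
  by under eq_fun do rewrite suf.
transitivity (\int[mu]_x (\sum_(y \in range (h n)) (y * \1_(h n @^-1` [set y]) x)%:E))%E.
  by apply: eq_integral => t tE; rewrite /= fimfunE -fsumEFin.
have mh y : measurable (h n @^-1` [set y]) by exact: measurable_sfunP.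
rewrite ge0_integral_fsum//; last 2 first.
- move=> r; apply/measurable_EFinP; apply: measurable_funM => //.
  exact: (measurable_indic (mh r)).
- by move=> m y Ey; exact: nnfun_muleindic_ge0.
transitivity (\int[mu]_(x in D) (\sum_(y \in range (h n))
    (y * \1_(h n @^-1` [set y]) (P x) * w x)%:E))%E; last first.
  apply: eq_integral => t tE; rewrite fsumEFin//; congr EFin.
  by rewrite [in RHS]fimfunE mulr_fsuml.
rewrite ge0_integral_fsum//; last 2 first.
- move=> r; apply/measurable_EFinP; apply: measurable_funM => //.
  apply: measurable_funM => //; apply: measurable_funTS.
  by apply: measurableT_comp => //; exact: measurable_indic.
- move=> y x Dx; rewrite EFinM mule_ge0// ?lee_fin ?w0//.
  by have := nnfun_muleindic_ge0 (h n) y (P x); rewrite -EFinM lee_fin.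
apply: eq_fsbigr => y /[!inE] -[x0 _ hy].
have y0 : 0 <= y by rewrite -hy.
under eq_integral do rewrite EFinM.
rewrite ge0_integralZl//; last first.
  by apply/measurable_EFinP; exact: (measurable_indic (mh y)).
rewrite (integral_indic mu measurableT (mh y)) setIT.
transitivity (y%:E * nu (h n @^-1` [set y]))%E.
  by congr (_ * _)%E; exact: (cov_measure (mh y)).
rewrite /nu.
under [in RHS]eq_integral do rewrite -mulrA EFinM.
rewrite ge0_integralZl//; last 2 first.
- apply/measurable_EFinP; apply: measurable_funM => //; apply: measurable_funTS.
  by apply: measurableT_comp => //; exact: measurable_indic.
- by move=> x Dx; rewrite lee_fin mulr_ge0// w0.
congr (_ * _)%E; rewrite integral_mkcondr; apply: eq_integral => x _.
rewrite patchE indicE; case: ifPn => xP.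
  by rewrite mem_set ?mul1r//; rewrite inE in xP.
by rewrite memNset ?mul0r//; rewrite notin_setE in xP.
Qed.

Lemma cov_intg (f : R -> R) : measurable_fun setT f ->
  intg setT f <-> intg D (fun x => f (P x) * w x).
Proof.
move=> mf; rewrite /intg; split => /integrableP[mf' fy]; apply/integrableP; split.
- apply/measurable_EFinP; apply: measurable_funM => //; apply: measurable_funTS.
  by apply: measurableT_comp.
- move: fy; rewrite cov_ge0//; last by apply: measurableT_comp.
  congr (_ < _)%E; apply: eq_integral => x; rewrite inE => Dx.
  by rewrite /= normrM (ger0_norm (w0 _)).
- exact/measurable_EFinP.
- rewrite cov_ge0//; last by apply: measurableT_comp => //; exact/measurable_EFinP.
  move: fy; congr (_ < _)%E; apply: eq_integral => x; rewrite inE => Dx.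
  by rewrite /= normrM (ger0_norm (w0 _)).
Qed.

Lemma cov_Rint (f : R -> R) : measurable_fun setT f ->
  (\int[mu]_x f x = \int[mu]_(x in D) (f (P x) * w x))%R.
Proof.
move=> mf; rewrite /Rintegral; congr fine.
rewrite integralE [RHS]integralE.
rewrite cov_ge0//; last by apply/measurable_funepos; exact/measurable_EFinP.
rewrite [X in (_ - X)%E]cov_ge0//; last by apply/measurable_funeneg; exact/measurable_EFinP.
congr (_ - _)%E; apply: eq_integral => x; rewrite inE => Dx.
  by rewrite !funeposE /= -!EFin_max -EFinM maxr_pMl ?w0// mul0r.
by rewrite !funenegE /= -?EFinN -!EFin_max -EFinM maxr_pMl ?w0// mul0r mulNr.
Qed.

End ChangeOfVariables.

(** * Translations, dilations and periods *)

Section Affine.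
Context {R : realType}.
Local Notation mu := (@lebesgue_measure R).
Implicit Types f : R -> R.

Let affineP (a b : R) : 0 < a -> forall c d : R, c < d ->
  (\int[mu]_(x in setT `&` (fun x => a * x + b)%R @^-1` `]c, d]) (cst a x : R)%:E)%E = (d - c)%:E.
Proof.
move=> a0 c d cd; rewrite setTI.
rewrite (_ : _ @^-1` _ = `](c - b) / a, (d - b) / a]%classic); last first.
  apply/seteqP; split=> x /=; rewrite !in_itv/= ltr_pdivrMr// ler_pdivlMr// => /andP[? ?];
    apply/andP; split; lra.
rewrite (integral_cst mu _ (EFin _))//= lebesgue_measure_itv/= lte_fin ltr_pM2r ?invr_gt0// ltrD2r cd.
by rewrite -EFinD -EFinM; congr EFin; field; rewrite gt_eqF.
Qed.

Let oppP (c d : R) : c < d ->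
  (\int[mu]_(x in setT `&` (-%R) @^-1` `]c, d]) (cst 1 x : R)%:E)%E = (d - c)%:E.
Proof.
move=> cd; rewrite setTI.
rewrite (_ : _ @^-1` _ = `[- d, - c[%classic); last first.
  by apply/seteqP; split=> x /=; rewrite !in_itv/= => /andP[? ?];
    apply/andP; split; lra.
rewrite (integral_cst mu _ (EFin _))//= lebesgue_measure_itv/= lte_fin ltrN2 cd.
by rewrite -EFinD -EFinM; congr EFin; ring.
Qed.

Lemma intg_affine f (a b : R) : 0 < a -> measurable_fun setT f ->
  intg setT f <-> intg setT (fun x => f (a * x + b) * a).
Proof.
move=> a0 mf; apply: (@cov_intg R setT (fun x => a * x + b) (cst a)) => //.
- by apply: measurable_funD => //; exact: measurable_funM.
- by move=> x _; exact: ltW.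
- exact: affineP.
Qed.

Lemma Rint_affine f (a b : R) : 0 < a -> measurable_fun setT f ->
  (\int[mu]_x f x = \int[mu]_x (f (a * x + b) * a))%R.
Proof.
move=> a0 mf; apply: (@cov_Rint R setT (fun x => a * x + b) (cst a)) => //.
- by apply: measurable_funD => //; exact: measurable_funM.
- by move=> x _; exact: ltW.
- exact: affineP.
Qed.

Lemma Rint_shift f (b : R) : measurable_fun setT f ->
  (\int[mu]_x f x = \int[mu]_x f (x + b))%R.
Proof.
by move=> mf; rewrite (@Rint_affine f 1 b)//; apply: eq_Rint => x _; rewrite mul1r mulr1.
Qed.

Lemma intg_shift f (b : R) : measurable_fun setT f ->
  intg setT f -> intg setT (fun x => f (x + b)).
Proof.
move=> mf /(@intg_affine f 1 b ltr01 mf); apply: eq_intg => // x _.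
by rewrite mul1r mulr1.
Qed.

Let mopp : measurable_fun setT (-%R : R -> R).
Proof. exact: oppr_measurable. Qed.

Lemma Rint_opp f : measurable_fun setT f ->
  (\int[mu]_x f x = \int[mu]_x f (- x))%R.
Proof.
move=> mf; rewrite (@cov_Rint R setT (-%R) (cst 1) measurableT mopp _ _ oppP f)//.
by apply: eq_Rint => x _; rewrite /= mulr1.
Qed.

Lemma intg_opp f : measurable_fun setT f -> intg setT f -> intg setT (fun x => f (- x)).
Proof.
move=> mf /(@cov_intg R setT (-%R) (cst 1)) H.
have := H measurableT mopp (measurable_cst _) (fun _ _ => ler01) oppP mf.
by apply: eq_intg => // x _; rewrite /= mulr1.
Qed.

Lemma Rint_shiftD (D : set R) f b : measurable D -> measurable_fun setT f ->
  (\int[mu]_(x in D) f (x + b) = \int[mu]_(x in (fun x => x - b) @^-1` D) f x)%R.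
Proof.
move=> mD mf.
have mD' : measurable ((fun x => x - b) @^-1` D).
  rewrite -[X in measurable X]setTI.
  by apply: (measurable_funD (@measurable_id _ _ _) (measurable_cst (- b))).
rewrite Rintegral_mkcond [RHS]Rintegral_mkcond [RHS](@Rint_shift _ b).
  apply: eq_Rint => x _; rewrite !patchE.
  have -> // : (x + b \in (fun x => x - b) @^-1` D) = (x \in D).
  by apply/idP/idP; rewrite !inE /preimage/= addrK.
by apply/(measurable_restrictT _ _).1 => //; exact: measurable_funTS.
Qed.

(** Pairs x with -x, which lets odd parts cancel before absolute values are
    taken. *)
Lemma Rint_even0 f : measurable_fun setT f -> intg setT f ->
  (\int[mu]_x f x = \int[mu]_(x in `[0%R, +oo[) (f x + f (- x)))%R.
Proof.
move=> mf If.
have IfN := intg_opp mf If.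
rewrite RintegralD//; last 2 first.
- exact: intgS If.
- exact: intgS IfN.
have -> : [set: R] = `[0, +oo[ `|` `]-oo, 0[.
  apply/seteqP; split=> x //= _; rewrite !in_itv/= andbT.
  by case: (leP 0 x) => ?; [left|right].
rewrite Rintegral_setU//.
- congr (_ + _); rewrite Rintegral_mkcond Rint_opp; last first.
    by apply/(measurable_restrictT _ _).1 => //; exact: measurable_funTS.
  rewrite -(@Rintegral_itv_obnd_cbnd _ 0 +oo%O (fun x => f (- x))); last first.
    exact: intgS IfN.
  rewrite [RHS]Rintegral_mkcond; apply: eq_Rint => x _; rewrite !patchE.
  by rewrite !mem_setE !in_itv/= oppr_lt0 andbT.
- by rewrite (_ : _ `|` _ = setT)//; apply/seteqP; split=> x //= _; rewrite !in_itv/= andbT;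
    case: (leP 0 x) => ?; [left|right].
- by apply/disj_setPS => x [] /=; rewrite !in_itv/= andbT leNgt => /negP.
Qed.

(** Moving the base point by less than a period exchanges two pieces that are
    translates of each other by p; longer moves are iterated. *)
Lemma period_shift f (C p a b : R) : 0 < p -> measurable_fun setT f ->
  (forall x, `|f x| <= C) -> (forall x, f (x + p) = f x) ->
  (\int[mu]_(x in `[a, a + p[) f x = \int[mu]_(x in `[b, b + p[) f x)%R.
Proof.
move=> p0 mf fC fp.
have If (u v : R) : intg `[u, v[ f.
  apply: (@intg_bounded _ _ _ C) => //; first exact: mu_itv_lty.
  exact: measurable_funTS.
pose Phi (c : R) := (\int[mu]_(x in `[c, (c + p)%R[) f x)%R.
have split3 u v w : u <= v -> v <= w ->
    (\int[mu]_(x in `[u, w[) f x = \int[mu]_(x in `[u, v[) f x + \int[mu]_(x in `[v, w[) f x)%R.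
  move=> uv vw; rewrite -Rintegral_setU//.
  - congr (Rintegral _ _ _).
    by apply: itv_bndbnd_setU; rewrite bnd_simp.
  - by rewrite -itv_bndbnd_setU ?bnd_simp//; exact: If.
  - by apply/disj_setPS => x [] /=; rewrite !in_itv/= => /andP[_ xv] /andP[]; rewrite leNgt xv.
have step c d : c <= d -> d <= c + p -> Phi c = Phi d.
  move=> cd dc; rewrite /Phi (split3 c d (c + p))// (split3 d (c + p) (d + p))//; last lra.
  rewrite addrC; congr (_ + _).
  transitivity (\int[mu]_(x in `[c, d[) f (x + p))%R.
    by apply: eq_Rint => x _; rewrite fp.
  rewrite Rint_shiftD//; congr (Rintegral _ _ _).
  by apply/seteqP; split => x /=; rewrite !in_itv/= => /andP[? ?]; apply/andP; split; lra.
have main n : forall c d, c <= d -> d <= c + n%:R * p -> Phi c = Phi d.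
  elim: n => [|n IH] c d cd dc.
    by congr Phi; lra.
  have [dp|pd] := leP d (c + p); first exact: step.
  rewrite (step c (c + p))//; [|lra]; apply: IH; first exact: ltW.
  by rewrite -natr1 in dc; lra.
have big c d : c <= d -> Phi c = Phi d.
  move=> cd; have [n hn] : exists n : nat, (d - c) / p <= n%:R.
    exists (Num.truncn ((d - c) / p)).+1; apply/ltW.
    have d0 : 0 <= (d - c) / p by apply: divr_ge0; lra.
    by have /andP[] := truncn_itv d0.
  by apply: (main n) => //; rewrite ler_pdivrMr// in hn; lra.
by case: (leP a b) => [/big//|/ltW/big].
Qed.

End Affine.

(** * Smooth functions *)

Section Smooth.
Context {R : realType}.
Implicit Types (f g : R -> R) (x y : R).

(** A local form of n-fold differentiability. [rsmooth] quantifies over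
    iterated global derivatives, which do not follow the shape of an
    expression; this predicate does, being stable under products, composition
    and inverses at a point. *)
Fixpoint Cn (n : nat) f x : Prop :=
  if n is n'.+1 then (\forall y \near x, derivable f y 1) /\ Cn n' (derive1 f) x
  else True.

Lemma near_all (P : R -> Prop) x : (forall y, P y) -> \forall y \near x, P y.
Proof. by move=> H; exact: filterE. Qed.

Lemma Cn_near n f g x : (\forall y \near x, f y = g y) -> Cn n f x -> Cn n g x.
Proof.
elim: n f g => [//|n IH] f g fg [df cf]; split.
- apply: filterS2 (near_join fg) df => y fgy dfy.
  exact: (near_eq_derivable fgy dfy).
- apply: IH cf; apply: filterS (near_join fg) => y fgy.
  by rewrite !derive1E; apply: near_eq_derive.
Qed.

Lemma CnS n f x : Cn n.+1 f x -> Cn n f x.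
Proof. by elim: n f => [//|n IH] f [df /IH]. Qed.

Lemma Cn_cst n (c : R) x : Cn n (cst c) x.
Proof.
elim: n c => [//|n IH] c; split; first by apply: near_all => y; exact: derivable_cst.
apply: (Cn_near _ (IH 0)); apply: near_all => y.
by rewrite derive1E derive_cst.
Qed.

Lemma Cn_id n x : Cn n id x.
Proof.
case: n => [//|n]; split; first by apply: near_all => y; exact: derivable_id.
apply: (Cn_near _ (Cn_cst n 1 x)); apply: near_all => y.
by rewrite derive1E derive_id.
Qed.

Lemma CnD n f g x : Cn n f x -> Cn n g x -> Cn n (fun y => f y + g y) x.
Proof.
elim: n f g => [//|n IH] f g [df cf] [dg cg]; split.
  by apply: filterS2 df dg => y *; exact: derivableD.
apply: Cn_near (IH _ _ cf cg); apply: filterS2 df dg => y dfy dgy.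
by rewrite !derive1E deriveD.
Qed.

Lemma CnM n f g x : Cn n f x -> Cn n g x -> Cn n (fun y => f y * g y) x.
Proof.
elim: n f g => [//|n IH] f g Cf Cg; have [df cf] := Cf; have [dg cg] := Cg; split.
  by apply: filterS2 df dg => y *; exact: derivableM.
apply: Cn_near (CnD (IH _ _ cf (CnS Cg)) (IH _ _ (CnS Cf) cg)).
apply: filterS2 df dg => y dfy dgy.
rewrite !derive1E [RHS](deriveM dfy dgy) /GRing.scale/= addrC.
by congr (_ + _); rewrite mulrC.
Qed.

Lemma CnN n f x : Cn n f x -> Cn n (fun y => - f y) x.
Proof.
move=> Cf; apply: Cn_near (CnM (Cn_cst n (-1) x) Cf).
by apply: near_all => y; rewrite mulN1r.
Qed.

Lemma CnB n f g x : Cn n f x -> Cn n g x -> Cn n (fun y => f y - g y) x.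
Proof. by move=> Cf Cg; apply: CnD => //; exact: CnN. Qed.

Lemma Cn_exp n f (k : nat) x : Cn n f x -> Cn n (fun y => f y ^+ k) x.
Proof.
move=> Cf; elim: k => [|k IH].
  by apply: Cn_near (Cn_cst n 1 x); apply: near_all => y; rewrite expr0.
by apply: Cn_near (CnM Cf IH); apply: near_all => y; rewrite exprS.
Qed.

Lemma derivable_cont f x : derivable f x 1 -> {for x, continuous f}.
Proof. by move=> /derivable1_diffP/differentiable_continuous. Qed.

(** By induction on n: the chain rule expresses the derivative through a
    composition and a product of lower order. *)
Lemma Cn_comp n f g x : Cn n f (g x) -> Cn n g x -> Cn n (fun y => f (g y)) x.
Proof.
elim: n f g => [//|n IH] f g Cf Cg; have [df cf] := Cf; have [dg cg] := Cg.
have cgx : {for x, continuous g} by exact/derivable_cont/(nbhs_singleton dg).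
have dfg : \forall y \near x, derivable f (g y) 1 by exact: (cgx _ df).
split.
  apply: filterS2 dfg dg => y dfy dgy.
  apply/derivable1_diffP; apply: (@differentiable_comp _ _ _ _ g f).
    exact/derivable1_diffP.
  exact/derivable1_diffP.
apply: Cn_near (CnM (IH _ _ cf (CnS Cg)) cg).
apply: filterS2 dfg dg => y dfy dgy.
exact/esym/(derive1_comp dgy dfy).
Qed.

Lemma CnV n f x : f x != 0 -> Cn n f x -> Cn n (fun y => (f y)^-1) x.
Proof.
elim: n f => [//|n IH] f fx0 Cf; have [df cf] := Cf.
have cfx : {for x, continuous f} by exact/derivable_cont/(nbhs_singleton df).
have f0 : \forall y \near x, f y != 0.
  by apply: (cfx [set z | z != 0]); apply: open_nbhs_nbhs; split=> //; exact: open_neq.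
split.
  by apply: filterS2 f0 df => y fy0 dfy; exact: derivableV.
apply: Cn_near (CnN (CnM (Cn_exp 2 (IH _ fx0 (CnS Cf))) cf)).
apply: filterS2 f0 df => y fy0 dfy.
by rewrite !derive1E deriveV// /GRing.scale/= exprVn mulNr.
Qed.

Lemma Cn_sincos n x : Cn n (@sin R) x /\ Cn n (@cos R) x.
Proof.
elim: n => [//|n [IHs IHc]]; split; split.
- by apply: near_all => y; exact: derivable_sin.
- apply: Cn_near IHc; apply: near_all => y.
  by rewrite derive1E derive_val.
- by apply: near_all => y; exact: derivable_cos.
- apply: Cn_near (CnN IHs); apply: near_all => y.
  by rewrite derive1E derive_val.
Qed.

Lemma Cn_atan n x : Cn n (@atan R) x.
Proof.
case: n => [//|n]; split; first by apply: near_all => y; exact: derivable_atan.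
apply: (@Cn_near _ (fun y => (1 + y ^+ 2)^-1)).
  by apply: near_all => y; rewrite derive1_atan.
apply: CnV; first by rewrite gt_eqF// ltr_pwDl// sqr_ge0.
by apply: CnD; [exact: Cn_cst|apply: Cn_exp; exact: Cn_id].
Qed.

Lemma rsmooth_derive1 f : rsmooth f -> rsmooth (derive1 f).
Proof. by move=> sf n x; rewrite -derive1Sn; exact: sf. Qed.

Lemma rsmooth_derivable f x : rsmooth f -> derivable f x 1.
Proof. by move=> sf; exact: (sf 0%N). Qed.

Lemma rsmooth_is_derive f x : rsmooth f -> is_derive x 1 f ((derive1 f) x).
Proof. by move=> sf; rewrite derive1E; apply: derivableP; exact: (sf 0%N). Qed.

Lemma rsmooth_cont f : rsmooth f -> continuous f.
Proof. by move=> sf x; apply: derivable_cont; exact: rsmooth_derivable. Qed.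

Lemma rsmooth_derive1n f n : rsmooth f -> rsmooth (derive1n n f).
Proof. by elim: n => [//|n IH] /IH/rsmooth_derive1; rewrite derive1nS. Qed.

Lemma rsmooth_Cn f n x : rsmooth f -> Cn n f x.
Proof.
elim: n f => [//|n IH] f sf; split; last exact/IH/rsmooth_derive1.
by apply: near_all => y; exact: rsmooth_derivable.
Qed.

Lemma Cn_rsmooth f : (forall n x, Cn n f x) -> rsmooth f.
Proof.
move=> Cf n; elim: n f Cf => [|n IH] f Cf x.
  by have [/nbhs_singleton] := Cf 1%N x.
rewrite derive1Sn; apply: IH => k y.
by have [] := Cf k.+1 y.
Qed.

Lemma rsmoothP f : rsmooth f <-> forall n x, Cn n f x.
Proof. by split=> [sf n x|]; [exact: rsmooth_Cn|exact: Cn_rsmooth]. Qed.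

Lemma rsmooth_sin : rsmooth (@sin R).
Proof. by apply: Cn_rsmooth => n x; exact: (Cn_sincos n x).1. Qed.

Lemma rsmooth_cos : rsmooth (@cos R).
Proof. by apply: Cn_rsmooth => n x; exact: (Cn_sincos n x).2. Qed.

Lemma rsmooth_cst (c : R) : rsmooth (fun _ : R => c).
Proof. by apply: Cn_rsmooth => n x; exact: Cn_cst. Qed.

Lemma rsmoothD f g : rsmooth f -> rsmooth g -> rsmooth (fun x => f x + g x).
Proof. by move=> sf sg; apply: Cn_rsmooth => n x; apply: CnD; exact: rsmooth_Cn. Qed.

Lemma rsmoothB f g : rsmooth f -> rsmooth g -> rsmooth (fun x => f x - g x).
Proof. by move=> sf sg; apply: Cn_rsmooth => n x; apply: CnB; exact: rsmooth_Cn. Qed.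

Lemma rsmoothM f g : rsmooth f -> rsmooth g -> rsmooth (fun x => f x * g x).
Proof. by move=> sf sg; apply: Cn_rsmooth => n x; apply: CnM; exact: rsmooth_Cn. Qed.

Lemma rsmoothV f : (forall x, f x != 0) -> rsmooth f -> rsmooth (fun x => (f x)^-1).
Proof. by move=> f0 sf; apply: Cn_rsmooth => n x; apply: CnV => //; exact: rsmooth_Cn. Qed.

Lemma rsmooth_comp f g : rsmooth f -> rsmooth g -> rsmooth (fun x => f (g x)).
Proof. by move=> sf sg; apply: Cn_rsmooth => n x; apply: Cn_comp; exact: rsmooth_Cn. Qed.

Lemma rsmooth_atan : rsmooth (@atan R).
Proof. by apply: Cn_rsmooth => n x; exact: Cn_atan. Qed.

(** Each derivative vanishes where f does, so that the weighted derivatives are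
    continuous with compact support, hence bounded. *)
Lemma compact_support_rschwartz f (M : R) :
  rsmooth f -> (forall x, M < `|x| -> f x = 0) -> rschwartz f.
Proof.
move=> sf f0; split=> // m n.
have dnf0 x : M < `|x| -> derive1n n f x = 0.
  elim: n x => [|n IH] x Mx; first exact: f0.
  rewrite derive1nS derive1E (@near_eq_derive _ _ _ _ (cst 0)) ?derive_cst//.
  have : \forall y \near x, M < `|y|.
    have cn : {for x, continuous (fun y : R => `|y|)} by exact: norm_continuous.
    by apply: (cn [set z | M < z]); apply: open_nbhs_nbhs; split => //; exact: open_gt.
  by apply: filterS => y /IH ->.
pose h (x : R) : R := `|x| ^+ m * `|derive1n n f x|.
have cD : continuous (derive1n n f) := rsmooth_cont (@rsmooth_derive1n f n sf).
have ch : continuous h.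
  move=> x; apply: cvgM.
    exact: (continuous_comp (@norm_continuous _ _ x) (@exprn_continuous R m _)).
  apply: (@cvg_norm _ _ _ _ _ (derive1n n f)); exact: cD.
have [M0|M0] := leP 0 M; last first.
  by exists 0 => x; rewrite dnf0 ?normr0 ?mulr0// (lt_le_trans M0).
have [c _ hc] := @EVT_max _ h (- M) M (ge0_cp M0).2 (continuous_subspaceT ch).
exists (h c) => x; have [xM|Mx] := leP `|x| M.
  by apply: hc; rewrite in_itv/= -ler_norml.
by rewrite dnf0// normr0 mulr0 /h mulr_ge0// exprn_ge0.
Qed.

End Smooth.

(** * A smooth function that is flat at the origin *)

Section Bump.
Context {R : realType}.

(** y^-k exp (-1/y) on the positive axis. The derivative of a member of this
    family is a combination of two others, so that smoothness is an induction
    on the order only. *)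
Definition bumpk (k : nat) (y : R) : R := if 0 < y then y^-1 ^+ k * expR (- y^-1) else 0.

Definition bump := bumpk 0.

Lemma expR_decay (k : nat) (z : R) : 0 <= z -> z ^+ k.+1 * expR (- z) <= (k.+1)`!%:R.
Proof.
move=> z0; rewrite expRN ler_pdivrMr ?expR_gt0//.
have := expR_ge1Dxn k z0; have := @ltr0n R (k.+1)`!; rewrite fact_gt0 => f0.
move=> h; rewrite -ler_pdivrMl// mulrC; lra.
Qed.

Lemma bumpk_ge0 k y : 0 <= bumpk k y.
Proof.
rewrite /bumpk; case: ifPn => // y0; rewrite mulr_ge0 ?expR_ge0// exprn_ge0// invr_ge0 ltW//.
Qed.

Lemma bumpk_le k y : bumpk k y <= (k.+2)`!%:R * y ^+ 2.
Proof.
rewrite /bumpk; case: ifPn => y0; last by rewrite mulr_ge0// ?ler0n// sqr_ge0.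
have yV0 : 0 <= y^-1 by rewrite invr_ge0 ltW.
have := expR_decay k.+1 yV0.
rewrite -ler_pdivrMr ?exprn_gt0//; apply: le_trans.
by rewrite -exprVn -[k.+2]addn2 exprD mulrAC.
Qed.

(** A quadratic bound alone gives the derivative; it is what is known at the
    points where two definitions by cases meet. *)
Lemma is_derive_flat (f : R -> R) (y C : R) : (forall h : R, `|f (y + h)| <= C * h ^+ 2) ->
  is_derive y 1 f 0.
Proof.
move=> fC.
have fy : f y = 0.
  by apply/eqP; rewrite -normr_eq0 eq_le normr_ge0 andbT; have := fC 0; rewrite addr0 expr0n mulr0.
have H : (fun h : R => h^-1 *: ((f \o shift y) (h *: 1) - f y)) @ 0^' --> (0 : R).
  have cvg0 : (fun h : R => C * `|h|) @ 0^' --> (0 : R).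
    rewrite -[X in _ --> X](mulr0 C); apply: cvgM; first exact: cvg_cst.
    rewrite -[X in _ --> X](@normr0 _ R); apply: cvg_within_filter; exact: norm_continuous.
  apply: (@squeeze_cvgr _ _ _ _ (fun h : R => - (C * `|h|)) (fun h : R => C * `|h|)) => //.
  + near=> h.
    have h0 : h != 0 by near: h; exact: nbhs_dnbhs_neq.
    rewrite -ler_norml /= /GRing.scale/= mulr1 fy subr0 addrC.
    rewrite normrM normfV ler_pdivrMl ?normr_gt0// (le_trans (fC _))//.
    by rewrite -[h ^+ 2]real_normK ?num_real// expr2 mulrCA.
  + by rewrite -[X in _ --> X]oppr0; apply: cvgN.
apply: DeriveDef; first by apply/cvg_ex; exists 0.
exact: cvg_lim.
Unshelve. all: by end_near. Qed.

Lemma bumpk_derive (k : nat) (y : R) : is_derive y 1 (bumpk k) (bumpk k.+2 y - k%:R * bumpk k.+1 y).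
Proof.
case: (ltgtP 0 y) => [y0|y0|<-].
- pose F (z : R) := z^-1 ^+ k * expR (- z^-1).
  have dV : is_derive y 1 (fun z : R => z^-1) (- (y^-1 ^+ 2)).
    have := @is_deriveV R id y 1 1; rewrite /= gt_eqF// => /(_ isT _) H.
    by move: H; rewrite exprVn /GRing.scale/= mulr1.
  have dF : is_derive y 1 F (bumpk k.+2 y - k%:R * bumpk k.+1 y).
    have dX : is_derive y 1 (fun z : R => z^-1 ^+ k) (k%:R * y^-1 ^+ k.-1 * - (y^-1 ^+ 2)).
      rewrite (_ : (fun z : R => _) = (GRing.inv : R -> R) ^+ k); last first.
        by apply/funext => z; rewrite exprfctE.
      by apply: is_derive_eq; rewrite /GRing.scale/= -mulr_natl.
    have dE : is_derive y 1 (fun z : R => expR (- z^-1)) (expR (- y^-1) * y^-1 ^+ 2).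
      have dN : is_derive y 1 (fun z : R => - z^-1) (y^-1 ^+ 2).
        by rewrite -[y^-1 ^+ 2]opprK; exact: is_deriveN.
      exact: (@is_derive1_comp _ expR (fun z : R => - z^-1)).
    have H := is_deriveM dX dE.
    apply: (@is_derive_eq _ _ _ _ _ _ _ _ H).
    rewrite /bumpk y0 /GRing.scale/=.
    clear; move: (y^-1) (expR _) => z e; case: k => [|k]; first by rewrite !mul0r; ring.
    by move: k.+1%:R => c /=; rewrite !exprS; ring.
  apply: near_eq_is_derive dF.
  near=> z; rewrite /bumpk /F ifT//; near: z; exact: lt_nbhsr.
- rewrite /bumpk !ltNge (ltW y0)/= mulr0 subr0.
  apply: near_eq_is_derive (dC 0 y).
  near=> z; rewrite ltNge ifF//; apply/negbTE; rewrite negbK ltW//.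
  near: z; exact: lt_nbhsl.
- have -> : bumpk k.+2 0 - k%:R * bumpk k.+1 0 = 0.
    by rewrite /bumpk ltxx mulr0 subr0.
  apply: (@is_derive_flat _ _ (k.+2)`!%:R) => h; rewrite add0r.
  by rewrite ger0_norm ?bumpk_ge0// bumpk_le.
Unshelve. all: by end_near. Qed.

Lemma Cn_bumpk n k y : Cn n (bumpk k) y.
Proof.
elim: n k => [//|n IH] k; split.
  by apply: near_all => z; have dz := bumpk_derive k z; exact: ex_derive.
apply: (@Cn_near _ _ (fun z => bumpk k.+2 z - k%:R * bumpk k.+1 z)).
  apply: near_all => z; rewrite derive1E; apply/esym.
  by have dz := bumpk_derive k z; exact: derive_val.
by apply: CnB => //; apply: CnM => //; exact: Cn_cst.
Qed.

Lemma rsmooth_bump : rsmooth bump.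
Proof. by apply: Cn_rsmooth => n x; exact: Cn_bumpk. Qed.

End Bump.

(** * The half-Laplacian of the circle as a singular integral *)

Section MeasInv.
Context {R : realType}.
Lemma meas_inv : measurable_fun setT (fun x : R => x^-1).
Proof.
rewrite (_ : setT = [set~ (0:R)] `|` [set 0]); last first.
  by apply/seteqP; split=> x //= _; case: (eqVneq x 0) => [->|/eqP ?]; [right|left].
apply/measurable_funU => //; first exact: measurableC.
split; last exact: measurable_fun_set1.
apply: open_continuous_measurable_fun; first exact/closed_openC/closed_eq.
by move=> x; rewrite inE/= => /eqP x0; exact: inv_continuous.
Qed.
Lemma measV (D : set R) (f : R -> R) : measurable_fun D f -> measurable_fun D (fun x => (f x)^-1).
Proof. by move=> mf; exact: (measurableT_comp meas_inv). Qed.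
End MeasInv.

Section Circle.
Context {R : realType}.
Local Notation mu := (@lebesgue_measure R).
Local Notation circle := (@circle R).
Local Notation mia := (@minus_i_angle R).
Implicit Types (th s t x y : R) (f psi : R -> R).

Definition per2pi f := forall t, f (t + 2 * pi) = f t.

Lemma pi2_gt0 : 0 < 2 * pi :> R. Proof. by rewrite mulr_gt0// pi_gt0. Qed.

Lemma measurable_circle : measurable circle.
Proof. exact: measurable_itv. Qed.
Hint Resolve measurable_circle : core.

Lemma mu_circle : mu circle = (2 * pi)%:E.
Proof.
rewrite /circle lebesgue_measure_itv/= lte_fin ltrDl pi2_gt0.
by rewrite -EFinB addrAC subrr add0r.
Qed.

Lemma mu_circle_lty : (mu circle < +oo)%E.
Proof. by rewrite mu_circle ltry. Qed.

Lemma intg_circle_bounded f (C : R) : measurable_fun setT f -> (forall t, `|f t| <= C) -> intg circle f.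
Proof.
move=> mf fC; apply: (@intg_bounded _ _ _ C) => //; first exact: mu_circle_lty.
exact: measurable_funTS.
Qed.

Lemma per_sin : per2pi (@sin R).
Proof. by move=> t; rewrite mulr_natl sinD2pi. Qed.
Lemma per_cos : per2pi (@cos R).
Proof. by move=> t; rewrite mulr_natl cosD2pi. Qed.

Lemma circle_shift f (C th : R) : measurable_fun setT f -> (forall t, `|f t| <= C) -> per2pi f ->
  (\int[mu]_(t in circle) f t = \int[mu]_(s in circle) f (th + s))%R.
Proof.
move=> mf fC pf.
under [RHS]eq_Rint do rewrite addrC.
rewrite Rint_shiftD// /circle.
rewrite (@period_shift _ f C (2 * pi) mia (mia + th))//; last exact: pi2_gt0.
congr (Rintegral _ _ _); apply/seteqP; split => t /=; rewrite !in_itv/= => /andP[? ?];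
  apply/andP; split; lra.
Qed.

Lemma circle_opp f (C : R) : measurable_fun setT f -> (forall t, `|f t| <= C) -> per2pi f ->
  (\int[mu]_(t in circle) f t = \int[mu]_(s in circle) f (- s))%R.
Proof.
move=> mf fC pf; rewrite [LHS]Rintegral_mkcond Rint_opp; last first.
  by apply/(measurable_restrictT _ _).1 => //; exact: measurable_funTS.
transitivity (\int[mu]_(x in `](- (mia + 2 * pi)), (- mia)]) f (- x))%R.
  rewrite [RHS]Rintegral_mkcond; apply: eq_Rint => x _; rewrite !patchE !mem_setE.
  congr (if _ then _ else _); rewrite !in_itv/=.
  by apply/andP/andP => -[? ?]; split; lra.
have mfN : measurable_fun setT (fun x => f (- x)) by apply: measurableT_comp.
have IfN (u v : R) (b c : bool) : intg [set` Interval (BSide b u) (BSide c v)] (fun x => f (- x)).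
  apply: (@intg_bounded _ _ _ C) => //; first exact: mu_itv_lty.
  exact: measurable_funTS.
have e1 := @Rintegral_itv_obnd_cbnd R (- (mia + 2 * pi)) (BRight (- mia)) (fun x => f (- x)) (IfN _ _ _ _).
have e2 := @Rintegral_itv_bndo_bndc R (BLeft (- (mia + 2 * pi))) (- mia) (fun x => f (- x)) (IfN _ _ _ _).
rewrite [LHS]e1 -[LHS]e2.
rewrite /circle (@period_shift _ (fun x => f (- x)) C (2 * pi) mia (- (mia + 2 * pi)))//.
- by rewrite (_ : - (mia + 2 * pi) + 2 * pi = - mia); last ring.
- exact: pi2_gt0.
- by move=> x; rewrite -[LHS]pf; congr f; ring.
Qed.

Lemma per_int f (k : int) t : per2pi f -> f (t + k%:~R * (2 * pi)) = f t.
Proof.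
move=> pf.
have key (n : nat) u : f (u + n%:R * (2 * pi)) = f u.
  elim: n => [|n IH]; first by rewrite mul0r addr0.
  by rewrite -[RHS]IH -[RHS]pf -natr1; congr f; ring.
case: k => n; first exact: key.
by rewrite NegzE mulrNz -[LHS](key n.+1); congr f; rewrite mulNr subrK.
Qed.

(** Bounds by 1 - cos s need only be proved for s in [-pi, pi]. *)
Lemma per_reduce s : exists s', `|s'| <= pi /\ forall f th, per2pi f -> f (th + s) = f (th + s').
Proof.
pose k := Num.floor ((s + pi) / (2 * pi)).
have /andP[k1 k2] := floor_itv ((s + pi) / (2 * pi)).
exists (s - k%:~R * (2 * pi)); split.
  rewrite ler_norml.
  move: k1 k2; rewrite -/k intrD ler_pdivlMr ?pi2_gt0// ltr_pdivrMr ?pi2_gt0//=.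
  by move=> k1 k2; apply/andP; split; lra.
by move=> f th pf; rewrite -[RHS](per_int k)//; congr f; ring.
Qed.

Lemma cos_pi4 : cos (pi / 4) ^+ 2 = 1 / 2 :> R.
Proof.
have : cos ((pi / 4) *+ 2) = 0 :> R.
  by rewrite -mulr_natr (_ : pi / 4 * 2%:R = pi / 2) ?cos_pihalf//; field.
rewrite cos_mulr2n; lra.
Qed.

(** A weak form of Jordan's inequality, obtained from the mean value theorem on
    [0, pi/4] and from monotonicity beyond. *)
Lemma sin_ge x : 0 <= x <= pi / 2 -> x ^+ 2 <= 8 * sin x ^+ 2.
Proof.
move=> /andP[x0 xpi].
have pi0 := @pi_gt0 R; have pih2 := @pihalf_lt2 R.
have c0 : 0 <= cos (pi / 4 : R) by apply: cos_ge0_pihalf; apply/andP; split; lra.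
have c2 := cos_pi4.
have s2 : sin (pi / 4 : R) ^+ 2 = 1 / 2 by rewrite sin2cos2 c2; lra.
(* cos is at least cos (pi / 4) on [0, pi/4]; beyond, sin is at least sin (pi /
   4). *)
have [x4|x4] := leP x (pi / 4).
  have [->|xn0] := eqVneq x 0; first by rewrite expr0n/= mulr_ge0// sqr_ge0.
  have xp : 0 < x by rewrite lt_def xn0.
  have [c cx] := MVT xp (fun z _ => is_derive_sin z) (continuous_subspaceT (@continuous_sin R)).
  rewrite sin0 !subr0 => ->.
  have cc : cos (pi / 4) <= cos c.
    by rewrite leNgt ltr_cos -?leNgt ?in_itv/=; move: cx; rewrite in_itv/= => /andP[? ?];
      try (apply/andP; split); lra.
  have : cos (pi / 4) ^+ 2 <= cos c ^+ 2 by rewrite lerXn2r// nnegrE//; lra.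
  rewrite c2 exprMn => h.
  have : 0 <= x ^+ 2 by exact: sqr_ge0.
  nra.
have s4 : 0 <= sin (pi / 4 : R) by apply: sin_ge0_pi; apply/andP; split; lra.
have ss : sin (pi / 4) <= sin x.
  by rewrite leNgt ltr_sin -?leNgt ?in_itv/= ?(ltW x4)//; apply/andP; split; lra.
have : sin (pi / 4) ^+ 2 <= sin x ^+ 2 by rewrite lerXn2r// nnegrE//; lra.
rewrite s2; nra.
Qed.

Lemma one_sub_cosE s : 1 - cos s = 2 * sin (s / 2) ^+ 2.
Proof.
have -> : cos s = cos ((s / 2) *+ 2) by congr cos; rewrite -mulr_natr; field.
by rewrite cos_mulr2n sin2cos2; ring.
Qed.

Lemma one_sub_cos_ge0 s : 0 <= 1 - cos s.
Proof. by rewrite subr_ge0 cos_le1. Qed.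

Lemma sqr_le_one_sub_cos s : `|s| <= pi -> s ^+ 2 <= 16 * (1 - cos s).
Proof.
move=> spi.
have h : 0 <= `|s| / 2 <= pi / 2 by apply/andP; split; [exact: divr_ge0|lra].
have := sin_ge h.
rewrite -(cos_norm s) (one_sub_cosE `|s|) exprMn real_normK ?num_real// exprVn; lra.
Qed.

(** The second-order remainder of psi at th, with sin s instead of s so as to
    be periodic in s. *)
Definition sin_rem psi th s := psi (th + s) - psi th - derive1 psi th * sin s.

(** C bounds psi, psi' and psi'' at once, which makes families of functions
    with the same C suitable for dominated convergence. *)
Definition C2per psi (C : R) :=
  [/\ forall x, derivable psi x 1, forall x, derivable (derive1 psi) x 1,
   forall x, `|psi x| <= C /\ `|derive1 psi x| <= C,
   forall x, `|derive1 (derive1 psi) x| <= C & per2pi psi].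

Lemma is_derive1 f x : derivable f x 1 -> is_derive x 1 f (derive1 f x).
Proof. by move=> df; rewrite derive1E; exact: derivableP. Qed.

Lemma taylor2 f f' f'' (C x s : R) : (forall x, is_derive x 1 f (f' x)) ->
  (forall x, is_derive x 1 f' (f'' x)) -> (forall x, `|f'' x| <= C) ->
  `|f (x + s) - f x - f' x * s| <= C * s ^+ 2.
Proof.
move=> df df' fC.
have C0 : 0 <= C by rewrite (le_trans _ (fC 0)).
pose g t := f (x + t) - f x - f' x * t.
have dg t : is_derive t 1 g (f' (x + t) - f' x).
  have H := dB (dB (dcomp (df (x + t)) (dD (dC x t) (dI t))) (dC (f x) t)) (dZ (f' x) (dI t)).
  apply: (is_derive_eq H).
  by rewrite add0r !mulr1 subr0.
have := @MVT_bound _ g (fun t => f' (x + t) - f' x) (C * `|s|) 0 s dg.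
rewrite {2}/g addr0 subrr mulr0 !subr0 -mulrA -expr2 real_normK ?num_real//; apply.
move=> z zs.
have := @MVT_bound _ f' f'' C x (x + z) df' (fun z _ => fC z).
rewrite (_ : x + z - x = z); last ring.
move=> /le_trans; apply; rewrite ler_wpM2l//.
move: zs; case: (leP 0 s) => s0 /andP[z1 z2].
  by rewrite !ger0_norm.
by rewrite !ler0_norm ?lerN2// ltW.
Qed.

Lemma sin_taylor s : `|sin s - s| <= s ^+ 2.
Proof.
have := @taylor2 (@sin R) (@cos R) (fun x => - sin x) 1 0 s _ _ _.
rewrite add0r sin0 cos0 subr0 !mul1r; apply.
by move=> x; rewrite normrN sin_max.
Qed.

Lemma derive1_per psi : per2pi psi -> per2pi (derive1 psi).
Proof.
move=> pp t; rewrite -{2}(_ : (fun t => psi (t + 2 * pi)) = psi); last exact/funext.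
rewrite !derive1E; apply: (congr1 (fun g : R -> R => lim (g @ 0^'))).
by apply/funext => h /=; rewrite addrA.
Qed.

(** The remainder is O(s^2) by Taylor's formula, and s^2 is O(1 - cos s) on a
    period. *)
Lemma sin_rem_le psi C th s : C2per psi C -> `|sin_rem psi th s| <= 32 * C * (1 - cos s).
Proof.
move=> [d1 d2 C01 C2 pp].
have C0 : 0 <= C by rewrite (le_trans _ (C2 0)).
have [s' [s'pi sE]] := per_reduce s.
have es : sin s = sin s' by have := sE _ 0 per_sin; rewrite !add0r.
have -> : cos s = cos s' by have := sE _ 0 per_cos; rewrite !add0r.
have -> : sin_rem psi th s = sin_rem psi th s' by rewrite /sin_rem es (sE psi).
have h1 := @taylor2 psi (derive1 psi) (derive1 (derive1 psi)) C th s'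
  (fun x => is_derive1 (d1 x)) (fun x => is_derive1 (d2 x)) C2.
have h2 := sin_taylor s'.
have h3 := sqr_le_one_sub_cos s'pi.
have h4 := (C01 th).2.
rewrite (_ : sin_rem psi th s' = (psi (th + s') - psi th - derive1 psi th * s')
   - derive1 psi th * (sin s' - s')); last by rewrite /sin_rem; ring.
apply: (le_trans (ler_normB _ _)); rewrite normrM.
have := ler_pM (normr_ge0 _) (normr_ge0 _) h4 h2.
nra.
Qed.

(** Bounded by [sin_quot_le], so that the singular integral below converges
    absolutely. *)
Definition sin_quot psi th s := sin_rem psi th s / (1 - cos s).

(** (-Delta)^(1/2) on the circle as a singular integral. The term psi' th * sin
    s has mean zero against 1 / (1 - cos s) in the principal value sense; it
    replaces the principal value by an absolutely convergent integral. *)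
Definition circle_hlap psi th : R := - (2 * pi)^-1 * (\int[mu]_(s in circle) sin_quot psi th s)%R.

Lemma div_le_bound (a b C : R) : 0 <= b -> 0 <= C -> `|a| <= C * b -> `|a / b| <= C.
Proof.
move=> b0 C0; rewrite normrM normfV (ger0_norm b0).
have [->|bn0] := eqVneq b 0; first by move=> _; rewrite invr0 mulr0.
by rewrite ler_pdivrMr// lt_def bn0.
Qed.

Lemma C2per_ge0 psi C : C2per psi C -> 0 <= C.
Proof. by move=> [_ _ _ C2 _]; rewrite (le_trans _ (C2 0)). Qed.

Lemma sin_quot_le psi C th s : C2per psi C -> `|sin_quot psi th s| <= 32 * C.
Proof.
move=> h; apply: div_le_bound; rewrite ?one_sub_cos_ge0//.
  by rewrite mulr_ge0// (C2per_ge0 h).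
exact: sin_rem_le.
Qed.

Lemma C2per_cont psi C : C2per psi C -> continuous psi.
Proof. by move=> [d1 _ _ _ _] x; exact: derivable_cont. Qed.

Lemma C2per_cont1 psi C : C2per psi C -> continuous (derive1 psi).
Proof. by move=> [_ d2 _ _ _] x; exact: derivable_cont. Qed.

Lemma C2per_meas psi C : C2per psi C -> measurable_fun setT psi.
Proof. by move=> h; apply: cont_meas; exact: (C2per_cont h). Qed.

Lemma C2per_meas1 psi C : C2per psi C -> measurable_fun setT (derive1 psi).
Proof. by move=> h; apply: cont_meas; exact: (C2per_cont1 h). Qed.

Lemma meas_sin_quot psi th : measurable_fun setT psi -> measurable_fun setT (sin_quot psi th).
Proof.
move=> mp; apply: measurable_funM; last first.
  by apply: measV; apply: measurable_funB => //; exact: cont_meas (@continuous_cos R).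
apply: measurable_funB; last first.
  by apply: measurable_funM => //; exact: cont_meas (@continuous_sin R).
apply: measurable_funB => //.
by apply: (measurableT_comp mp); apply: measurable_funD.
Qed.

Lemma meas_sin_quot2 psi C : C2per psi C ->
  measurable_fun setT (fun z : R * R => sin_quot psi z.1 z.2).
Proof.
move=> h.
have mp : measurable_fun setT psi by exact: C2per_meas h.
have mp1 : measurable_fun setT (derive1 psi) by exact: C2per_meas1 h.
apply: measurable_funM; last first.
  apply: (measurableT_comp meas_inv); apply: measurable_funB => //.
  by apply: measurableT_comp => //; exact: cont_meas (@continuous_cos R).
apply: measurable_funB; last first.
  apply: measurable_funM; first exact: measurableT_comp.
  by apply: measurableT_comp => //; exact: cont_meas (@continuous_sin R).
apply: measurable_funB; last exact: measurableT_comp.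
by apply: (measurableT_comp mp); exact: measurable_funD.
Qed.

Lemma intg_sin_quot psi C th : C2per psi C -> intg circle (sin_quot psi th).
Proof.
move=> h; apply: (@intg_circle_bounded _ (32 * C)).
  by apply: meas_sin_quot; exact: C2per_meas h.
by move=> s; exact: sin_quot_le.
Qed.

Lemma circle_Rint_le f (C : R) : measurable_fun setT f -> (forall t, `|f t| <= C) ->
  `|(\int[mu]_(t in circle) f t)%R| <= 2 * pi * C.
Proof.
move=> mf fC; have If := intg_circle_bounded mf fC.
have h := @le_normr_Rintegral _ _ _ mu circle f measurable_circle If.
apply: (le_trans h).
apply: (@le_trans _ _ (\int[mu]_(t in circle) (cst C t))%R).
  apply: le_Rintegral => //; first exact: intg_norm.
  exact: intg_cst mu_circle_lty.
by rewrite Rintegral_cst//= mu_circle/= mulrC.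
Qed.

Lemma circle_hlap_le psi C th : C2per psi C -> `|circle_hlap psi th| <= 32 * C.
Proof.
move=> h; rewrite /circle_hlap normrM normrN normfV (gtr0_norm pi2_gt0).
rewrite ler_pdivrMl ?pi2_gt0//.
apply: circle_Rint_le; last by move=> s; exact: sin_quot_le.
by apply: meas_sin_quot; exact: C2per_meas h.
Qed.

(** The common C^2 bound dominates the quotients, so that pointwise convergence
    of the remainders passes to the half-Laplacians. *)
Lemma circle_hlap_dct (psi : nat -> R -> R) (r : R -> R) C th :
  (forall n, C2per (psi n) C) -> (forall s, (fun n => sin_rem (psi n) th s) @ \oo --> r s) ->
  (fun n => circle_hlap (psi n) th) @ \oo -->
    - (2 * pi)^-1 * (\int[mu]_(s in circle) (r s / (1 - cos s)))%R.
Proof.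
move=> h hr; apply: cvgM; first exact: cvg_cst.
apply: (@Rint_dct R circle (fun n s => sin_quot (psi n) th s) _ (cst (32 * C)) _ _ _ _ _).2 => //.
- move=> n; apply: measurable_funTS; apply: meas_sin_quot; exact: C2per_meas (h n).
- by move=> s _; apply: cvgM => //; exact: cvg_cst.
- by move=> n s _; exact: sin_quot_le.
- exact: intg_cst mu_circle_lty.
Qed.

(** The real and imaginary parts of a [circle_test]. *)
Definition ctest psi := rsmooth psi /\ per2pi psi.

(** A continuous periodic function takes its values on one compact period. *)
Lemma per_cont_bounded f : continuous f -> per2pi f -> exists C : R, forall x, `|f x| <= C.
Proof.
move=> cf pf.
have cn : continuous (fun x => `|f x|).
  by move=> x; apply: (@cvg_norm _ _ _ _ _ f); exact: cf.
have pi0 : - pi <= pi :> R by rewrite (le_trans _ (pi_ge0 _))// oppr_le0 pi_ge0.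
have [c _ hc] := EVT_max pi0 (continuous_subspaceT cn).
exists `|f c| => x.
have [s [spi sE]] := per_reduce x.
by rewrite -[x]add0r (sE f 0 pf) add0r; apply: hc; rewrite in_itv/= -ler_norml.
Qed.

Lemma ctest_derive1 psi : ctest psi -> ctest (derive1 psi).
Proof. by move=> [sp pp]; split; [exact: rsmooth_derive1|exact: derive1_per]. Qed.

Lemma ctest_bounded psi : ctest psi -> exists C : R, forall x, `|psi x| <= C.
Proof. by move=> [sp pp]; apply: per_cont_bounded => //; exact: rsmooth_cont. Qed.

Lemma ctest_C2per psi : ctest psi -> exists C : R, C2per psi C.
Proof.
move=> tp.
have [C0 h0] := ctest_bounded tp.
have [C1 h1] := ctest_bounded (ctest_derive1 tp).
have [C2 h2] := ctest_bounded (ctest_derive1 (ctest_derive1 tp)).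
exists (`|C0| + `|C1| + `|C2|); split.
- by move=> x; apply: rsmooth_derivable; case: tp.
- by move=> x; apply: rsmooth_derivable; apply: rsmooth_derive1; case: tp.
- move=> x; split.
    have := h0 x; have := ler_norm C0; have := normr_ge0 C1; have := normr_ge0 C2; lra.
  have := h1 x; have := ler_norm C1; have := normr_ge0 C0; have := normr_ge0 C2; lra.
- move=> x; have := h2 x; have := ler_norm C2; have := normr_ge0 C0; have := normr_ge0 C1; lra.
- by case: tp.
Qed.

Lemma ctestD f g : ctest f -> ctest g -> ctest (fun x => f x + g x).
Proof. by move=> [? pf] [? pg]; split; [exact: rsmoothD|move=> t; rewrite pf pg]. Qed.
Lemma ctestB f g : ctest f -> ctest g -> ctest (fun x => f x - g x).
Proof. by move=> [? pf] [? pg]; split; [exact: rsmoothB|move=> t; rewrite pf pg]. Qed.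
Lemma ctestM f g : ctest f -> ctest g -> ctest (fun x => f x * g x).
Proof. by move=> [? pf] [? pg]; split; [exact: rsmoothM|move=> t; rewrite pf pg]. Qed.
Lemma ctest_cst (c : R) : ctest (fun _ => c).
Proof. by split; [exact: rsmooth_cst|]. Qed.
Lemma ctest_sin : ctest (@sin R).
Proof. by split; [exact: rsmooth_sin|exact: per_sin]. Qed.
Lemma ctest_cos : ctest (@cos R).
Proof. by split; [exact: rsmooth_cos|exact: per_cos]. Qed.
Lemma ctestV f : (forall x, f x != 0) -> ctest f -> ctest (fun x => (f x)^-1).
Proof. by move=> f0 [? pf]; split; [exact: rsmoothV|move=> t; rewrite pf]. Qed.

End Circle.
#[global] Hint Resolve measurable_circle : core.

(** * Fourier series and the singular integral *)

Section CircleFourier.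
Context {R : realType}.
Local Notation mu := (@lebesgue_measure R).
Local Notation circle := (@circle R).
Local Notation mia := (@minus_i_angle R).
Implicit Types (th s t x y : R) (f psi : R -> R) (k n : nat).

Lemma circle_Rint_deriv (F f : R -> R) : (forall x : R, is_derive x 1 F (f x)) ->
  continuous f -> per2pi F -> (\int[mu]_(t in circle) f t)%R = 0.
Proof.
move=> dF cf pF; rewrite /circle.
have mab : mia <= mia + 2 * pi by rewrite lerDl ltW// pi2_gt0.
have If : intg `[mia, (mia + 2 * pi)[ f.
  have pi0 := @pi2_gt0 R.
  have [c _ hc] := EVT_max mab (continuous_subspaceT (fun x => cvg_norm (cf x))).
  apply: (@intg_bounded _ _ _ `|f c|) => //; first exact: mu_itv_lty.
    exact: cont_meas.
  by move=> x; rewrite /= in_itv/= => /andP[x1 x2]; apply: hc; rewrite in_itv/= x1 ltW.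
have e := @Rintegral_itv_bndo_bndc R (BLeft mia) (mia + 2 * pi) f If.
by rewrite [LHS]e (Rint_FTC mab dF cf) pF subrr.
Qed.

Lemma cont_cosM k : continuous (fun s : R => cos (k%:R * s)).
Proof. by move=> s; apply: (@deriv_cont _ _ (fun s => - sin (k%:R * s) * (k%:R * 1))) => x; apply: dcomp (dZ _ (dI _)). Qed.

Lemma cont_sinM k : continuous (fun s : R => sin (k%:R * s)).
Proof. by move=> s; apply: (@deriv_cont _ _ (fun s => cos (k%:R * s) * (k%:R * 1))) => x; apply: dcomp (dZ _ (dI _)). Qed.

Lemma natper (g : R -> R) k : per2pi g -> forall x, g (k%:R * (x + 2 * pi)) = g (k%:R * x).
Proof. by move=> pg x; rewrite mulrDr; exact: (@per_int R g k). Qed.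

Lemma int_cos k : (0 < k)%N -> (\int[mu]_(s in circle) cos (k%:R * s))%R = 0.
Proof.
move=> k0; have kn0 : k%:R != 0 :> R by rewrite pnatr_eq0 -lt0n.
apply: (@circle_Rint_deriv (fun s => k%:R^-1 * sin (k%:R * s))).
- move=> x; have H := dZ (k%:R^-1) (@dcomp R sin (fun y => k%:R * y) x _ _ (is_derive_sin _) (dZ k%:R (dI x))).
  by apply: (is_derive_eq H); field.
- exact: cont_cosM.
- by move=> x; rewrite natper//; exact: per_sin.
Qed.

Lemma int_sin k : (\int[mu]_(s in circle) sin (k%:R * s))%R = 0.
Proof.
case: k => [|k].
  rewrite (@eq_Rint _ _ _ (fun=> 0)); last by move=> s _; rewrite mul0r sin0.
  exact: Rint0.
have kn0 : k.+1%:R != 0 :> R by rewrite pnatr_eq0.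
apply: (@circle_Rint_deriv (fun s => - (k.+1%:R^-1 * cos (k.+1%:R * s)))).
- move=> x; have H := dN (dZ (k.+1%:R^-1) (@dcomp R cos (fun y => k.+1%:R * y) x _ _ (is_derive_cos _) (dZ k.+1%:R (dI x)))).
  by apply: (is_derive_eq H); field.
- exact: cont_sinM.
- by move=> x; rewrite natper//; exact: per_cos.
Qed.

Lemma intg_circle_cont f : continuous f -> per2pi f -> intg circle f.
Proof.
move=> cf pf; have [C hC] := per_cont_bounded cf pf.
by apply: intg_circle_bounded hC; exact: cont_meas.
Qed.

Lemma cont_affk k th (g : R -> R) : continuous g -> continuous (fun t : R => g (k%:R * (t - th))).
Proof.
move=> cg t; apply: (@continuous_comp _ _ _ (fun t : R => k%:R * (t - th)) g); last exact: cg.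
by apply: cvgM; [exact: cvg_cst|apply: cvgB; [exact: cvg_id|exact: cvg_cst]].
Qed.

Lemma int_sin_cos k : (0 < k)%N ->
  (\int[mu]_(s in circle) (sin s * cos (k%:R * s)))%R = 0.
Proof.
case: k => // k _.
rewrite (@eq_Rint _ _ _ (fun s => 2^-1 * (sin (k.+2%:R * s) - sin (k%:R * s)))); last first.
  move=> s _.
  rewrite (_ : k.+2%:R * s = k.+1%:R * s + s); last by rewrite -[k.+2%:R]natr1; ring.
  rewrite (_ : k%:R * s = k.+1%:R * s - s); last by rewrite -natr1; ring.
  by rewrite sinD sinB; field.
have I1 j : intg circle (fun s : R => sin (j%:R * s)).
  by apply: intg_circle_cont; [exact: cont_sinM|move=> x; rewrite natper//; exact: per_sin].
rewrite Rint_Z//; last exact: intgB.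
by rewrite Rint_B// !int_sin subrr mulr0.
Qed.

Variable psi : R -> R.
Hypothesis tpsi : ctest psi.
Variable th : R.

(** The n-th term of the Fourier series at th pairs the frequencies n and -n,
    which leaves this cosine integral. *)
Definition acoef k : R := (\int[mu]_(t in circle) (psi t * cos (k%:R * (t - th))))%R.

Let bcoef k : R := (\int[mu]_(s in circle) (sin_quot psi th s * cos (k%:R * s)))%R.

Lemma fourier_ibp (f : R -> R) k : ctest f ->
  (k%:R * \int[mu]_(t in circle) (f t * cos (k%:R * (t - th))) =
     - \int[mu]_(t in circle) (derive1 f t * sin (k%:R * (t - th))))%R /\
  (k%:R * \int[mu]_(t in circle) (f t * sin (k%:R * (t - th))) =
     \int[mu]_(t in circle) (derive1 f t * cos (k%:R * (t - th))))%R.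
Proof.
move=> tf; have [sf pf] := tf; have [sf1 pf1] := ctest_derive1 tf.
have cs (g : R -> R) : continuous g -> continuous (fun t : R => g (k%:R * (t - th))) by exact: cont_affk.
have pk (g : R -> R) : per2pi g -> per2pi (fun t : R => g (k%:R * (t - th))).
  by move=> pg t; rewrite addrAC natper.
have cprod (f1 f2 : R -> R) : continuous f1 -> continuous f2 -> continuous (fun t => f1 t * f2 t).
  by move=> cf cg t; apply: cvgM; [exact: cf|exact: cg].
have pprod (f1 f2 : R -> R) : per2pi f1 -> per2pi f2 -> per2pi (fun t => f1 t * f2 t).
  by move=> pf' pg t; rewrite pf' pg.
have I (f1 g : R -> R) : continuous f1 -> per2pi f1 -> continuous g -> per2pi g ->
    intg circle (fun t => f1 t * g (k%:R * (t - th))).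
  move=> cf pf' cg pg; apply: intg_circle_cont.
    by apply: cprod => //; exact: cs.
  by apply: pprod => //; exact: pk.
have cf := rsmooth_cont sf; have cf1 := rsmooth_cont sf1.
have csin := @continuous_sin R; have ccos := @continuous_cos R.
have psin := @per_sin R; have pcos := @per_cos R.
have dk t : is_derive t 1 (fun t : R => k%:R * (t - th)) k%:R.
  by apply: (is_derive_eq (dZ k%:R (dB (dI t) (dC th t)))); rewrite subr0 mulr1.
split.
- have := @circle_Rint_deriv (fun t => f t * sin (k%:R * (t - th)))
    (fun t => derive1 f t * sin (k%:R * (t - th)) + k%:R * (f t * cos (k%:R * (t - th)))).
  rewrite Rint_D ?Rint_Z//; try exact: I; last by apply: intgZ => //; exact: I.
  move=> H; apply/eqP; rewrite -addr_eq0 addrC; apply/eqP; apply: H.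
  + move=> t; apply: (is_derive_eq (dM (rsmooth_is_derive t sf) (dcomp (is_derive_sin _) (dk t)))).
    by ring.
  + move=> t; apply: cvgD; first exact: (cprod _ _ cf1 (cs _ csin)).
    by apply: cvgM; [exact: cvg_cst|exact: (cprod _ _ cf (cs _ ccos))].
  + by apply: pprod => //; exact: pk.
- have := @circle_Rint_deriv (fun t => f t * cos (k%:R * (t - th)))
    (fun t => derive1 f t * cos (k%:R * (t - th)) - k%:R * (f t * sin (k%:R * (t - th)))).
  rewrite Rint_B ?Rint_Z//; try exact: I; last by apply: intgZ => //; exact: I.
  move=> H; apply/eqP; rewrite eq_sym -subr_eq0; apply/eqP; apply: H.
  + move=> t; apply: (is_derive_eq (dM (rsmooth_is_derive t sf) (dcomp (is_derive_cos _) (dk t)))).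
    by ring.
  + move=> t; apply: cvgB; first exact: (cprod _ _ cf1 (cs _ ccos)).
    by apply: cvgM; [exact: cvg_cst|exact: (cprod _ _ cf (cs _ csin))].
  + by apply: pprod => //; exact: pk.
Qed.

(** Three integrations by parts; the series of k * a_k then converges
    absolutely. *)
Let acoef_decay : exists M : R, forall k, `|k%:R ^+ 3 * acoef k| <= M.
Proof.
have t1 := ctest_derive1 tpsi; have t2 := ctest_derive1 t1; have t3 := ctest_derive1 t2.
have [C hC] := ctest_bounded t3.
exists (2 * pi * C) => k.
have -> : k%:R ^+ 3 * acoef k = (\int[mu]_(t in circle) (derive1 (derive1 (derive1 psi)) t * sin (k%:R * (t - th))))%R.
  rewrite 2!exprS expr1 -2!mulrA (fourier_ibp k tpsi).1 mulrN (fourier_ibp k t1).2.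
  by rewrite mulrN (fourier_ibp k t2).1 opprK.
apply: circle_Rint_le.
  apply: measurable_funM; first by apply: cont_meas; apply: rsmooth_cont; case: t3.
  by apply: cont_meas; apply: cont_affk; exact: continuous_sin.
move=> t; rewrite normrM (le_trans _ (hC t))// ler_piMr// sin_max//.
Qed.

Let C2 := ctest_C2per tpsi.

Let meas_cosM k : measurable_fun setT (fun s : R => cos (k%:R * s)).
Proof. by apply: cont_meas; exact: cont_cosM. Qed.

Let intg_Qcos k : intg circle (fun s => sin_quot psi th s * cos (k%:R * s)).
Proof.
have [C h] := C2; apply: (@intg_circle_bounded _ _ (32 * C)).
  by apply: measurable_funM => //; apply: meas_sin_quot; exact: C2per_meas h.
by move=> s; rewrite normrM (le_trans _ (sin_quot_le th s h))// ler_piMr// cos_max.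
Qed.

Let bcoef_bound : exists M : R, forall k, `|bcoef k| <= M.
Proof.
have [C h] := C2; exists (2 * pi * (32 * C)) => k; apply: circle_Rint_le.
  by apply: measurable_funM => //; apply: meas_sin_quot; exact: C2per_meas h.
by move=> s; rewrite normrM (le_trans _ (sin_quot_le th s h))// ler_piMr// cos_max.
Qed.

Let sin_quotK s : sin_quot psi th s * (1 - cos s) = sin_rem psi th s.
Proof.
have [C h] := C2; rewrite /sin_quot; have [e|e] := eqVneq (1 - cos s) 0; last by rewrite divfK.
have := sin_rem_le th s h; rewrite e mulr0 normr_le0 => /eqP ->.
by rewrite !mul0r.
Qed.

(** Since the remainder is 1 - cos s times the quotient, and cos (k s) cos s =
    (cos ((k+1) s) + cos ((k-1) s)) / 2, the coefficients of psi are second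
    differences of those of the quotient; the terms psi th and psi' th * sin s
    are orthogonal to cos (k s) for k > 0. *)
Let acoef_b k : acoef k.+1 = bcoef k.+1 - 2^-1 * (bcoef k.+2 + bcoef k).
Proof.
have [C h] := C2; have [sp pp] := tpsi.
have cpsi := C2per_cont h.
have [C0 hC0] := ctest_bounded tpsi.
have -> : acoef k.+1 = (\int[mu]_(s in circle) (psi (th + s) * cos (k.+1%:R * s)))%R.
  rewrite /acoef (@circle_shift _ _ C0 th).
  - by apply: eq_Rint => s _; rewrite (addrC th s) addrK.
  - apply: measurable_funM; first exact: cont_meas.
    by apply: cont_meas; apply: cont_affk; exact: continuous_cos.
  - by move=> t; rewrite normrM (le_trans _ (hC0 t))// ler_piMr// cos_max.
  - by move=> t; rewrite pp addrAC natper//; exact: per_cos.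
have Icos j : intg circle (fun s : R => cos (j%:R * s)).
  by apply: intg_circle_cont; [exact: cont_cosM|move=> x; rewrite natper//; exact: per_cos].
have Isc : intg circle (fun s : R => sin s * cos (k.+1%:R * s)).
  apply: intg_circle_cont.
    by move=> x; apply: cvgM; [exact: continuous_sin|exact: cont_cosM].
  by move=> x; rewrite natper ?per_sin//; exact: per_cos.
have Irem : intg circle (fun s => sin_quot psi th s * cos (k.+1%:R * s) - 2^-1 *
   (sin_quot psi th s * cos (k.+2%:R * s) + sin_quot psi th s * cos (k%:R * s))).
  by apply: intgB => //; apply: intgZ => //; exact: intgD.
(* psi (th + s) = quotient * (1 - cos s) + psi th + psi' th * sin s, and the
   product formula for cos * cos. *)
rewrite (@eq_Rint _ _ _ (fun s => (sin_quot psi th s * cos (k.+1%:R * s) - 2^-1 *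
   (sin_quot psi th s * cos (k.+2%:R * s) + sin_quot psi th s * cos (k%:R * s)))
   + (psi th * cos (k.+1%:R * s) + derive1 psi th * (sin s * cos (k.+1%:R * s))))); last first.
  move=> s _.
  have -> : psi (th + s) = sin_quot psi th s * (1 - cos s) + (psi th + derive1 psi th * sin s).
    by rewrite sin_quotK /sin_rem; ring.
  rewrite (_ : k.+2%:R * s = k.+1%:R * s + s); last by rewrite -[k.+2%:R]natr1; ring.
  rewrite (_ : k%:R * s = k.+1%:R * s - s); last by rewrite -natr1; ring.
  by rewrite cosD cosB; field.
rewrite Rint_D//; last by apply: intgD => //; exact: intgZ.
rewrite [X in _ + X]Rint_D//; try exact: intgZ.
rewrite !Rint_Z// int_cos// int_sin_cos// !mulr0 !addr0.
rewrite Rint_B//; last by apply: intgZ => //; exact: intgD.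
rewrite Rint_Z//; last exact: intgD.
by rewrite Rint_D.
Qed.

(** The boundary term of the summation by parts of k times a second difference.
    *)
Let e_ n := n.+1%:R * bcoef n - n%:R * bcoef n.+1.

Let e_step n : e_ n.+1 - e_ n = 2 * n.+1%:R * acoef n.+1.
Proof. by rewrite /e_ acoef_b -[n.+2%:R]natr1 -![n.+1%:R]natr1; field. Qed.

Let sum_a_e N : \sum_(1 <= k < N.+1) (k%:R * acoef k) = 2^-1 * (e_ N - bcoef 0%N).
Proof.
elim: N => [|N IH].
  by rewrite big_geq// /e_ mul1r mul0r subr0 subrr mulr0.
rewrite big_nat_recr//= IH.
rewrite (_ : e_ N.+1 = e_ N + 2 * N.+1%:R * acoef N.+1); last by rewrite -e_step; ring.
by field.
Qed.

Let e_cvg : cvgn e_.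
Proof.
have -> : e_ = (fun n => e_ 0%N + series (fun k => 2 * k.+1%:R * acoef k.+1) n).
  apply/funext; elim => [|n IH]; first by rewrite /series/= big_geq// addr0.
  have -> : e_ n.+1 = e_ n + 2 * n.+1%:R * acoef n.+1 by rewrite -e_step; ring.
  by rewrite {1}IH /series/= big_nat_recr//= addrA.
apply: is_cvgD; first exact: is_cvg_cst.
apply: normed_cvg.
have [M hM] := acoef_decay.
(* The decay k^-3 bounds k * a_k by a telescoping series. *)
apply: (@series_le_cvg _ _ (fun k => 4 * M * (k.+1%:R^-1 - k.+2%:R^-1))) => //.
- by move=> k /=; exact: normr_ge0.
- move=> k /=; apply: mulr_ge0; first by rewrite mulr_ge0// (le_trans _ (hM 0%N)).
  by rewrite subr_ge0 lef_pV2 ?posrE ?ltr0n// ler_nat.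
- move=> k /=.
  have := hM k.+1; have k0 : 0 < k.+1%:R :> R by rewrite ltr0n.
  rewrite (normrM (k.+1%:R ^+ 3)) normrX (normrM (2 * k.+1%:R)) (normrM 2) !(ger0_norm (ler0n _ _)).
  move: (`|acoef k.+1|) (normr_ge0 (acoef k.+1)) => A A0 hA.
  have -> : k.+1%:R^-1 - k.+2%:R^-1 = (k.+1%:R * k.+2%:R)^-1 :> R.
    rewrite -[k.+2%:R]natr1; move: (k.+1%:R : R) k0 => x x0.
    have n1 : x != 0 by rewrite gt_eqF.
    have n2 : x + 1 != 0 by rewrite gt_eqF// addr_gt0.
    by field; rewrite n1 n2.
  rewrite ler_pdivlMr ?mulr_gt0 ?ltr0n//.
  have kk : k.+2%:R <= 2 * k.+1%:R :> R by rewrite -natrM ler_nat mul2n -addnn addSn addnS !ltnS leq_addr.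
  have : 0 <= k.+1%:R ^+ 2 * A by rewrite mulr_ge0// exprn_ge0// ltW.
  move: (k.+1%:R) (k.+2%:R) k0 kk hA => x y x0 yx hA xA.
  have : x ^+ 2 * A * y <= x ^+ 2 * A * (2 * x) by rewrite ler_wpM2l.
  lra.
- rewrite (_ : series _ = (fun n => 4 * M * (1 - n.+1%:R^-1))).
    apply: is_cvgM; first exact: is_cvg_cst.
    apply: is_cvgB; first exact: is_cvg_cst.
    by apply/cvg_ex; exists 0; exact: cvg_harmonic.
  apply/funext; elim=> [|n IH]; first by rewrite /series/= big_geq// invr1 subrr mulr0.
  rewrite /series/= big_nat_recr//=.
  by rewrite (_ : \sum_(0 <= k < n) _ = series (fun k => 4 * M * (k.+1%:R^-1 - k.+2%:R^-1)) n)// IH; ring.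
Qed.

Let sum_cos_bound n s : `|sin (s / 2) * \sum_(0 <= k < n) cos (k%:R * s)| <= 1.
Proof.
have -> : sin (s / 2) * \sum_(0 <= k < n) cos (k%:R * s) =
   2^-1 * (sin (n%:R * s - s / 2) + sin (s / 2)).
  elim: n => [|n IH]; first by rewrite big_geq// mulr0 mul0r sub0r sinN addNr mulr0.
  rewrite big_nat_recr//= mulrDr IH -[n.+1%:R]natr1.
  rewrite (_ : (n%:R + 1) * s - s / 2 = n%:R * s + s / 2); last by field.
  by rewrite sinB sinD; field.
have := sin_max (n%:R * s - s / 2); have := sin_max (s / 2) => h1 h2.
rewrite normrM ger0_norm//; have := ler_normD (sin (n%:R * s - s / 2)) (sin (s / 2)); lra.
Qed.

Let intg_Qsum n : intg circle (fun s => sin_quot psi th s * \sum_(0 <= k < n) cos (k%:R * s)) /\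
  (\int[mu]_(s in circle) (sin_quot psi th s * \sum_(0 <= k < n) cos (k%:R * s)) =
  \sum_(0 <= k < n) bcoef k)%R.
Proof.
elim: n => [|n [IH1 IH2]].
  split.
    apply: (@eq_intg _ _ (fun=> 0)) => //; last by apply: intg_cst mu_circle_lty.
    by move=> x _; rewrite big_geq// mulr0.
  rewrite big_geq// (@eq_Rint _ _ _ (fun=> 0)).
    exact: Rint0.
  by move=> s _; rewrite big_geq// mulr0.
have E s : circle s -> sin_quot psi th s * (\sum_(0 <= k < n) cos (k%:R * s)) + sin_quot psi th s * cos (n%:R * s)
   = sin_quot psi th s * \sum_(0 <= k < n.+1) cos (k%:R * s).
  by move=> _; rewrite big_nat_recr//= mulrDr.
split.
  by apply: (eq_intg _ E) => //; apply: intgD.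
rewrite -(eq_Rint E) Rint_D// IH2 big_nat_recr//=.
Qed.

(** The Cesaro means of cos (k s) are at most 1 and tend to 0 wherever sin (s /
    2) does not vanish. This weak form of the Riemann-Lebesgue lemma requires
    only that the quotient be bounded. *)
Let mean_b : arithmetic_mean bcoef @ \oo --> 0.
Proof.
have [C h] := C2.
pose m n s := n.+1%:R^-1 * \sum_(0 <= k < n.+1) cos (k%:R * s).
rewrite (_ : arithmetic_mean bcoef = (fun n => \int[mu]_(s in circle) (sin_quot psi th s * m n s))%R); last first.
  apply/funext => n; rewrite /arithmetic_mean /series/= -(intg_Qsum _).2.
  rewrite -Rint_Z//; last exact: (intg_Qsum _).1.
  by apply: eq_Rint => s _; rewrite /m; ring.
have -> : 0 = (\int[mu]_(s in circle) (cst 0 s : R))%R :> R.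
  by rewrite Rint0.
apply: (@Rint_dct R circle (fun n s => sin_quot psi th s * m n s) (cst 0) (cst (32 * C)) _ _ _ _ _).2 => //.
- move=> n; have [H _] := intg_Qsum n.+1.
  have := intg_meas (intgZ (n.+1%:R^-1) measurable_circle H).
  congr (measurable_fun _ _); apply/funext => s; rewrite /m; ring.
- move=> s _.
  have [s0|s0] := eqVneq (sin (s / 2)) 0.
    have -> : (fun n => sin_quot psi th s * m n s) = cst 0; last exact: cvg_cst.
    by apply/funext => n; rewrite /sin_quot one_sub_cosE s0 expr0n/= mulr0 invr0 mulr0 mul0r.
  rewrite [cst 0 s]/= -(mulr0 (sin_quot psi th s)); apply: cvgM; first exact: cvg_cst.
  apply: (@squeeze_cvgr _ _ _ _ (fun n => - (`|sin (s / 2)|^-1 * n.+1%:R^-1)) (fun n => `|sin (s / 2)|^-1 * n.+1%:R^-1)).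
  + apply: nearW => n; rewrite -ler_norml /m normrM ger0_norm// mulrC ler_pM2r ?invr_gt0//.
    by rewrite -[leRHS]mul1r ler_pdivlMr ?normr_gt0// mulrC -normrM sum_cos_bound.
  + rewrite -oppr0; apply: cvgN; rewrite -(mulr0 (`|sin (s / 2)|^-1)); apply: cvgM.
      exact: cvg_cst.
    exact: cvg_harmonic.
  + rewrite -[X in _ --> X](mulr0 (`|sin (s / 2)|^-1)); apply: cvgM; first exact: cvg_cst.
    exact: cvg_harmonic.
- move=> n s _; rewrite normrM (le_trans _ (sin_quot_le th s h))// ler_piMr// /m.
  rewrite normrM ger0_norm// ler_pdivrMl// mulr1 (le_trans (ler_norm_sum _ _ _))//.
  rewrite (le_trans (ler_sum _ (fun i _ => cos_max _)))//.
  by rewrite big_const_nat iter_addr subn0 addr0.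
- exact: intg_cst mu_circle_lty.
Qed.

Let sum_e n : \sum_(0 <= k < n.+1) e_ k =
  2 * \sum_(0 <= k < n.+1) bcoef k - bcoef 0%N - n%:R * bcoef n.+1.
Proof.
elim: n => [|n IH]; first by rewrite !big_nat1 /e_; ring.
rewrite big_nat_recr//= IH [in RHS]big_nat_recr//= /e_ -[n.+2%:R]natr1 -[n.+1%:R]natr1.
by ring.
Qed.

(** The limit l of e_n exists. The Cesaro means of e_n express b_(n+1) through
    quantities that converge, which gives b_n --> -l; but the Cesaro means of
    b_n tend to 0, so l = 0. *)
Let e_cvg0 : e_ @ \oo --> 0.
Proof.
have [l el] := (@cvg_ex _ _).1 e_cvg.
have [M hM] := bcoef_bound.
have b1 : (fun n => bcoef n.+1) @ \oo --> - l.
  have me := cesaro el.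
  have mb := mean_b.
  have -> : (fun n => bcoef n.+1) = (fun n => 2 * arithmetic_mean bcoef n - bcoef 0%N * harmonic n
     + bcoef n.+1 * harmonic n - arithmetic_mean e_ n).
    apply/funext => n; rewrite /arithmetic_mean /series/= sum_e -[n.+1%:R]natr1.
    by field; rewrite natr1 pnatr_eq0.
  have -> : - l = 2 * 0 - bcoef 0%N * 0 + 0 - l by ring.
  apply: cvgB => //; apply: cvgD.
    apply: cvgB.
      by apply: cvgM => //; exact: cvg_cst.
    by apply: cvgM; [exact: cvg_cst|exact: cvg_harmonic].
  apply: (@squeeze_cvgr _ _ _ _ (fun n => - (M * harmonic n)) (fun n => M * harmonic n)).
  + apply: nearW => n; rewrite -ler_norml normrM (ger0_norm (harmonic_ge0 n)).
    by rewrite ler_wpM2r ?harmonic_ge0.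
  + rewrite -oppr0 -(mulr0 M); apply: cvgN; apply: cvgM; [exact: cvg_cst|exact: cvg_harmonic].
  + rewrite -[X in _ --> X](mulr0 M); apply: cvgM; [exact: cvg_cst|exact: cvg_harmonic].
have b2 : bcoef @ \oo --> - l.
  by rewrite -(cvg_shiftn 1); under eq_fun do rewrite addn1.
have b3 := cesaro b2.
have := cvg_unique _ b3 mean_b.
move=> /(_ _) l0.
have -> : 0 = l by rewrite -[LHS]oppr0 -l0 ?opprK.
exact: el.
Qed.

(** Summation by parts of [acoef_b] leaves b_0 and a boundary term, which tends
    to 0. *)
Lemma fourier_circle_hlap :
  (fun N => \sum_(1 <= k < N.+1) (k%:R * acoef k)) @ \oo --> pi * circle_hlap psi th.
Proof.
have -> : pi * circle_hlap psi th = 2^-1 * (0 - bcoef 0%N).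
  have -> : bcoef 0%N = (\int[mu]_(s in circle) sin_quot psi th s)%R.
    by apply: eq_Rint => s _; rewrite mul0r cos0 mulr1.
  have pn0 : pi != 0 :> R by rewrite gt_eqF// pi_gt0.
  rewrite /circle_hlap; move: (Rintegral _ _ _) => I.
  by move: (pi : R) pn0 => p pn0; field.
have -> : (fun N => \sum_(1 <= k < N.+1) (k%:R * acoef k)) = (fun N => 2^-1 * (e_ N - bcoef 0%N)).
  by apply/funext => N; exact: sum_a_e.
apply: cvgM; first exact: cvg_cst.
by apply: cvgB; [exact: e_cvg0|exact: cvg_cst].
Qed.

End CircleFourier.

(** * The half-Laplacian of the circle in real form *)

Section HalfLapCircle.
Context {R : realType}.
Local Notation mu := (@lebesgue_measure R).
Local Notation circle := (@circle R).
Local Notation mia := (@minus_i_angle R).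

Lemma sum_sym (V : zmodType) (f : int -> V) (N : nat) :
  \sum_(k < N.*2.+1) f (k%:Z - N%:Z) = f 0 + \sum_(1 <= n < N.+1) (f n%:Z + f (- n%:Z)).
Proof.
rewrite -(big_mkord xpredT (fun k : nat => f (k%:Z - N%:Z))).
elim: N => [|N IH]; first by rewrite big_nat1 (@big_geq _ _ _ 1)// subr0 addr0.
rewrite [in RHS]big_nat_recr//= addrA -IH doubleS big_nat_recl// big_nat_recr//=.
rewrite sub0r (_ : (N.*2.+2)%:Z - N.+1%:Z = N.+1%:Z); last by rewrite -addnn; lia.
rewrite (eq_bigr (fun i : nat => f (i%:Z - N%:Z))); last by move=> i _; congr f; lia.
by rewrite [LHS]addrC -addrA.
Qed.

Lemma Re_M (x y : R[i]) : complex.Re (x * y) = complex.Re x * complex.Re y - complex.Im x * complex.Im y.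
Proof. by case: x y => [a b] [c d]. Qed.
Lemma Im_M (x y : R[i]) : complex.Im (x * y) = complex.Re x * complex.Im y + complex.Im x * complex.Re y.
Proof. by case: x y => [a b] [c d]. Qed.

Definition cReal_test (phi : R -> R[i]) :=
  ctest (fun x => complex.Re (phi x)) /\ ctest (fun x => complex.Im (phi x)).

Lemma circle_testP (phi : R -> R[i]) : circle_test phi <-> cReal_test phi.
Proof.
split=> [[[s1 s2] p]|[[s1 p1] [s2 p2]]].
  by split; split=> // t; rewrite p.
split=> // t; move: (p1 t) (p2 t).
by case: (phi _) => a b; case: (phi t) => c d /= -> ->.
Qed.

Section Real.
Variables (a b : R -> R).
Hypotheses (ta : ctest a) (tb : ctest b).
Variable th : R.

Let Cf (f : R -> R) (m : R) := (\int[mu]_(t in circle) (f t * cos (m * t)))%R.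
Let Sf (f : R -> R) (m : R) := (\int[mu]_(t in circle) (f t * sin (m * t)))%R.

Let contM (f : R -> R) (m : R) : ctest f -> intg circle (fun t => f t * cos (m * t)) /\
   intg circle (fun t => f t * sin (m * t)).
Proof.
move=> tf; have [C hC] := ctest_bounded tf.
have mf : measurable_fun setT f by apply: cont_meas; apply: rsmooth_cont; case: tf.
have mm : measurable_fun setT (fun t : R => m * t) by exact: measurable_funM.
split; apply: (@intg_circle_bounded _ _ C).
- by apply: measurable_funM => //; apply: measurableT_comp mm; exact: cont_meas (@continuous_cos R).
- by move=> s; rewrite normrM (le_trans _ (hC s))// ler_piMr// cos_max.
- by apply: measurable_funM => //; apply: measurableT_comp mm; exact: cont_meas (@continuous_sin R).
- by move=> s; rewrite normrM (le_trans _ (hC s))// ler_piMr// sin_max.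
Qed.

Let phi : R -> R[i] := fun x => a x +i* b x.

Let coefE (n : int) : fourier_coef phi n =
  ((2 * pi)^-1 * (Cf a n%:~R + Sf b n%:~R)) +i* ((2 * pi)^-1 * (Cf b n%:~R - Sf a n%:~R)).
Proof.
have [ca sa] := contM n%:~R ta; have [cb sb] := contM n%:~R tb.
rewrite /fourier_coef /cintegral /phi.
have hRe : (\int[mu]_(t in circle) complex.Re ((a t +i* b t) * expi (- (n%:~R * t)))
    = Cf a n%:~R + Sf b n%:~R)%R.
  rewrite -Rint_D//; apply: eq_Rint => t _.
  by rewrite Re_M /= cosN sinN mulrN opprK.
have hIm : (\int[mu]_(t in circle) complex.Im ((a t +i* b t) * expi (- (n%:~R * t)))
    = Cf b n%:~R - Sf a n%:~R)%R.
  rewrite -Rint_B//; apply: eq_Rint => t _.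
  by rewrite Im_M /= cosN sinN mulrN addrC.
rewrite hRe hIm.
by rewrite /real_complex_def; apply/eqP; rewrite eq_complex /= !mul0r subr0 addr0 !eqxx.
Qed.

Let acoefE (f : R -> R) (n : nat) : ctest f ->
  acoef f th n = cos (n%:R * th) * Cf f n%:R + sin (n%:R * th) * Sf f n%:R.
Proof.
move=> tf; have [cf sf] := contM n%:R tf.
rewrite /acoef /Cf /Sf -!Rint_Z// -Rint_D//; try exact: intgZ.
by apply: eq_Rint => t _; rewrite mulrBr cosB; ring.
Qed.

Let term (n : int) : R[i] := (`|n|%:~R)%:C * fourier_coef phi n * expi (n%:~R * th).

Let CfN (f : R -> R) (m : R) : Cf f (- m) = Cf f m.
Proof. by apply: eq_Rint => t _; rewrite mulNr cosN. Qed.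
Let SfN (f : R -> R) (m : R) : ctest f -> Sf f (- m) = - Sf f m.
Proof.
move=> tf; rewrite /Sf -RintN//; last exact: (contM m tf).2.
by apply: eq_Rint => t _; rewrite mulNr sinN mulrN.
Qed.

(** In the pair of frequencies n and -n the odd parts cancel, so that the real
    and imaginary parts of a test function do not interact. *)
Let term_pair (n : nat) : (0 < n)%N ->
  term n%:Z + term (- n%:Z) = (pi^-1 * (n%:R * acoef a th n)) +i* (pi^-1 * (n%:R * acoef b th n)).
Proof.
move=> n0; have pn0 : pi != 0 :> R by rewrite gt_eqF// pi_gt0.
rewrite /term !coefE normrN mulrNz !CfN !SfN// mulNr /expi cosN sinN /=.
rewrite (acoefE _ ta) (acoefE _ tb) (ger0_norm (_ : 0 <= n%:Z))// -!pmulrn.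
apply/eqP; rewrite eq_complex /=; apply/andP; split; apply/eqP;
  move: (pi : R) pn0 => p pn0; field; exact: pn0.
Qed.

Lemma half_lap_circle_real :
  half_lap_circle phi th = circle_hlap a th +i* circle_hlap b th.
Proof.
have pn0 : pi != 0 :> R by rewrite gt_eqF// pi_gt0.
rewrite /half_lap_circle /clim.
have E N : \sum_(k < N.*2.+1) term (k%:Z - N%:Z) =
   (pi^-1 * \sum_(1 <= k < N.+1) (k%:R * acoef a th k)) +i*
   (pi^-1 * \sum_(1 <= k < N.+1) (k%:R * acoef b th k)).
  rewrite (sum_sym term) (_ : term 0 = 0); last by rewrite /term normr0 !mul0r.
  rewrite add0r; elim: N => [|N IH].
    by rewrite !big_geq// mulr0.
  rewrite big_nat_recr//= IH term_pair// ![\sum_(1 <= k < N.+2) _]big_nat_recr//=.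
  by apply/eqP; rewrite eq_complex /= !mulrDr !eqxx.
have cv f : ctest f -> (fun N => pi^-1 * \sum_(1 <= k < N.+1) (k%:R * acoef f th k)) @ \oo --> circle_hlap f th.
  move=> tf; rewrite -[circle_hlap f th](mulKf pn0); apply: cvgM; first exact: cvg_cst.
  exact: fourier_circle_hlap.
congr (_ +i* _).
- rewrite (_ : (fun N => _) = (fun N => pi^-1 * \sum_(1 <= k < N.+1) (k%:R * acoef a th k))).
    by apply: cvg_lim => //; exact: cv.
  by apply/funext => N; rewrite E.
- rewrite (_ : (fun N => _) = (fun N => pi^-1 * \sum_(1 <= k < N.+1) (k%:R * acoef b th k))).
    by apply: cvg_lim => //; exact: cv.
  by apply/funext => N; rewrite E.
Qed.

End Real.

(** Reduces the Fourier definition to the singular integral of the real and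
    imaginary parts. *)
Lemma half_lap_circleE (phi : R -> R[i]) th : circle_test phi ->
  half_lap_circle phi th = circle_hlap (fun x => complex.Re (phi x)) th +i* circle_hlap (fun x => complex.Im (phi x)) th.
Proof.
move=> /circle_testP[ta tb]; rewrite -(half_lap_circle_real ta tb).
have {1}-> : phi = (fun x => complex.Re (phi x) +i* complex.Im (phi x)).
  by apply/funext => x; case: (phi x).
by [].
Qed.

End HalfLapCircle.

(** * Stereographic projection *)

Section Stereo.
Context {R : realType}.
Local Notation mu := (@lebesgue_measure R).
Local Notation circle := (@circle R).
Local Notation mia := (@minus_i_angle R).
Implicit Types (x y th : R).

(** The branch of Pi^-1 with values in the open period that starts at the pole:
    the angle runs backwards from the pole as x increases. *)
Definition ster_inv x : R := pi / 2 - 2 * atan x.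
Definition arc : set R := `]mia, mia + 2 * pi[.

Lemma oneDsqr_gt0 x : 0 < 1 + x ^+ 2. Proof. by rewrite ltr_pwDl// sqr_ge0. Qed.
Lemma oneDsqr_neq0 x : 1 + x ^+ 2 != 0. Proof. by rewrite gt_eqF// oneDsqr_gt0. Qed.

Lemma cos2_atan x : cos (atan x) ^+ 2 = (1 + x ^+ 2)^-1.
Proof. by rewrite cos_atan exprVn sqr_sqrtr// ltW// oneDsqr_gt0. Qed.

Lemma cos_atan_neq0 x : cos (atan x) != 0.
Proof. by rewrite cos_atan invr_eq0 gt_eqF// sqrtr_gt0 oneDsqr_gt0. Qed.

Lemma sin_atan x : sin (atan x) = x * cos (atan x).
Proof. by have /(congr1 (fun z => z * cos (atan x))) := atanK x; rewrite /tan /= divfK ?cos_atan_neq0. Qed.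

Lemma sin_ster_inv x : sin (ster_inv x) = (1 - x ^+ 2) / (1 + x ^+ 2).
Proof.
rewrite /ster_inv -[pi / 2 - _]opprB sinN sinBpihalf opprK mulr_natl cos_mulr2n cos2_atan.
by field; exact: oneDsqr_neq0.
Qed.

Lemma cos_ster_inv x : cos (ster_inv x) = 2 * x / (1 + x ^+ 2).
Proof.
rewrite /ster_inv -[pi / 2 - _]opprB cosN cosBpihalf mulr_natl sin_mulr2n sin_atan.
rewrite mulrCA -expr2 cos2_atan; by rewrite -mulr_natl mulrA.
Qed.

Lemma oneDsin_ster_inv x : 1 + sin (ster_inv x) = 2 / (1 + x ^+ 2).
Proof. by rewrite sin_ster_inv; field; exact: oneDsqr_neq0. Qed.

Lemma ster_invK x : stereo (ster_inv x) = x.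
Proof.
by rewrite /stereo oneDsin_ster_inv cos_ster_inv; field; rewrite oneDsqr_neq0.
Qed.

Lemma ster_inv_arc x : arc (ster_inv x).
Proof.
rewrite /arc /= in_itv/= /ster_inv /minus_i_angle.
have := atan_gtNpi2 x; have := atan_ltpi2 x; have := @pi_gt0 R.
by move=> *; apply/andP; split; lra.
Qed.

Lemma stereoK th : arc th -> ster_inv (stereo th) = th.
Proof.
rewrite /arc /= in_itv/= /minus_i_angle => /andP[t1 t2].
pose x := tan ((pi / 2 - th) / 2).
have xE : ster_inv x = th.
  rewrite /ster_inv /x tanK; first by field.
  by rewrite in_itv/=; apply/andP; split; lra.
by rewrite -{1}xE ster_invK xE.
Qed.

Lemma oneDsin_gt0 th : arc th -> 0 < 1 + sin th.
Proof. by move=> /stereoK <-; rewrite oneDsin_ster_inv divr_gt0// oneDsqr_gt0. Qed.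

Lemma oneDsin_ge0 th : 0 <= 1 + sin th.
Proof. by rewrite -lerBlDl sub0r sin_geN1. Qed.

Lemma meas_stereo : measurable_fun setT (@stereo R).
Proof.
apply: measurable_funM; first exact: cont_meas (@continuous_cos R).
by apply: measV; apply: measurable_funD => //; exact: cont_meas (@continuous_sin R).
Qed.

Lemma ster_inv_lt : {homo ster_inv : x y /~ x < y}.
Proof. by move=> x y xy; rewrite /ster_inv ltrD2l ltrN2 ltr_pM2l//; exact: lt_atan. Qed.

(** Pi decreases with speed 1 / (1 + sin th), the density of dx with respect to
    d th. *)
Lemma is_derive_stereo th : 1 + sin th != 0 -> is_derive th 1 (@stereo R) (- (1 + sin th)^-1).
Proof.
move=> sn0.
have H := dM (is_derive_cos th) (@dV R (fun t => 1 + sin t) th _ sn0 (dD (dC 1 th) (is_derive_sin th))).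
apply: (is_derive_eq H).
have := cos2Dsin2 th => h.
have -> : cos th * (- (0 + cos th) / (1 + sin th) ^+ 2) = - (cos th ^+ 2) / (1 + sin th) ^+ 2 by ring.
rewrite cos2sin2; by field.
Qed.

Lemma measurable_arc : measurable arc. Proof. exact: measurable_itv. Qed.

Let wmeas : measurable_fun arc (fun th => (1 + sin th)^-1).
Proof.
apply: measurable_funTS; apply: measV; apply: measurable_funD => //.
exact: cont_meas (@continuous_sin R).
Qed.

Let w0 th : arc th -> 0 <= (1 + sin th)^-1.
Proof. by move=> /oneDsin_gt0 h; rewrite invr_ge0 ltW. Qed.

(** The preimage of an interval is an interval, and Pi is a primitive of -1 /
    (1 + sin). *)
Let wP (a b : R) : a < b ->
  (\int[mu]_(x in arc `&` (@stereo R) @^-1` `]a, b]) ((1 + sin x)^-1)%:E)%E = (b - a)%:E.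
Proof.
move=> ab.
have ba := ster_inv_lt ab.
rewrite (_ : _ `&` _ = `[ster_inv b, ster_inv a[%classic); last first.
  apply/seteqP; split=> th /=.
    move=> [ath]; rewrite !in_itv/= => /andP[at1 tb].
    rewrite -(stereoK ath); apply/andP; split.
      by move: tb; rewrite le_eqVlt => /predU1P[->//|/ster_inv_lt/ltW].
    exact: ster_inv_lt.
  rewrite in_itv/= => /andP[bt ta].
  have ath : arc th.
    have := ster_inv_arc a; have := ster_inv_arc b; rewrite /arc /= !in_itv/= => /andP[? ?] /andP[? ?].
    by apply/andP; split; [exact: lt_le_trans bt|exact: lt_trans ta _].
  split=> //; rewrite in_itv/=; move: bt ta; rewrite -{1 2}(stereoK ath) => bt ta.
  apply/andP; split.
    rewrite ltNge; apply/negP; rewrite le_eqVlt => /predU1P[e|/ster_inv_lt h].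
      by move: ta; rewrite e ltxx.
    by have := lt_trans ta h; rewrite ltxx.
  rewrite leNgt; apply/negP => /ster_inv_lt h.
  by have := le_lt_trans bt h; rewrite ltxx.
have sub th : ster_inv b <= th <= ster_inv a -> arc th.
  move=> /andP[bt ta].
  have := ster_inv_arc a; have := ster_inv_arc b; rewrite /arc /= !in_itv/= => /andP[? ?] /andP[? ?].
  by apply/andP; split; [exact: lt_le_trans bt|exact: le_lt_trans ta _].
have cw th : arc th -> {for th, continuous (fun t : R => (1 + sin t)^-1)}.
  move=> ath; apply: cvgV; first by rewrite gt_eqF// oneDsin_gt0.
  by apply: cvgD; [exact: cvg_cst|exact: continuous_sin].
have cs th : arc th -> {for th, continuous (fun t : R => - stereo t)}.
  move=> ath; apply: derivable_cont.
  by have H := dN (is_derive_stereo (lt0r_neq0 (oneDsin_gt0 ath))); exact: ex_derive.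
rewrite integral_itv_bndo_bndc; last first.
  by apply: meas_EFin; apply: measurable_funTS; apply: measV; apply: measurable_funD => //; exact: cont_meas (@continuous_sin R).
rewrite (@continuous_FTC2 _ (fun t => (1 + sin t)^-1) (fun t => - stereo t))//.
- by rewrite !ster_invK -EFinB opprK addrC.
- apply: continuous_in_subspaceT => th; rewrite inE/= in_itv/= => h; exact: cw (sub _ h).
- split.
  + move=> th; rewrite in_itv/= => /andP[h1 h2].
    have ath : arc th by apply: sub; rewrite !ltW.
    by have H := dN (is_derive_stereo (lt0r_neq0 (oneDsin_gt0 ath))); exact: ex_derive.
  + by apply: cvg_at_right_filter; apply: cs; exact: ster_inv_arc.
  + by apply: cvg_at_left_filter; apply: cs; exact: ster_inv_arc.
- move=> th; rewrite in_itv/= => /andP[h1 h2].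
  have ath : arc th by apply: sub; rewrite !ltW.
  by have H := dN (is_derive_stereo (lt0r_neq0 (oneDsin_gt0 ath))); rewrite derive1E derive_val opprK.
Qed.

Lemma stereo_intg (f : R -> R) : measurable_fun setT f ->
  intg setT f <-> intg arc (fun th => f (stereo th) / (1 + sin th)).
Proof. exact: (cov_intg measurable_arc meas_stereo wmeas w0 wP). Qed.

Lemma stereo_Rint (f : R -> R) : measurable_fun setT f ->
  (\int[mu]_x f x = \int[mu]_(th in arc) (f (stereo th) / (1 + sin th)))%R.
Proof. exact: (cov_Rint measurable_arc meas_stereo wmeas w0 wP). Qed.

Lemma arc_circle : arc `<=` circle.
Proof. by move=> x; rewrite /arc /circle /= !in_itv/= => /andP[/ltW -> ->]. Qed.

Lemma intg_arc_circle (f : R -> R) : intg arc f <-> intg circle f.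
Proof.
split; last by apply: (@intgS _ _ circle) => //; [exact: measurable_arc|exact: arc_circle].
move=> If.
have -> : circle = [set mia] `|` arc.
  rewrite /circle /arc; apply/seteqP; split=> x /=; rewrite !in_itv/=.
    move=> /andP[]; rewrite le_eqVlt => /predU1P[->|-> ->]; [by left|by right].
  by move=> [->|/andP[/ltW -> ->]//]; rewrite lexx ltrDl pi2_gt0.
apply/integrableP; have /integrableP[mf fy] := If; split.
  apply/measurable_funU => //; first exact: measurable_arc.
  by split => //; exact: measurable_fun_set1.
rewrite ge0_integral_setU//=; last 3 first.
- exact: measurable_arc.
- apply: measurableT_comp => //; apply/measurable_funU => //; first exact: measurable_arc.
  split; first exact: measurable_fun_set1.
  by apply: measurableT_comp => //; exact: intg_meas If.
- by apply/disj_setPS => x [-> /=]; rewrite /arc /= in_itv/= ltxx.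
by rewrite integral_set1 add0e.
Qed.

Lemma Rint_arc_circle (f : R -> R) : intg circle f ->
  (\int[mu]_(t in arc) f t = \int[mu]_(t in circle) f t)%R.
Proof.
move=> If; rewrite /arc /circle Rintegral_itv_obnd_cbnd//.
by apply/intg_arc_circle.
Qed.

End Stereo.

(** * The half-Laplacian of the line in real form *)

Section Schwartz.
Context {R : realType}.
Local Notation mu := (@lebesgue_measure R).
Implicit Types (x y xi t : R) (a b : R -> R).

Lemma intg_cauchy : intg setT (fun x : R => (1 + x ^+ 2)^-1).
Proof.
apply/stereo_intg.
  by apply: measV; apply: measurable_funD => //; exact: measurable_funX.
apply/intg_arc_circle; apply: (@intg_circle_bounded _ _ 1).
  apply: measurable_funM; apply: measV; apply: measurable_funD => //.
    by apply: measurable_funX; exact: meas_stereo.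
  exact: cont_meas (@continuous_sin R).
move=> t; have s0 := oneDsin_ge0 t.
have [e|e] := eqVneq (1 + sin t) 0; first by rewrite e invr0 mulr0 normr0.
have st : 0 < 1 + sin t by rewrite lt_def e.
rewrite /stereo expr_div_n cos2sin2.
have -> : 1 + (1 - sin t ^+ 2) / (1 + sin t) ^+ 2 = 2 / (1 + sin t) by field.
rewrite invf_div -mulrA mulrC -mulrA mulVf// mulr1 ger0_norm ?invr_ge0//.
by rewrite invf_le1// ler1n.
Qed.

Lemma sch_derive1 a : rschwartz a -> rschwartz (derive1 a).
Proof.
move=> [sa ba]; split; first exact: rsmooth_derive1.
by move=> m n; have [C hC] := ba m n.+1; exists C => x; rewrite -derive1Sn.
Qed.

Lemma sch_cont a : rschwartz a -> continuous a.
Proof. by move=> [sa _]; exact: rsmooth_cont. Qed.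

Lemma sch_meas a : rschwartz a -> measurable_fun setT a.
Proof. by move=> sa; apply: cont_meas; exact: sch_cont. Qed.

Lemma sch_decay a (m : nat) : rschwartz a -> exists C : R, forall x, `|x| ^+ m * `|a x| <= C.
Proof. by move=> [_ ba]; have [C hC] := ba m 0%N; exists C. Qed.

(** Two bounds of this kind give integrability by comparison with 1 / (1 +
    x^2). *)
Lemma decay2 (g : R -> R) (C0 C2 : R) : (forall x, `|g x| <= C0) -> (forall x, `|x| ^+ 2 * `|g x| <= C2) ->
  forall x, `|g x| <= (C0 + C2) * (1 + x ^+ 2)^-1.
Proof.
move=> h0 h2 x; rewrite ler_pdivlMr ?oneDsqr_gt0//.
have := h0 x; have := h2 x; rewrite real_normK ?num_real//; lra.
Qed.

Lemma sch_le a : rschwartz a -> exists C : R, forall x, `|a x| <= C * (1 + x ^+ 2)^-1.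
Proof.
move=> sa; have [C0 h0] := sch_decay 0 sa; have [C2 h2] := sch_decay 2 sa.
exists (C0 + C2); apply: decay2 => // x.
by have := h0 x; rewrite expr0 mul1r.
Qed.

Lemma sch_intg a : rschwartz a -> intg setT a.
Proof.
move=> sa; have [C hC] := sch_le sa.
apply: (@intg_le _ _ _ (fun x => C * (1 + x ^+ 2)^-1)) => //; first exact: sch_meas.
by apply: intgZ => //; exact: intg_cauchy.
Qed.

Lemma intgM_bounded (D : set R) (f g : R -> R) (C : R) : measurable D -> intg D f ->
  measurable_fun D g -> (forall x, `|g x| <= C) -> intg D (fun x => f x * g x).
Proof.
move=> mD If mg gC; apply: (@intg_le _ _ _ (fun x => C * `|f x|)) => //.
- by apply: measurable_funM => //; exact: intg_meas.
- by move=> x _; rewrite normrM mulrC ler_wpM2r.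
- by apply: intgZ => //; exact: intg_norm.
Qed.

Lemma meas_cosM (m : R) : measurable_fun setT (fun t : R => cos (t * m)).
Proof. by apply: (measurableT_comp (cont_meas (D:=setT) (@continuous_cos R))); exact: measurable_funM. Qed.
Lemma meas_sinM (m : R) : measurable_fun setT (fun t : R => sin (t * m)).
Proof. by apply: (measurableT_comp (cont_meas (D:=setT) (@continuous_sin R))); exact: measurable_funM. Qed.

(** With [sin_transform], the real part and the opposite of the imaginary part
    of the Fourier transform. *)
Definition cos_transform a xi : R := (\int[mu]_y (a y * cos (y * xi)))%R.
Definition sin_transform a xi : R := (\int[mu]_y (a y * sin (y * xi)))%R.

Lemma intg_cos_transform a xi : intg setT a -> intg setT (fun y => a y * cos (y * xi)).
Proof. by move=> ia; apply: (@intgM_bounded _ _ _ 1) => //; [exact: meas_cosM|move=> x; exact: cos_max]. Qed.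
Lemma intg_sin_transform a xi : intg setT a -> intg setT (fun y => a y * sin (y * xi)).
Proof. by move=> ia; apply: (@intgM_bounded _ _ _ 1) => //; [exact: meas_sinM|move=> x; exact: sin_max]. Qed.

Lemma Rint_norm_le (f g : R -> R) : intg setT f -> intg setT g -> (forall x, `|f x| <= g x) ->
  `|(\int[mu]_x f x)%R| <= (\int[mu]_x g x)%R.
Proof.
move=> If Ig fg.
have h := @le_normr_Rintegral _ _ _ mu setT f measurableT If.
apply: (le_trans h).
by apply: le_Rintegral => //; exact: intg_norm.
Qed.

Lemma cos_transform_le a xi : intg setT a -> `|cos_transform a xi| <= (\int[mu]_y `|a y|)%R.
Proof.
move=> ia; apply: Rint_norm_le; [exact: intg_cos_transform|exact: intg_norm|].
by move=> x; rewrite normrM ler_piMr// cos_max.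
Qed.
Lemma sin_transform_le a xi : intg setT a -> `|sin_transform a xi| <= (\int[mu]_y `|a y|)%R.
Proof.
move=> ia; apply: Rint_norm_le; [exact: intg_sin_transform|exact: intg_norm|].
by move=> x; rewrite normrM ler_piMr// sin_max.
Qed.

Lemma cvg0_harmonic (f : nat -> R) (C : R) : (forall n, `|f n| <= C / n.+1%:R) -> f @ \oo --> 0.
Proof.
move=> fC.
have h0 : (fun n => C * harmonic n) @ \oo --> 0.
  by rewrite -[X in _ --> X](mulr0 C); apply: cvgM; [exact: cvg_cst|exact: cvg_harmonic].
apply: (@squeeze_cvgr _ _ _ _ (fun n => - (C * harmonic n)) (fun n => C * harmonic n)) => //.
  by apply: nearW => n; rewrite -ler_norml.
by rewrite -oppr0; apply: cvgN.
Qed.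

Lemma sch_cvg0 a (g : R -> R) : rschwartz a -> (forall x, `|g x| <= 1) ->
  (fun n : nat => a n%:R * g n%:R) @ \oo --> 0 /\
  (fun n : nat => a (- n%:R) * g (- n%:R)) @ \oo --> 0.
Proof.
move=> sa g1; have [C0 h0] := sch_decay 0 sa; have [C1 h1] := sch_decay 1 sa.
have key (e : R) : `|e| = 1 -> (fun n : nat => a (e * n%:R) * g (e * n%:R)) @ \oo --> 0.
  move=> e1.
  apply: (@cvg0_harmonic _ (C0 + C1)) => n; rewrite normrM (@le_trans _ _ `|a (e * n%:R)|)//.
    by rewrite ler_piMr.
  rewrite ler_pdivlMr// -natr1.
  have := h0 (e * n%:R); have := h1 (e * n%:R).
  by rewrite expr0 expr1 normrM e1 !mul1r ger0_norm//; lra.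
split.
  by have := key 1 (normr1 _); under eq_fun do rewrite !mul1r.
by have := key (-1) _; rewrite normrN1 => /(_ erefl); under eq_fun do rewrite !mulN1r.
Qed.

Lemma dMcos xi y : is_derive y 1 (fun y : R => cos (y * xi)) (- sin (y * xi) * xi).
Proof.
apply: (is_derive_eq (dcomp (is_derive_cos _) (dM (dI y) (dC xi y)))).
by rewrite mul1r mulr0 addr0.
Qed.
Lemma dMsin xi y : is_derive y 1 (fun y : R => sin (y * xi)) (cos (y * xi) * xi).
Proof.
apply: (is_derive_eq (dcomp (is_derive_sin _) (dM (dI y) (dC xi y)))).
by rewrite mul1r mulr0 addr0.
Qed.

Lemma fourier_line_ibp a xi : rschwartz a ->
  xi * cos_transform a xi = - sin_transform (derive1 a) xi /\ xi * sin_transform a xi = cos_transform (derive1 a) xi.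
Proof.
move=> sa; have sa1 := sch_derive1 sa.
have ia := sch_intg sa; have ia1 := sch_intg sa1.
have da y := rsmooth_is_derive y sa.1.
have ccos : continuous (fun y : R => cos (y * xi)) by apply: deriv_cont; exact: dMcos.
have csin : continuous (fun y : R => sin (y * xi)) by apply: deriv_cont; exact: dMsin.
have ca := sch_cont sa; have ca1 := sch_cont sa1.
split.
- have [l1 l2] := sch_cvg0 sa (fun y => sin_max (y * xi)).
  have H := @Rint_improper _ (fun y => derive1 a y * sin (y * xi) + xi * (a y * cos (y * xi)))
    (fun y => a y * sin (y * xi)) 0 0 _ _ _ l1 l2.
  apply/eqP; rewrite -addr_eq0 addrC -Rint_Z ?intg_cos_transform// -Rint_D//; last 2 first.
  + exact: intg_sin_transform.
  + by apply: intgZ => //; exact: intg_cos_transform.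
  apply/eqP; transitivity (0 - 0 : R); last by rewrite subrr.
  apply: H.
  + move=> y; apply: (is_derive_eq (dM (da y) (dMsin xi y))); ring.
  + move=> y; apply: cvgD; first by apply: cvgM; [exact: ca1|exact: csin].
    by apply: cvgM; [exact: cvg_cst|apply: cvgM; [exact: ca|exact: ccos]].
  + by apply: intgD => //; [exact: intg_sin_transform|apply: intgZ => //; exact: intg_cos_transform].
- have [l1 l2] := sch_cvg0 sa (fun y => cos_max (y * xi)).
  have H := @Rint_improper _ (fun y => derive1 a y * cos (y * xi) - xi * (a y * sin (y * xi)))
    (fun y => a y * cos (y * xi)) 0 0 _ _ _ l1 l2.
  apply/eqP; rewrite eq_sym -subr_eq0 -Rint_Z ?intg_sin_transform// -Rint_B//; last 2 first.
  + exact: intg_cos_transform.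
  + by apply: intgZ => //; exact: intg_sin_transform.
  apply/eqP; transitivity (0 - 0 : R); last by rewrite subrr.
  apply: H.
  + move=> y; apply: (is_derive_eq (dM (da y) (dMcos xi y))); ring.
  + move=> y; apply: cvgB; first by apply: cvgM; [exact: ca1|exact: ccos].
    by apply: cvgM; [exact: cvg_cst|apply: cvgM; [exact: ca|exact: csin]].
  + by apply: intgB => //; [exact: intg_cos_transform|apply: intgZ => //; exact: intg_sin_transform].
Qed.

(** Each integration by parts trades a factor xi for a derivative, and the
    transform of an integrable function is bounded. *)
Lemma transform_decay a : rschwartz a -> exists C : R, forall xi,
  `|xi| * `|cos_transform a xi| <= C * (1 + xi ^+ 2)^-1 /\ `|xi| * `|sin_transform a xi| <= C * (1 + xi ^+ 2)^-1.
Proof.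
move=> sa; have s1 := sch_derive1 sa; have s2 := sch_derive1 s1; have s3 := sch_derive1 s2.
pose N (f : R -> R) := (\int[mu]_y `|f y|)%R.
exists (N (derive1 a) + N (derive1 (derive1 (derive1 a)))) => xi.
have [c0 d0] := fourier_line_ibp xi sa.
have [c1 d1] := fourier_line_ibp xi s1.
have [c2 d2] := fourier_line_ibp xi s2.
rewrite !ler_pdivlMr ?oneDsqr_gt0//; split.
- have -> : `|xi| * `|cos_transform a xi| * (1 + xi ^+ 2) = `|xi * cos_transform a xi| + `|xi * (xi * (xi * cos_transform a xi))|.
    by rewrite !normrM -[xi ^+ 2]real_normK ?num_real//; ring.
  rewrite c0 !mulrN !normrN d1 c2 normrN lerD//; apply: sin_transform_le; exact: sch_intg.
- have -> : `|xi| * `|sin_transform a xi| * (1 + xi ^+ 2) = `|xi * sin_transform a xi| + `|xi * (xi * (xi * sin_transform a xi))|.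
    by rewrite !normrM -[xi ^+ 2]real_normK ?num_real//; ring.
  rewrite d0 c1 !mulrN !normrN d2 lerD//; apply: cos_transform_le; exact: sch_intg.
Qed.

Let meas_transform (g : R -> R) a : continuous g -> (forall x, `|g x| <= 1) -> intg setT a ->
  measurable_fun setT (fun xi => (\int[mu]_y (a y * g (y * xi)))%R).
Proof.
move=> cg g1 ia.
have mg : measurable_fun setT g by exact: cont_meas.
have mz (y : R) : measurable_fun setT (fun xi : R => g (y * xi)).
  by apply: measurableT_comp => //; exact: measurable_funM.
have I y : intg setT (fun z => a z * g (z * y)).
  apply: (@intgM_bounded _ _ _ 1) => //; apply: measurableT_comp => //; exact: measurable_funM.
have mH : measurable_fun setT (fun xi => (\int[mu]_y ((1 + xi ^+ 2)^-1 * (a y * g (y * xi))))%R).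
  apply: intg_meas; apply: (proj1 (@Rint_Fubini R setT setT (fun xi y => (1 + xi ^+ 2)^-1 * (a y * g (y * xi)))
   (fun xi => (1 + xi ^+ 2)^-1) (fun y => `|a y|) measurableT measurableT _ _ intg_cauchy (intg_norm ia))).
  - apply: measurable_funM.
      apply: (measurableT_comp meas_inv); apply: measurable_funD => //.
      by apply: measurable_funX.
    apply: measurable_funM; first by apply: measurableT_comp => //; exact: intg_meas ia.
    by apply: measurableT_comp => //; apply: measurable_funM.
  - move=> xi y _ _; rewrite normrM ger0_norm ?invr_ge0 ?(ltW (oneDsqr_gt0 _))//.
    rewrite ler_wpM2l ?invr_ge0 ?(ltW (oneDsqr_gt0 _))//.
    by rewrite normrM ler_piMr.
have -> : (fun xi => (\int[mu]_y (a y * g (y * xi)))%R) = (fun xi => (1 + xi ^+ 2) *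
    (\int[mu]_y ((1 + xi ^+ 2)^-1 * (a y * g (y * xi))))%R).
  by apply/funext => xi; rewrite Rint_Z// mulVKf// oneDsqr_neq0.
apply: measurable_funM => //; apply: measurable_funD => //; exact: measurable_funX.
Qed.

Lemma meas_cos_transform a : intg setT a -> measurable_fun setT (cos_transform a).
Proof. by move=> ia; apply: meas_transform => //; [exact: continuous_cos|exact: cos_max]. Qed.
Lemma meas_sin_transform a : intg setT a -> measurable_fun setT (sin_transform a).
Proof. by move=> ia; apply: meas_transform => //; [exact: continuous_sin|exact: sin_max]. Qed.

(** The real part of the transform of a at xi times exp (i x xi), an even
    function of xi; the imaginary part is odd. *)
Definition symb a x xi : R := cos_transform a xi * cos (x * xi) + sin_transform a xi * sin (x * xi).

(** (-Delta)^(1/2) on the line for a real function: the integral over all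
    frequencies folded onto the positive ones. *)
Definition line_hlap a x : R := pi^-1 * (\int[mu]_(xi in `[0%R, +oo[) (xi * symb a x xi))%R.

Lemma symb_decay a x : rschwartz a -> exists C : R, forall xi, `|xi * symb a x xi| <= C * (1 + xi ^+ 2)^-1.
Proof.
move=> sa; have [C hC] := transform_decay sa; exists (C + C) => xi.
have [h1 h2] := hC xi.
rewrite /symb mulrDr (le_trans (ler_normD _ _))// mulrDl lerD//.
  by rewrite !normrM (le_trans _ h1)// mulrA ler_piMr ?cos_max// mulr_ge0.
by rewrite !normrM (le_trans _ h2)// mulrA ler_piMr ?sin_max// mulr_ge0.
Qed.

Lemma meas_symb a x : rschwartz a -> measurable_fun setT (fun xi => xi * symb a x xi).
Proof.
move=> sa; have ia := sch_intg sa.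
have mc : measurable_fun setT (fun xi : R => cos (x * xi)).
  by have := meas_cosM x; under eq_fun do rewrite mulrC.
have ms : measurable_fun setT (fun xi : R => sin (x * xi)).
  by have := meas_sinM x; under eq_fun do rewrite mulrC.
apply: measurable_funM => //; apply: measurable_funD; apply: measurable_funM => //.
  exact: meas_cos_transform.
exact: meas_sin_transform.
Qed.

Lemma cos_transformN a xi : cos_transform a (- xi) = cos_transform a xi.
Proof. by apply: eq_Rint => y _; rewrite mulrN cosN. Qed.
Lemma sin_transformN a xi : intg setT a -> sin_transform a (- xi) = - sin_transform a xi.
Proof.
move=> ia; rewrite /sin_transform -RintN//; last exact: intg_sin_transform.
by apply: eq_Rint => y _; rewrite mulrN sinN mulrN.
Qed.

(** For complex functions the odd parts in xi integrate to 0, so that real and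
    imaginary parts do not interact. *)
Lemma half_lap_line_real a b x : rschwartz a -> rschwartz b ->
  half_lap_line (fun y => a y +i* b y) x = line_hlap a x +i* line_hlap b x.
Proof.
move=> sa sb; have ia := sch_intg sa; have ib := sch_intg sb.
have FE xi : fourier (fun y => a y +i* b y) xi = (cos_transform a xi + sin_transform b xi) +i* (cos_transform b xi - sin_transform a xi).
  rewrite /fourier /cintegral; congr (_ +i* _).
    rewrite /cos_transform /sin_transform -Rint_D ?intg_cos_transform ?intg_sin_transform//; apply: eq_Rint => y _.
    by rewrite Re_M /= cosN sinN mulrN opprK.
  rewrite /cos_transform /sin_transform -Rint_B ?intg_cos_transform ?intg_sin_transform//; apply: eq_Rint => y _.
  by rewrite Im_M /= cosN sinN mulrN addrC.
have [Ca ha] := transform_decay sa; have [Cb hb] := transform_decay sb.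
have mc : measurable_fun setT (fun xi : R => cos (x * xi)).
  by have := meas_cosM x; under eq_fun do rewrite mulrC.
have ms : measurable_fun setT (fun xi : R => sin (x * xi)).
  by have := meas_sinM x; under eq_fun do rewrite mulrC.
have mFca := meas_cos_transform ia; have mFsa := meas_sin_transform ia; have mFcb := meas_cos_transform ib; have mFsb := meas_sin_transform ib.
pose hr xi := `|xi| * ((cos_transform a xi + sin_transform b xi) * cos (x * xi) - (cos_transform b xi - sin_transform a xi) * sin (x * xi)).
pose hi xi := `|xi| * ((cos_transform a xi + sin_transform b xi) * sin (x * xi) + (cos_transform b xi - sin_transform a xi) * cos (x * xi)).
have mnorm : measurable_fun setT (fun xi : R => `|xi|) by apply: measurableT_comp.
have mhr : measurable_fun setT hr.
  apply: measurable_funM => //; apply: measurable_funB; apply: measurable_funM => //.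
    exact: measurable_funD.
  exact: measurable_funB.
have mhi : measurable_fun setT hi.
  apply: measurable_funM => //; apply: measurable_funD; apply: measurable_funM => //.
    exact: measurable_funD.
  exact: measurable_funB.
have key xi (c s : R) : `|c| <= 1 -> `|s| <= 1 ->
   `| `|xi| * ((cos_transform a xi + sin_transform b xi) * c + (cos_transform b xi - sin_transform a xi) * s)| <= (Ca + Ca + Cb + Cb) * (1 + xi ^+ 2)^-1.
  move=> c1 s1; have [a1 a2] := ha xi; have [b1 b2] := hb xi.
  rewrite normrM normr_id.
  have : `|(cos_transform a xi + sin_transform b xi) * c + (cos_transform b xi - sin_transform a xi) * s| <= `|cos_transform a xi| + `|sin_transform b xi| + `|cos_transform b xi| + `|sin_transform a xi|.
    rewrite -addrA (le_trans (ler_normD _ _))// !normrM lerD//.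
      by rewrite (le_trans (ler_piMr _ c1))// ler_normD.
    by rewrite (le_trans (ler_piMr _ s1))// ler_normB.
  move=> /(ler_wpM2l (normr_ge0 xi)) /le_trans; apply; rewrite !mulrDr !mulrDl; lra.
have Ihr : intg setT hr.
  apply: (@intg_le _ _ _ (fun xi => (Ca + Ca + Cb + Cb) * (1 + xi ^+ 2)^-1)) => //.
    move=> xi _; rewrite /hr -mulrN; apply: key; rewrite ?normrN ?cos_max ?sin_max//.
  by apply: intgZ => //; exact: intg_cauchy.
have Ihi : intg setT hi.
  apply: (@intg_le _ _ _ (fun xi => (Ca + Ca + Cb + Cb) * (1 + xi ^+ 2)^-1)) => //.
    by move=> xi _; apply: key; rewrite ?cos_max ?sin_max.
  by apply: intgZ => //; exact: intg_cauchy.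
have Is (f : R -> R) : rschwartz f -> intg `[0, +oo[ (fun xi => xi * symb f x xi).
  move=> sf; have [C hC] := symb_decay x sf.
  apply: (@intg_le _ _ _ (fun xi => C * (1 + xi ^+ 2)^-1)) => //.
    by apply: measurable_funTS; exact: meas_symb.
  apply: intgZ => //.
  by apply: (@intgS _ _ setT) => //; exact: intg_cauchy.
rewrite /half_lap_line /inv_fourier /cintegral.
have -> : (\int[mu]_xi complex.Re (`|xi|%:C * fourier (fun y => a y +i* b y) xi * expi (x * xi)))%R
   = 2 * (\int[mu]_(xi in `[0%R, +oo[) (xi * symb a x xi))%R.
  transitivity (\int[mu]_xi hr xi)%R.
    by apply: eq_Rint => xi _; rewrite FE /hr Re_M /=; ring.
  rewrite Rint_even0// -Rint_Z//; last exact: Is.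
  apply: eq_Rint => xi; rewrite /= in_itv/= andbT => xi0.
  rewrite /hr normrN (ger0_norm xi0) !cos_transformN !sin_transformN// mulrN cosN sinN /symb; ring.
have -> : (\int[mu]_xi complex.Im (`|xi|%:C * fourier (fun y => a y +i* b y) xi * expi (x * xi)))%R
   = 2 * (\int[mu]_(xi in `[0%R, +oo[) (xi * symb b x xi))%R.
  transitivity (\int[mu]_xi hi xi)%R.
    by apply: eq_Rint => xi _; rewrite FE /hi Im_M /=; ring.
  rewrite Rint_even0// -Rint_Z//; last exact: Is.
  apply: eq_Rint => xi; rewrite /= in_itv/= andbT => xi0.
  rewrite /hi normrN (ger0_norm xi0) !cos_transformN !sin_transformN// mulrN cosN sinN /symb; ring.
rewrite /line_hlap; apply/eqP; rewrite eq_complex /=.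
have pn0 : pi != 0 :> R by rewrite gt_eqF// pi_gt0.
move: (pi : R) pn0 => p pn0; move: (Rintegral _ _ _) (Rintegral _ _ _) => I J.
by apply/andP; split; apply/eqP; field; exact: pn0.
Qed.

End Schwartz.

(** * Abel summation of the half-Laplacian of the line *)

Section Abel.
Context {R : realType}.
Local Notation mu := (@lebesgue_measure R).
Implicit Types (x y xi t e : R) (a b : R -> R).

(** The cosine transform of xi exp (-e xi) on the positive axis
    ([laplace_cos]). *)
Definition abel_kernel e t : R := (e ^+ 2 - t ^+ 2) / (e ^+ 2 + t ^+ 2) ^+ 2.

Lemma meas_abel_kernel e : measurable_fun setT (abel_kernel e).
Proof.
apply: measurable_funM; first by apply: measurable_funB => //; exact: measurable_funX.
apply: measV; apply: measurable_funX; apply: measurable_funD => //; exact: measurable_funX.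
Qed.

Lemma abel_kernelN e t : abel_kernel e (- t) = abel_kernel e t. Proof. by rewrite /abel_kernel sqrrN. Qed.

Lemma sqDsqr_gt0 e t : 0 < e -> 0 < e ^+ 2 + t ^+ 2.
Proof. by move=> e0; rewrite ltr_pwDl ?sqr_ge0// exprn_gt0. Qed.

Lemma abel_kernel_le e t : 0 < e -> `|abel_kernel e t| <= (e ^+ 2 + t ^+ 2)^-1.
Proof.
move=> e0; have r0 := sqDsqr_gt0 t e0.
rewrite /abel_kernel normrM normfV [X in _ / X]gtr0_norm ?exprn_gt0// ler_pdivrMr ?exprn_gt0//.
rewrite expr2 mulKf ?gt_eqF// (le_trans (ler_normB _ _))//.
by rewrite !ger0_norm ?sqr_ge0.
Qed.

(** Uniform in e: dominates the kernel against a remainder of second order. *)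
Lemma abel_kernel_sqr_le e t : 0 < e -> `|abel_kernel e t * t ^+ 2| <= 1.
Proof.
move=> e0; have r0 := sqDsqr_gt0 t e0; rewrite normrM [X in _ * X]ger0_norm ?sqr_ge0//.
apply: (le_trans (ler_wpM2r (sqr_ge0 t) (abel_kernel_le t e0))).
by rewrite mulrC ler_pdivrMr// mul1r lerDr sqr_ge0.
Qed.

Lemma intg_abel_kernel e : 0 < e -> intg setT (abel_kernel e).
Proof.
move=> e0; apply: (@intg_le _ _ _ (fun t => (1 + e ^- 2) * (1 + t ^+ 2)^-1)) => //.
- exact: meas_abel_kernel.
- move=> t _; apply: (le_trans (abel_kernel_le t e0)).
  rewrite ler_pdivlMr ?oneDsqr_gt0// mulrC ler_pdivrMr ?sqDsqr_gt0//.
  rewrite mulrDl mul1r mulrDr mulVf ?gt_eqF ?exprn_gt0//.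
  have : 0 <= e ^- 2 * t ^+ 2 by rewrite mulr_ge0 ?sqr_ge0// invr_ge0 sqr_ge0.
  have := sqr_ge0 e; lra.
- by apply: intgZ => //; exact: intg_cauchy.
Qed.

Lemma cont_sqDsqr e : continuous (fun t : R => e ^+ 2 + t ^+ 2).
Proof. by move=> t; apply: cvgD; [exact: cvg_cst|exact: exprn_continuous]. Qed.

Lemma cont_abel_kernel e : 0 < e -> continuous (abel_kernel e).
Proof.
move=> e0 t; apply: cvgM.
  by apply: cvgB; [exact: cvg_cst|exact: exprn_continuous].
apply: cvgV; first by rewrite gt_eqF// exprn_gt0// sqDsqr_gt0.
by apply: (@cvgM _ _ (nbhs t)); exact: cont_sqDsqr.
Qed.

(** The kernel is the derivative of t / (e^2 + t^2): subtracting a constant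
    from the test function does not change its pairing with the kernel. *)
Lemma Rint_abel_kernel e : 0 < e -> (\int[mu]_t abel_kernel e t)%R = 0.
Proof.
move=> e0.
have key (s : R) : `|s| = 1 -> (fun n : nat => (s * n%:R) / (e ^+ 2 + (s * n%:R) ^+ 2)) @ \oo --> 0.
  move=> s1.
  have ss : s ^+ 2 = 1 by rewrite -real_normK ?num_real// s1 expr1n.
  apply: (@cvg0_harmonic _ _ (e ^- 2 + 2)) => n.
  rewrite normrM normfV [X in _ / X]gtr0_norm ?sqDsqr_gt0// normrM s1 mul1r ger0_norm//.
  rewrite /= ler_pdivrMr ?sqDsqr_gt0// exprMn ss mul1r mulrAC ler_pdivlMr//.
  rewrite mulrDl mulrDr mulVf ?gt_eqF ?exprn_gt0//.
  have n0 : 0 <= n%:R :> R by [].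
  have h1 : 0 <= e ^- 2 * n%:R ^+ 2 by rewrite mulr_ge0 ?sqr_ge0// invr_ge0 sqr_ge0.
  have h2 := sqr_ge0 e.
  rewrite -[n.+1%:R]natr1.
  have [->|n1] := eqVneq n 0%N; first by rewrite mul0r; nra.
  have : 1 <= n%:R :> R by rewrite ler1n lt0n.
  nra.
transitivity (0 - 0 : R); last by rewrite subrr.
apply: (@Rint_improper _ _ (fun t => t / (e ^+ 2 + t ^+ 2))).
- move=> t; have r0 := sqDsqr_gt0 t e0.
  have rn : e ^+ 2 + t ^+ 2 != 0 by rewrite gt_eqF.
  apply: (is_derive_eq (dM (dI t) (@dV R (fun t => e ^+ 2 + t ^+ 2) t _ rn (dD (dC (e ^+ 2) t) (dX 2 (dI t)))))).
  by rewrite /abel_kernel; field.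
- exact: cont_abel_kernel.
- exact: intg_abel_kernel.
- by have := key 1 (normr1 _); under eq_fun do rewrite mul1r.
- by have := key (-1) _; rewrite normrN1 => /(_ erefl); under eq_fun do rewrite mulN1r.
Qed.

Lemma meas_expM e : measurable_fun setT (fun xi : R => expR (- (e * xi))).
Proof.
apply: (measurableT_comp (@measurable_expR R)); apply: measurableT_comp => //.
Qed.

Lemma exp_decay2 e xi (k : nat) : 0 < e -> 0 <= xi -> xi ^+ k.+1 * expR (- (e * xi)) <= (k.+1)`!%:R / e ^+ k.+1.
Proof.
move=> e0 x0; rewrite ler_pdivlMr ?exprn_gt0// mulrC mulrA -exprMn.
by apply: expR_decay; rewrite mulr_ge0// ltW.
Qed.

Lemma intg_xexp e : 0 < e -> intg `[0, +oo[ (fun xi : R => xi * expR (- (e * xi))).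
Proof.
move=> e0.
apply: (@intg_le _ _ _ (fun t => (1`!%:R / e ^+ 1 + 3`!%:R / e ^+ 3) * (1 + t ^+ 2)^-1)) => //.
- by apply: measurable_funTS; apply: measurable_funM => //; exact: meas_expM.
- move=> t; rewrite /= in_itv/= andbT => t0.
  rewrite ger0_norm ?mulr_ge0 ?expR_ge0// ler_pdivlMr ?oneDsqr_gt0//.
  rewrite (_ : t * _ * _ = t ^+ 1 * expR (- (e * t)) + t ^+ 3 * expR (- (e * t))); last by ring.
  by apply: lerD; exact: exp_decay2.
- by apply: intgZ => //; apply: (@intgS _ _ setT) => //; exact: intg_cauchy.
Qed.

(** The primitive is exp (-e xi) times a combination of cos (t xi) and sin (t
    xi) with coefficients of degree 1 in xi. *)
Lemma laplace_cos e t : 0 < e ->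
  (\int[mu]_(xi in `[0%R, +oo[) (xi * expR (- (e * xi)) * cos (t * xi)))%R = abel_kernel e t.
Proof.
move=> e0; have r0 := sqDsqr_gt0 t e0; set r := e ^+ 2 + t ^+ 2 in r0.
have rn : r != 0 by rewrite gt_eqF.
pose A := e / r; pose B := abel_kernel e t; pose C := t / r; pose D := 2 * e * t / r ^+ 2.
(* A, B, C, D solve the linear system e1, ..., e4 that makes G a primitive. *)
pose G xi := - (expR (- (e * xi)) * (cos (t * xi) * (xi * A + B) - sin (t * xi) * (xi * C + D))).
have Elin xi : is_derive xi 1 (fun xi : R => - (e * xi)) (- e).
  by apply: (is_derive_eq (dN (dZ e (dI xi)))); rewrite mulr1.
have dE xi : is_derive xi 1 (fun xi : R => expR (- (e * xi))) (expR (- (e * xi)) * - e).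
  exact: (dcomp (is_derive_expR _) (Elin xi)).
have dc xi : is_derive xi 1 (fun xi : R => cos (t * xi)) (- sin (t * xi) * t).
  by apply: (is_derive_eq (dcomp (is_derive_cos _) (dZ t (dI xi)))); rewrite mulr1.
have ds xi : is_derive xi 1 (fun xi : R => sin (t * xi)) (cos (t * xi) * t).
  by apply: (is_derive_eq (dcomp (is_derive_sin _) (dZ t (dI xi)))); rewrite mulr1.
have dl (p q xi : R) : is_derive xi 1 (fun xi : R => xi * p + q) p.
  by apply: (is_derive_eq (dD (dM (dI xi) (dC p xi)) (dC q xi))); rewrite mul1r mulr0 !addr0.
have dG xi : is_derive xi 1 G (xi * expR (- (e * xi)) * cos (t * xi)).
  apply: (is_derive_eq (dN (dM (dE xi) (dB (dM (dc xi) (dl A B xi)) (dM (ds xi) (dl C D xi)))))).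
  have e1 : e * A + t * C = 1 by rewrite /A /C -/r; move: rn; rewrite /r => rn; field.
  have e2 : e * B - A + t * D = 0 by rewrite /A /B /C /D /abel_kernel -/r; move: rn; rewrite /r => rn; field.
  have e3 : t * A - e * C = 0 by rewrite /A /C -/r; move: rn; rewrite /r => rn; field.
  have e4 : - (e * D) + t * B + C = 0 by rewrite /A /B /C /D /abel_kernel -/r; move: rn; rewrite /r => rn; field.
  move: (expR _) (cos _) (sin _) => E c s.
  transitivity (E * (c * (xi * (e * A + t * C) + (e * B - A + t * D))
     + s * (xi * (t * A - e * C) + (- (e * D) + t * B + C)))); first by ring.
  by rewrite e1 e2 e3 e4; ring.
have I : intg `[0, +oo[ (fun xi => xi * expR (- (e * xi)) * cos (t * xi)).
  apply: (@intgM_bounded _ _ _ _ 1) => //; first exact: intg_xexp.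
    apply: measurable_funTS; apply: (measurableT_comp (cont_meas (D:=setT) (@continuous_cos R))).
    exact: measurable_funM.
  by move=> xi; exact: cos_max.
have G0 : (fun n : nat => G n%:R) @ \oo --> (0 : R).
  pose M := (1`!%:R / e ^+ 1 + 2`!%:R / e ^+ 2 + 1) * (`|A| + `|B| + `|C| + `|D|).
  have hM n : `|G n%:R| <= M / n.+1%:R * 2.
    rewrite /G normrN normrM ger0_norm ?expR_ge0//.
    set E := expR _; have E0 : 0 <= E by exact: expR_ge0.
    have E1 : E <= 1 by rewrite -expR0 ler_expR oppr_le0 mulr_ge0// ltW.
    have n0 : 0 <= n%:R :> R by [].
    have d1 := exp_decay2 0 e0 n0; have d2 := exp_decay2 1 e0 n0; rewrite -/E in d1 d2.
    have h : `|cos (t * n%:R) * (n%:R * A + B) - sin (t * n%:R) * (n%:R * C + D)|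
        <= n.+1%:R * (`|A| + `|B| + `|C| + `|D|).
      have := cos_max (t * n%:R); have := sin_max (t * n%:R).
      move: (cos _) (sin _) => c s s1 c1.
      rewrite (le_trans (ler_normB _ _))// (normrM c) (normrM s).
      have : `|n%:R * A + B| <= n%:R * `|A| + `|B|.
        by rewrite (le_trans (ler_normD _ _))// normrM ger0_norm.
      have : `|n%:R * C + D| <= n%:R * `|C| + `|D|.
        by rewrite (le_trans (ler_normD _ _))// normrM ger0_norm.
      have := normr_ge0 (n%:R * A + B); have := normr_ge0 (n%:R * C + D).
      move: `|_ * A + B| `|_ * C + D| => p q q0 p0 hq hp.
      have : `|c| * p <= p by rewrite ler_piMl.
      have : `|s| * q <= q by rewrite ler_piMl.
      have B0 := normr_ge0 B; have D0 := normr_ge0 D; have A0 := normr_ge0 A; have C0 := normr_ge0 C.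
      have nB : 0 <= n%:R * `|B| by rewrite mulr_ge0.
      have nD : 0 <= n%:R * `|D| by rewrite mulr_ge0.
      rewrite -[n.+1%:R]natr1; move: `|A| `|B| `|C| `|D| B0 D0 A0 C0 nB nD hq hp => a' b' c' d'; lra.
    apply: (le_trans (ler_wpM2l E0 h)).
    have S0 : 0 <= `|A| + `|B| + `|C| + `|D| by rewrite !addr_ge0.
    rewrite mulrA /M; move: (_ + `|D|) (1`!%:R / _) (2`!%:R / _) S0 d1 d2 => S c1 c2 S0 d1 d2.
    rewrite (_ : _ * S / _ * 2 = (c1 + c2 + 1) * 2 / n.+1%:R * S); last by ring.
    rewrite ler_wpM2r// ler_pdivlMr// -[n.+1%:R]natr1.
    have p1 : 0 <= n%:R ^+ 1 * E by rewrite mulr_ge0.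
    have p2 : 0 <= n%:R ^+ 2 * E by rewrite mulr_ge0.
    lra.
  by apply: (@cvg0_harmonic _ _ (M * 2)) => n; rewrite mulrAC; exact: hM.
rewrite (Rint_improper0 dG _ I G0).
  by rewrite sub0r /G !mulr0 oppr0 expR0 cos0 sin0 !mul0r !add0r !mul1r subr0 opprK.
move=> xi; apply: cvgM; last exact: (deriv_cont dc).
by apply: cvgM; [exact: cvg_id|exact: (deriv_cont dE)].
Qed.

Lemma symbE a x xi : intg setT a -> symb a x xi = (\int[mu]_y (a y * cos ((y - x) * xi)))%R.
Proof.
move=> ia; rewrite /symb /cos_transform /sin_transform.
rewrite mulrC -Rint_Z ?intg_cos_transform// [X in _ + X]mulrC -Rint_Z ?intg_sin_transform// -Rint_D//; last 2 first.
- by apply: intgZ => //; exact: intg_cos_transform.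
- by apply: intgZ => //; exact: intg_sin_transform.
by apply: eq_Rint => y _; rewrite mulrBl cosB; ring.
Qed.

Lemma Rint_xexp_symb a x e : 0 < e -> intg setT a ->
  (\int[mu]_(xi in `[0%R, +oo[) (expR (- (e * xi)) * (xi * symb a x xi)) =
   \int[mu]_y (a y * abel_kernel e (y - x)))%R.
Proof.
move=> e0 ia.
pose F xi y := xi * expR (- (e * xi)) * (a y * cos ((y - x) * xi)).
have mc : measurable_fun setT (fun z : R * R => cos ((z.2 - x) * z.1)).
  apply: (measurableT_comp (cont_meas (D:=setT) (@continuous_cos R))).
  by apply: measurable_funM => //; apply: measurable_funB.
have H : (\int[mu]_(xi in `[0%R, +oo[) \int[mu]_y F xi y = \int[mu]_y \int[mu]_(xi in `[0%R, +oo[) F xi y)%R.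
  apply: (proj2 (@Rint_Fubini R `[0, +oo[ setT F (fun xi => xi * expR (- (e * xi))) (fun y => `|a y|)
    (measurable_itv _) measurableT _ _ (intg_xexp e0) (intg_norm ia))).
  - apply: measurable_funM.
      by apply: measurable_funM => //; apply: (measurableT_comp (meas_expM e)).
    by apply: measurable_funM => //; apply: measurableT_comp => //; exact: intg_meas ia.
  - move=> xi y; rewrite /= in_itv/= andbT => x0 _; rewrite /F normrM ger0_norm ?mulr_ge0 ?expR_ge0//.
    by rewrite ler_wpM2l ?mulr_ge0 ?expR_ge0// normrM ler_piMr// cos_max.
transitivity (\int[mu]_(xi in `[0%R, +oo[) \int[mu]_y F xi y)%R.
  apply: eq_Rint => xi _; rewrite symbE// /F mulrCA mulrA -Rint_Z//.
  apply: (@intgM_bounded _ _ _ _ 1) => //; last by move=> y; exact: cos_max.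
  apply: (measurableT_comp (cont_meas (D:=setT) (@continuous_cos R))).
  by apply: measurable_funM => //; apply: measurable_funB.
rewrite H; apply: eq_Rint => y _; rewrite -laplace_cos// -Rint_Z//.
  by apply: eq_Rint => xi _; rewrite /F mulrCA.
apply: (@intgM_bounded _ _ _ _ 1) => //; first exact: intg_xexp.
  apply: measurable_funTS; apply: (measurableT_comp (cont_meas (D:=setT) (@continuous_cos R))).
  exact: measurable_funM.
by move=> xi; exact: cos_max.
Qed.

(** Inserting the convergence factor exp (-e xi) makes it legitimate to
    integrate over xi first. *)
Lemma line_hlap_abel a x : rschwartz a ->
  (fun n : nat => pi^-1 * \int[mu]_y (a y * abel_kernel (harmonic n) (y - x)))%R @ \oo --> line_hlap a x.
Proof.
move=> sa; have ia := sch_intg sa.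
under eq_fun => n do rewrite -Rint_xexp_symb ?harmonic_gt0//.
apply: cvgM; first exact: cvg_cst.
have [C hC] := symb_decay x sa.
apply: (proj2 (@Rint_dct _ _ (fun n xi => expR (- (harmonic n * xi)) * (xi * symb a x xi))
   (fun xi => xi * symb a x xi) (fun xi => C * (1 + xi ^+ 2)^-1) _ _ _ _ _)) => //.
- move=> n; apply: measurable_funTS; apply: measurable_funM; first exact: meas_expM.
  exact: meas_symb.
- move=> xi _; rewrite -[X in _ --> X]mul1r -expR0 -oppr0 -(mul0r xi).
  apply: cvgM; last exact: cvg_cst.
  apply: (@continuous_cvg _ _ _ _ _ _ expR); first exact: continuous_expR.
  by apply: cvgN; apply: cvgM; [exact: cvg_harmonic|exact: cvg_cst].
- move=> n xi; rewrite /= in_itv/= andbT => x0.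
  rewrite normrM (le_trans _ (hC xi))// ler_piMl// ger0_norm ?expR_ge0//.
  by rewrite -expR0 ler_expR oppr_le0 mulr_ge0// harmonic_ge0.
- by apply: intgZ => //; apply: (@intgS _ _ setT) => //; exact: intg_cauchy.
Qed.

End Abel.

(** * Conformal covariance *)

Section Conformal.
Context {R : realType}.
Local Notation mu := (@lebesgue_measure R).
Local Notation circle := (@circle R).
Implicit Types (x y t : R) (e : nat -> R).

(** The chordal distance between two points of the circle in stereographic
    coordinates: the identity behind conformal covariance. *)
Lemma one_sub_cos_ster x y :
  1 - cos (ster_inv y - ster_inv x) = 2 * (y - x) ^+ 2 / ((1 + x ^+ 2) * (1 + y ^+ 2)).
Proof.
have := oneDsqr_neq0 x; have := oneDsqr_neq0 y => ny nx.
rewrite cosB !cos_ster_inv !sin_ster_inv; field; exact/andP.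
Qed.

Lemma sin_ster_sub x y :
  sin (ster_inv y - ster_inv x) = 2 * (x - y) * (1 + x * y) / ((1 + x ^+ 2) * (1 + y ^+ 2)).
Proof.
have := oneDsqr_neq0 x; have := oneDsqr_neq0 y => ny nx.
rewrite sinB !cos_ster_inv !sin_ster_inv; field; exact/andP.
Qed.

Lemma abel_kernel_cvg e t : t != 0 -> e @ \oo --> 0 -> (fun n => abel_kernel (e n) t) @ \oo --> - t ^- 2.
Proof.
move=> t0 e0.
have e2 : (fun n => e n ^+ 2) @ \oo --> 0 by rewrite -[X in _ --> X](mulr0 0); apply: cvgM.
have -> : - t ^- 2 = (0 - t ^+ 2) / (0 + t ^+ 2) ^+ 2 by field.
apply: cvgM; first by apply: cvgB => //; exact: cvg_cst.
apply: cvgV; first by rewrite add0r !expf_neq0.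
by apply: (@cvgM _ _ \oo); apply: cvgD => //; exact: cvg_cst.
Qed.

Lemma meas_ster_inv : measurable_fun setT (@ster_inv R).
Proof.
apply: measurable_funB => //; apply: measurable_funM => //.
exact: cont_meas (@continuous_atan R).
Qed.

Lemma meas_abel_kernel_sub x (c : R) : measurable_fun setT (fun y => abel_kernel c (y - x)).
Proof. by apply: (measurableT_comp (meas_abel_kernel c)); exact: measurable_funB. Qed.

Lemma intg_abel_kernel_sub x (c : R) : 0 < c -> intg setT (fun y => abel_kernel c (y - x)).
Proof. by move=> c0; apply: intg_shift; [exact: meas_abel_kernel|exact: intg_abel_kernel]. Qed.

Lemma Rint_abel_kernel_sub x (c : R) : 0 < c -> (\int[mu]_y abel_kernel c (y - x))%R = 0.
Proof. by move=> c0; rewrite -(Rint_shift (- x) (meas_abel_kernel c)) Rint_abel_kernel. Qed.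

Section Compensator.
Variable x : R.
Let A := 1 + x ^+ 2.
(** The even part of the compensator is t^2 times this function up to a
    constant, see [hx_even]; it is the derivative of ln (1 + (x + t)^2) - ln (1
    + (x - t)^2), which vanishes at both ends. *)
Let p t : R := 2 * (x + t) / (1 + (x + t) ^+ 2) + 2 * (x - t) / (1 + (x - t) ^+ 2).

Let pE t : p t = 4 * x * (A - t ^+ 2) / ((1 + (x + t) ^+ 2) * (1 + (x - t) ^+ 2)).
Proof.
have := oneDsqr_neq0 (x + t); have := oneDsqr_neq0 (x - t) => n1 n2.
by rewrite /p /A; field; rewrite n1 n2.
Qed.

Let shift_sqr t : 1 + t ^+ 2 <= 2 * A * (1 + (x + t) ^+ 2) /\ 1 + t ^+ 2 <= 2 * A * (1 + (x - t) ^+ 2).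
Proof.
rewrite /A; have h1 := sqr_ge0 (t + 2 * x); have h2 := sqr_ge0 (t - 2 * x).
have := sqr_ge0 (x * (x + t)); have := sqr_ge0 (x * (x - t)); have := sqr_ge0 x.
by split; nra.
Qed.

Let p_le t : `|p t| <= 16 * `|x| * A ^+ 3 * (1 + t ^+ 2)^-1.
Proof.
have [h1 h2] := shift_sqr t.
have A1 : 1 <= A by rewrite lerDl sqr_ge0.
have u0 := oneDsqr_gt0 (x + t); have v0 := oneDsqr_gt0 (x - t); have t0 := oneDsqr_gt0 t.
rewrite pE normrM normfV (gtr0_norm (mulr_gt0 u0 v0)) ler_pdivrMr ?mulr_gt0// [X in _ <= X]mulrAC.
rewrite ler_pdivlMr// normrM normrM (ger0_norm (ler0n _ 4)).
have hA : `|A - t ^+ 2| <= A * (1 + t ^+ 2).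
  rewrite (le_trans (ler_normB _ _))// !ger0_norm ?sqr_ge0 ?(le_trans ler01)//.
  have := sqr_ge0 t; nra.
have hQ : (1 + t ^+ 2) ^+ 2 <= 4 * A ^+ 2 * ((1 + (x + t) ^+ 2) * (1 + (x - t) ^+ 2)).
  rewrite (_ : 4 * _ * _ = (2 * A * (1 + (x + t) ^+ 2)) * (2 * A * (1 + (x - t) ^+ 2))); last by ring.
  by rewrite expr2; apply: ler_pM => //; exact: ltW.
have x0 := normr_ge0 x.
have : `|A - t ^+ 2| * (1 + t ^+ 2) <= A * (4 * A ^+ 2 * ((1 + (x + t) ^+ 2) * (1 + (x - t) ^+ 2))).
  apply: (le_trans (ler_wpM2r (ltW t0) hA)).
  rewrite (_ : A * _ * _ = A * (1 + t ^+ 2) ^+ 2); last by ring.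
  by apply: ler_wpM2l hQ; rewrite (le_trans ler01).
move=> /(ler_wpM2l (mulr_ge0 (ler0n _ 4) x0)).
set N := `|_ - _|; set Q := _ * (1 + (x - t) ^+ 2).
rewrite (_ : 4 * `|x| * (N * _) = 4 * `|x| * N * (1 + t ^+ 2)); last by ring.
move=> /le_trans; apply.
by rewrite (_ : 4 * `|x| * _ = 16 * `|x| * A ^+ 3 * Q) //; ring.
Qed.

Let cont_sq (f : R -> R) : continuous f -> continuous (fun t => 1 + f t ^+ 2).
Proof. by move=> cf t; apply: cvgD; [exact: cvg_cst|apply: (@cvgM _ _ (nbhs t)); exact: cf]. Qed.

Let cont_p : continuous p.
Proof.
have ca : continuous (fun t : R => x + t) by move=> t; apply: cvgD; [exact: cvg_cst|exact: cvg_id].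
have cb : continuous (fun t : R => x - t) by move=> t; apply: cvgB; [exact: cvg_cst|exact: cvg_id].
move=> t; apply: cvgD; apply: cvgM.
- by apply: cvgM; [exact: cvg_cst|exact: ca].
- by apply: cvgV; [exact: oneDsqr_neq0|exact: (cont_sq ca)].
- by apply: cvgM; [exact: cvg_cst|exact: cb].
- by apply: cvgV; [exact: oneDsqr_neq0|exact: (cont_sq cb)].
Qed.

Let intg_p : intg `[0, +oo[ p.
Proof.
apply: (@intg_le _ _ _ (fun t => 16 * `|x| * A ^+ 3 * (1 + t ^+ 2)^-1)) => //.
- by apply: measurable_funTS; exact: cont_meas cont_p.
- by apply: intgZ => //; apply: (@intgS _ _ setT) => //; exact: intg_cauchy.
Qed.

Let Rint_p : (\int[mu]_(t in `[0%R, +oo[) p t)%R = 0.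
Proof.
pose F t := ln (1 + (x + t) ^+ 2) - ln (1 + (x - t) ^+ 2).
have dF t : is_derive t 1 F (p t).
  have u0 := oneDsqr_gt0 (x + t); have v0 := oneDsqr_gt0 (x - t).
  have dl (z : R) : 0 < z -> is_derive z 1 (@ln R) z^-1 by exact: is_derive1_ln.
  have du := dD (dC 1 t) (dX 2 (dD (dC x t) (dI t))).
  have dv := dD (dC 1 t) (dX 2 (dB (dC x t) (dI t))).
  rewrite /F; apply: (is_derive_eq (dB (@dcomp R (@ln R) (fun t => 1 + (x + t) ^+ 2) t _ _ (dl _ u0) du) (@dcomp R (@ln R) (fun t => 1 + (x - t) ^+ 2) t _ _ (dl _ v0) dv))).
  rewrite /p /= !expr1; move: (_^-1) (_^-1) => a b; ring.
have lim0 : (fun n : nat => F n%:R) @ \oo --> (0 : R).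
  have lnlim : (fun n : nat => ln ((1 + (x + n%:R) ^+ 2) / (1 + (x - n%:R) ^+ 2))) @ \oo --> ln (1 : R).
    apply: (@continuous_cvg _ _ _ _ _ _ (@ln R)); first by apply: continuous_ln.
    rewrite -[X in _ --> X]addr0.
    have -> : (fun n : nat => (1 + (x + n%:R) ^+ 2) / (1 + (x - n%:R) ^+ 2)) =
        (fun n : nat => 1 + 4 * x * n%:R / (1 + (x - n%:R) ^+ 2)).
      by apply/funext => n; have := oneDsqr_neq0 (x - n%:R) => n1; field.
    apply: cvgD; first exact: cvg_cst.
    apply: (@cvg0_harmonic _ _ (16 * `|x| * A)) => n.
    have [_ h2] := shift_sqr n%:R; have v0 := oneDsqr_gt0 (x - n%:R).
    rewrite normrM normfV (gtr0_norm v0) ler_pdivrMr// [X in _ <= X]mulrAC ler_pdivlMr//.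
    rewrite normrM normrM (ger0_norm (ler0n _ 4)) (ger0_norm (ler0n _ n)).
    have hn : n%:R * n.+1%:R <= 2 * (1 + n%:R ^+ 2) :> R.
      rewrite -[n.+1%:R]natr1; have := sqr_ge0 (n%:R - 1 : R); have := sqr_ge0 (n%:R : R); lra.
    have x0 := normr_ge0 x.
    rewrite -[X in X <= _]mulrA; apply: (le_trans (ler_wpM2l (mulr_ge0 (ler0n _ 4) x0) hn)).
    move: (ler_wpM2l (mulr_ge0 (ler0n _ 8) x0) h2); lra.
  rewrite ln1 in lnlim; apply: cvg_trans lnlim.
  apply: near_eq_cvg; apply: nearW => n.
  by rewrite /F lnM ?posrE ?invr_gt0 ?oneDsqr_gt0// lnV ?posrE ?oneDsqr_gt0.
rewrite (Rint_improper0 dF cont_p intg_p lim0).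
by rewrite /F addr0 subr0 subrr subr0.
Qed.

Let hx t := sin (ster_inv (t + x) - ster_inv x).

Let hx_even t : hx t + hx (- t) = A^-1 * (t ^+ 2 * p t).
Proof.
have := oneDsqr_neq0 (x + t); have := oneDsqr_neq0 (x - t) => n1 n2.
rewrite /hx !sin_ster_sub pE /A; have := oneDsqr_neq0 x => nx.
rewrite [t + x]addrC [- t + x]addrC.
by field; rewrite nx n1 n2.
Qed.

Let meas_hx : measurable_fun setT hx.
Proof.
apply: (measurableT_comp (cont_meas (D:=setT) (@continuous_sin R))).
apply: measurable_funB => //; apply: (measurableT_comp meas_ster_inv).
exact: measurable_funD.
Qed.

(** The two half-Laplacians could differ by the contribution of the compensator
    sin (tau - th), which is odd in the angle but not in y - x. Against the
    even kernel only its even part counts, and in the limit this is the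
    integral of an exact derivative that vanishes at 0 and at infinity. *)
Lemma compensator_cvg0 e : (forall n, 0 < e n) -> e @ \oo --> 0 ->
  (fun n => \int[mu]_y (sin (ster_inv y - ster_inv x) * abel_kernel (e n) (y - x)))%R @ \oo --> 0.
Proof.
move=> ep e0.
have EE n : (\int[mu]_y (sin (ster_inv y - ster_inv x) * abel_kernel (e n) (y - x)))%R =
   (\int[mu]_(t in `]0%R, +oo[) (A^-1 * (abel_kernel (e n) t * t ^+ 2 * p t)))%R.
  have m1 : measurable_fun setT (fun y => sin (ster_inv y - ster_inv x) * abel_kernel (e n) (y - x)).
    apply: measurable_funM; last exact: meas_abel_kernel_sub.
    apply: (measurableT_comp (cont_meas (D:=setT) (@continuous_sin R))).
    by apply: measurable_funB => //; exact: meas_ster_inv.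
  rewrite (Rint_shift x m1).
  have m2 : measurable_fun setT (fun t => abel_kernel (e n) t * hx t) by apply: measurable_funM; [exact: meas_abel_kernel|].
  transitivity (\int[mu]_t (abel_kernel (e n) t * hx t))%R.
    by apply: eq_Rint => t _; rewrite addrK mulrC.
  have I2 : intg setT (fun t => abel_kernel (e n) t * hx t).
    by apply: (@intgM_bounded _ _ _ _ 1) => //; [exact: intg_abel_kernel|move=> t; exact: sin_max].
  rewrite Rint_even0//.
  have E3 t : abel_kernel (e n) t * hx t + abel_kernel (e n) (- t) * hx (- t) = A^-1 * (abel_kernel (e n) t * t ^+ 2 * p t).
    by rewrite abel_kernelN -mulrDr hx_even; ring.
  under eq_Rint do rewrite E3.
  rewrite Rintegral_itv_obnd_cbnd//.
  apply: intgZ => //; apply: (@intg_le _ _ _ (fun t => `|p t|)) => //.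
  - apply: measurable_funTS; apply: measurable_funM; last exact: cont_meas cont_p.
    by apply: measurable_funM; [exact: meas_abel_kernel|exact: measurable_funX].
  - by move=> t _; rewrite normrM ler_piMl// abel_kernel_sqr_le.
  - apply: intg_norm; apply: (@intgS _ _ `[0, +oo[) => //.
    by move=> t; rewrite /= !in_itv/= !andbT => /ltW.
have -> : (fun n => \int[mu]_y (sin (ster_inv y - ster_inv x) * abel_kernel (e n) (y - x)))%R =
   (fun n => \int[mu]_(t in `]0%R, +oo[) (A^-1 * (abel_kernel (e n) t * t ^+ 2 * p t)))%R by apply/funext.
have Ip : intg `]0, +oo[ p.
  apply: (@intgS _ _ `[0, +oo[) => //.
  by move=> t; rewrite /= !in_itv/= !andbT => /ltW.
have E0 : (\int[mu]_(t in `]0%R, +oo[) (A^-1 * (- p t)))%R = 0.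
  rewrite Rint_Z//; last exact: intgN.
  by rewrite RintN// Rintegral_itv_obnd_cbnd// Rint_p oppr0 mulr0.
rewrite -[X in _ --> X]E0.
apply: (proj2 (@Rint_dct _ `]0, +oo[ (fun n t => A^-1 * (abel_kernel (e n) t * t ^+ 2 * p t))
   (fun t => A^-1 * (- p t)) (fun t => `|p t|) (measurable_itv _) _ _ _ (intg_norm Ip))).
- move=> n; apply: measurable_funTS; apply: measurable_funM => //; apply: measurable_funM; last exact: cont_meas cont_p.
  by apply: measurable_funM; [exact: meas_abel_kernel|exact: measurable_funX].
- move=> t; rewrite /= in_itv/= andbT => t0.
  apply: cvgM; first exact: cvg_cst.
  rewrite -mulN1r; apply: cvgM; last exact: cvg_cst.
  have -> : -1 = - t ^- 2 * t ^+ 2 by rewrite mulNr mulVf// expf_neq0// gt_eqF.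
  by apply: cvgM; [apply: abel_kernel_cvg => //; rewrite gt_eqF|exact: cvg_cst].
- move=> n t _; rewrite normrM.
  have A1 : 1 <= A by rewrite lerDl sqr_ge0.
  rewrite normfV (ger0_norm (le_trans ler01 A1)) mulrC ler_pdivrMr ?(lt_le_trans ltr01)//.
  rewrite normrM [X in _ <= X]mulrC; apply: ler_wpM2r => //.
  exact: (le_trans (abel_kernel_sqr_le t (ep n))).
Qed.

End Compensator.

Section Limit.
Variables (psi : R -> R) (C : R) (h : C2per psi C) (x : R).
Local Notation th := (ster_inv x).

Let rk y := sin_rem psi th (ster_inv y - th).

Let psi_ster y : psi (ster_inv y) = rk y + psi th + derive1 psi th * sin (ster_inv y - th).
Proof. by rewrite /rk /sin_rem (_ : th + (ster_inv y - th) = ster_inv y); ring. Qed.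

Let meas_rk : measurable_fun setT rk.
Proof.
have m1 : measurable_fun setT (fun y => ster_inv y - th) by apply: measurable_funB => //; exact: meas_ster_inv.
apply: measurable_funB; last first.
  by apply: measurable_funM => //; apply: (measurableT_comp (cont_meas (D:=setT) (@continuous_sin R))).
apply: measurable_funB => //; apply: (measurableT_comp (C2per_meas h)).
exact: measurable_funD.
Qed.

Let rk_le y : `|rk y| <= 64 * C * (1 + y ^+ 2)^-1 * (y - x) ^+ 2.
Proof.
have C0 := C2per_ge0 h; apply: (le_trans (sin_rem_le _ _ h)); rewrite one_sub_cos_ster.
have x0 := oneDsqr_gt0 x; have y0 := oneDsqr_gt0 y.
rewrite (_ : 32 * C * _ = (1 + x ^+ 2)^-1 * (64 * C * (1 + y ^+ 2)^-1 * (y - x) ^+ 2)).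
  apply: ler_piMl; last by rewrite invf_le1// lerDl sqr_ge0.
  apply: mulr_ge0; last exact: sqr_ge0.
  by apply: mulr_ge0; [rewrite mulr_ge0|rewrite invr_ge0 ltW].
by rewrite invfM; move: (_^-1) (_^-1) => a b; ring.
Qed.

(** Uniform in c: the remainder is O((y - x)^2 / (1 + y^2)), which absorbs the
    singularity of the kernel and keeps the decay at infinity. *)
Let rk_bound y (c : R) : 0 < c -> `|rk y * abel_kernel c (y - x)| <= 64 * C * (1 + y ^+ 2)^-1.
Proof.
move=> c0; rewrite normrM.
apply: (le_trans (ler_wpM2r (normr_ge0 _) (rk_le y))).
have C0 := C2per_ge0 h; have y0 := oneDsqr_gt0 y.
rewrite -[X in X <= _]mulrA; apply: ler_piMr; first by rewrite !mulr_ge0// invr_ge0 ltW.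
by have := abel_kernel_sqr_le (y - x) c0; rewrite normrM [X in _ * X]ger0_norm ?sqr_ge0// mulrC.
Qed.

Let intg_rk (c : R) : 0 < c -> intg setT (fun y => rk y * abel_kernel c (y - x)).
Proof.
move=> c0; apply: (@intg_le _ _ _ (fun y => 64 * C * (1 + y ^+ 2)^-1)) => //.
- by apply: measurable_funM => //; exact: meas_abel_kernel_sub.
- by move=> y _; exact: rk_bound.
- by apply: intgZ => //; exact: intg_cauchy.
Qed.

(** Change of variables y = Pi (tau); the factor 1 / (1 + y^2) of the chordal
    distance is the density of the projection, and 1 / (1 + x^2) comes out. *)
Let Rint_limit : (\int[mu]_y (- (rk y / (y - x) ^+ 2)) = - (1 + x ^+ 2)^-1 * \int[mu]_(s in circle) sin_quot psi th s)%R.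
Proof.
have mg : measurable_fun setT (fun y => - (rk y / (y - x) ^+ 2)).
  apply: measurableT_comp => //; apply: measurable_funM => //.
  by apply: measV; apply: measurable_funX; exact: measurable_funB.
rewrite (stereo_Rint mg).
have mT : measurable_fun setT (fun t => sin_quot psi th (t - th)).
  by apply: (measurableT_comp (meas_sin_quot th (C2per_meas h))); exact: measurable_funB.
have pT t : sin_quot psi th (t + 2 * pi - th) = sin_quot psi th (t - th).
  rewrite /sin_quot /sin_rem (_ : t + 2 * pi - th = t - th + 2 * pi); last by ring.
  by have [_ _ _ _ pp] := h; rewrite addrA pp per_sin per_cos.
have bT t : `|sin_quot psi th (t - th)| <= 32 * C by exact: sin_quot_le.
have I : intg circle (fun t => sin_quot psi th (t - th)) by exact: intg_circle_bounded bT.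
transitivity (\int[mu]_(t in arc) (- (1 + x ^+ 2)^-1 * sin_quot psi th (t - th)))%R.
  apply: eq_Rint => t at_; rewrite /rk stereoK//.
  have := one_sub_cos_ster x (stereo t); rewrite stereoK// => hc.
  have y0 := oneDsqr_neq0 (stereo t); have x0 := oneDsqr_neq0 x.
  have s0 : 1 + sin t = 2 / (1 + stereo t ^+ 2) by rewrite -oneDsin_ster_inv stereoK.
  have -> : (stereo t - x) ^+ 2 = (1 - cos (t - th)) * ((1 + x ^+ 2) / (1 + sin t)).
    by rewrite hc s0; field; rewrite x0 y0.
  rewrite /sin_quot s0 !invfM !invrK; move: (sin_rem _ _ _) (1 - cos _)^-1 => r c.
  by field; rewrite x0 y0.
rewrite Rint_Z ?Rint_arc_circle//; last by apply/intg_arc_circle.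
  by rewrite (circle_shift th mT bT pT); congr (_ * _); apply: eq_Rint => s _; rewrite addrC addKr.
exact: measurable_arc.
Qed.

(** Split psi into its remainder at th, a constant and the compensator: the
    kernel has mean zero, the compensator contributes 0 in the limit, and the
    remainder gives the singular integral of the circle. The sequence e is
    arbitrary so that the limit can be compared with a dilated one. *)
Lemma conformal_limit (e : nat -> R) : (forall n, 0 < e n) -> e @ \oo --> 0 ->
  (fun n => pi^-1 * \int[mu]_y (psi (ster_inv y) * abel_kernel (e n) (y - x)))%R @ \oo -->
  2 / (1 + x ^+ 2) * circle_hlap psi th.
Proof.
move=> ep e0.
have Is n : intg setT (fun y => sin (ster_inv y - th) * abel_kernel (e n) (y - x)).
  have : intg setT (fun y => abel_kernel (e n) (y - x) * sin (ster_inv y - th)).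
    apply: (@intgM_bounded _ _ _ _ 1) => //; first exact: intg_abel_kernel_sub.
      apply: (measurableT_comp (cont_meas (D:=setT) (@continuous_sin R))).
      by apply: measurable_funB => //; exact: meas_ster_inv.
    by move=> y; exact: sin_max.
  by apply: eq_intg => // y _; rewrite mulrC.
have EE n : (\int[mu]_y (psi (ster_inv y) * abel_kernel (e n) (y - x)))%R =
   (\int[mu]_y (rk y * abel_kernel (e n) (y - x)))%R +
   derive1 psi th * (\int[mu]_y (sin (ster_inv y - th) * abel_kernel (e n) (y - x)))%R.
  transitivity (\int[mu]_y (rk y * abel_kernel (e n) (y - x) + psi th * abel_kernel (e n) (y - x)
      + derive1 psi th * (sin (ster_inv y - th) * abel_kernel (e n) (y - x))))%R.
    by apply: eq_Rint => y _; rewrite psi_ster; ring.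
  have I2 : intg setT (fun y => psi th * abel_kernel (e n) (y - x)) by apply: intgZ => //; exact: intg_abel_kernel_sub.
  rewrite Rint_D//; last 2 first.
  - by apply: intgD => //; exact: intg_rk.
  - exact: intgZ.
  rewrite Rint_D//; last exact: intg_rk.
  by rewrite !Rint_Z//; [rewrite Rint_abel_kernel_sub// mulr0 addr0|exact: intg_abel_kernel_sub].
under eq_fun do rewrite EE.
have -> : 2 / (1 + x ^+ 2) * circle_hlap psi th =
   pi^-1 * ((\int[mu]_y (- (rk y / (y - x) ^+ 2)))%R + derive1 psi th * 0).
  rewrite Rint_limit mulr0 addr0 /circle_hlap.
  have pn0 : pi != 0 :> R by rewrite gt_eqF// pi_gt0.
  have x0 := oneDsqr_neq0 x.
  move: (Rintegral _ _ _) (pi : R) pn0 => I p pn0; field; by rewrite x0 pn0.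
apply: cvgM; first exact: cvg_cst.
apply: cvgD; last first.
  by apply: cvgM; [exact: cvg_cst|exact: compensator_cvg0].
apply: (proj2 (@Rint_dct _ setT (fun n y => rk y * abel_kernel (e n) (y - x))
   (fun y => - (rk y / (y - x) ^+ 2)) (fun y => 64 * C * (1 + y ^+ 2)^-1) measurableT _ _ _ _)).
- by move=> n; apply: measurable_funM => //; exact: meas_abel_kernel_sub.
(* The limit function is 0 at y = x by the convention on inverses, and so is
   the remainder. *)
- move=> y _; have [->|yx] := eqVneq y x.
    rewrite subrr expr0n/= invr0 mulr0 oppr0.
    under eq_fun do rewrite /rk subrr /sin_rem addr0 subrr sin0 mulr0 subrr mul0r.
    exact: cvg_cst.
  rewrite -mulrN; apply: cvgM; first exact: cvg_cst.
  by apply: abel_kernel_cvg => //; rewrite subr_eq0.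
- by move=> n y _; exact: rk_bound.
- by apply: intgZ => //; exact: intg_cauchy.
Qed.

End Limit.

Lemma line_hlap_circle (a psi : R -> R) (C x : R) : rschwartz a -> C2per psi C ->
  (forall y, a y = psi (ster_inv y)) -> line_hlap a x = 2 / (1 + x ^+ 2) * circle_hlap psi (ster_inv x).
Proof.
move=> sa h apsi; have L1 := line_hlap_abel (x:=x) sa.
have L2 := conformal_limit h (x:=x) (@harmonic_gt0 R) (@cvg_harmonic R).
move: L1; under eq_fun do under eq_Rint do rewrite apsi.
by move=> L1; apply: (cvg_unique _ L1 L2).
Qed.

(** A dilation of the line scales the Abel kernels, hence the half-Laplacian.
    As a statement on the circle it also covers functions that do not decay on
    the line, such as cos o Pi^-1. *)
Lemma circle_hlap_dilation (psi psia : R -> R) (C C' a x : R) : 0 < a -> C2per psi C -> C2per psia C' ->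
  (forall y, psia (ster_inv y) = psi (ster_inv (a * y))) ->
  circle_hlap psia (ster_inv x) = a * (1 + x ^+ 2) / (1 + (a * x) ^+ 2) * circle_hlap psi (ster_inv (a * x)).
Proof.
move=> a0 h h' E.
have L1 := conformal_limit h' (x:=x) (@harmonic_gt0 R) (@cvg_harmonic R).
have L2 := conformal_limit h (x:=a * x) (e := fun n => a * harmonic n) _ _.
have p2 n : 0 < a * harmonic n :> R by rewrite mulr_gt0// harmonic_gt0.
have c2 : (fun n => a * harmonic n) @ \oo --> (0 : R).
  by rewrite -[X in _ --> X](mulr0 a); apply: cvgM; [exact: cvg_cst|exact: cvg_harmonic].
have {}L2 := L2 p2 c2.
have EI n : (\int[mu]_y (psia (ster_inv y) * abel_kernel (harmonic n) (y - x)))%R =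
   a * (\int[mu]_y (psi (ster_inv y) * abel_kernel (a * harmonic n) (y - a * x)))%R.
  have mf : measurable_fun setT (fun y => psi (ster_inv y) * abel_kernel (a * harmonic n) (y - a * x)).
    apply: measurable_funM; last exact: meas_abel_kernel_sub.
    exact: (measurableT_comp (C2per_meas h) meas_ster_inv).
  rewrite (Rint_affine 0 a0 mf) -Rint_Z//; last first.
    apply/(intg_affine 0 a0 mf).
    have : intg setT (fun y => abel_kernel (a * harmonic n) (y - a * x) * psi (ster_inv y)).
      apply: (@intgM_bounded _ _ _ _ C) => //; first exact: intg_abel_kernel_sub.
        exact: (measurableT_comp (C2per_meas h) meas_ster_inv).
      by move=> y; have [_ _ b _ _] := h; have [] := b (ster_inv y).
    by apply: eq_intg => // y _; rewrite mulrC.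
  apply: eq_Rint => y _; rewrite addr0 E -mulrBr.
  have r0 : harmonic n ^+ 2 + (y - x) ^+ 2 != 0 :> R by rewrite gt_eqF// sqDsqr_gt0// harmonic_gt0.
  have an0 : a != 0 by rewrite gt_eqF.
  have -> : abel_kernel (a * harmonic n) (a * (y - x)) = abel_kernel (harmonic n) (y - x) / a ^+ 2.
    rewrite /abel_kernel !exprMn -mulrBr -mulrDr; move: (harmonic n ^+ 2) ((y - x) ^+ 2) r0 => u v r0.
    by field; rewrite an0 r0.
  by field.
have {}L1 : (fun n => a * (pi^-1 * \int[mu]_y (psi (ster_inv y) * abel_kernel (a * harmonic n) (y - a * x))))%R @ \oo -->
   2 / (1 + x ^+ 2) * circle_hlap psia (ster_inv x).
  by move: L1; under eq_fun do rewrite EI mulrCA.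
have {}L2 : (fun n => a * (pi^-1 * \int[mu]_y (psi (ster_inv y) * abel_kernel (a * harmonic n) (y - a * x))))%R @ \oo -->
   a * (2 / (1 + (a * x) ^+ 2) * circle_hlap psi (ster_inv (a * x))).
  by apply: cvgM; [exact: cvg_cst|exact: L2].
have H : 2 / (1 + x ^+ 2) * circle_hlap psia (ster_inv x) = a * (2 / (1 + (a * x) ^+ 2) * circle_hlap psi (ster_inv (a * x))).
  by apply: (cvg_unique _ L1 L2).
have x0 := oneDsqr_neq0 x; have ax0 := oneDsqr_neq0 (a * x).
have -> : circle_hlap psia (ster_inv x) = (1 + x ^+ 2) / 2 * (2 / (1 + x ^+ 2) * circle_hlap psia (ster_inv x)).
  by field.
by rewrite H; move: (circle_hlap _ _) => c; field.
Qed.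

End Conformal.

(** * Symmetry and eigenfunctions *)

Section Symmetry.
Context {R : realType}.
Local Notation mu := (@lebesgue_measure R).
Local Notation circle := (@circle R).
Local Notation mia := (@minus_i_angle R).
Implicit Types (psi v : R -> R) (th s : R).

Lemma sin_quot_per psi C th : C2per psi C -> per2pi (sin_quot psi th).
Proof.
move=> [_ _ _ _ pp] s; rewrite /sin_quot /sin_rem.
by rewrite addrA pp per_sin per_cos.
Qed.

(** The even part of the quotient is a symmetric second difference, in which
    psi' no longer appears; shifts of th then become shifts of the other
    factor. *)
Let D2 psi th s := sin_quot psi th s + sin_quot psi th (- s).

Let D2E psi th s : D2 psi th s = (psi (th + s) + psi (th - s) - 2 * psi th) / (1 - cos s).
Proof. by rewrite /D2 /sin_quot cosN -mulrDl /sin_rem sinN; congr (_ / _); ring. Qed.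

Let circle_hlap_D2 psi C th : C2per psi C ->
  circle_hlap psi th = - (4 * pi)^-1 * (\int[mu]_(s in circle) D2 psi th s)%R.
Proof.
move=> h; have mT := meas_sin_quot th (C2per_meas h).
have mT' : measurable_fun setT (fun s => sin_quot psi th (- s)) by apply: (measurableT_comp mT).
have b' t : `|sin_quot psi th (- t)| <= 32 * C by exact: sin_quot_le.
rewrite Rint_D//; [|exact: intg_sin_quot h|exact: (intg_circle_bounded mT' b')].
rewrite -(circle_opp mT (fun t => sin_quot_le th t h) (sin_quot_per th h)) /circle_hlap.
have pn0 : pi != 0 :> R by rewrite gt_eqF// pi_gt0.
by move: (Rintegral _ _ _) (pi : R) pn0 => I p pn0; field.
Qed.

Let meas_D2 psi C : C2per psi C -> measurable_fun setT (fun z : R * R => D2 psi z.1 z.2).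
Proof.
move=> h; have mp := C2per_meas h.
under eq_fun do rewrite D2E.
apply: measurable_funM; last first.
  apply: (measurableT_comp meas_inv); apply: measurable_funB => //.
  by apply: measurableT_comp => //; exact: cont_meas (@continuous_cos R).
apply: measurable_funB; last by apply: measurable_funM => //; exact: measurableT_comp.
apply: measurable_funD; apply: (measurableT_comp mp); first exact: measurable_funD.
exact: measurable_funB.
Qed.

Let D2_le psi C th s : C2per psi C -> `|D2 psi th s| <= 64 * C.
Proof.
move=> h; rewrite (le_trans (ler_normD _ _))// (_ : 64 * C = 32 * C + 32 * C); last by ring.
by rewrite lerD// sin_quot_le.
Qed.

Let shift_swap (v psi : R -> R) Cv C s : C2per v Cv -> C2per psi C ->
  (\int[mu]_(th in circle) (v th * D2 psi th s) = \int[mu]_(th in circle) (psi th * D2 v th s))%R.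
Proof.
move=> hv h.
have [_ _ bv _ pv] := hv; have [_ _ b _ p] := h.
have mv := C2per_meas hv; have m := C2per_meas h.
have ms (f : R -> R) (c : R) : measurable_fun setT f -> measurable_fun setT (fun t : R => f (t + c)).
  by move=> mf; apply: (measurableT_comp mf); exact: measurable_funD.
have I (f g : R -> R) (Cf Cg c : R) : measurable_fun setT f -> measurable_fun setT g ->
    (forall t, `|f t| <= Cf) -> (forall t, `|g t| <= Cg) -> intg circle (fun t => f t * g (t + c)).
  move=> mf mg bf bg; apply: (@intg_circle_bounded _ _ (Cf * Cg)).
    by apply: measurable_funM => //; exact: ms.
  by move=> t; rewrite normrM ler_pM.
have sw (f g : R -> R) (Cf Cg c : R) : measurable_fun setT f -> measurable_fun setT g ->
    (forall t, `|f t| <= Cf) -> (forall t, `|g t| <= Cg) -> per2pi f -> per2pi g ->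
    (\int[mu]_(t in circle) (f t * g (t + c)) = \int[mu]_(t in circle) (g t * f (t - c)))%R.
  move=> mf mg bf bg pf pg.
  rewrite (@circle_shift _ (fun t => f t * g (t + c)) (Cf * Cg) (- c))//.
  - by apply: eq_Rint => t _; rewrite addrC mulrC addrNK.
  - by apply: measurable_funM => //; exact: ms.
  - by move=> t; rewrite normrM ler_pM.
  - by move=> t; rewrite addrAC pf pg.
have b0 t : `|psi t| <= C by have [] := b t.
have bv0 t : `|v t| <= Cv by have [] := bv t.
have key (f g : R -> R) (Cf Cg : R) : measurable_fun setT f -> measurable_fun setT g ->
    (forall t, `|f t| <= Cf) -> (forall t, `|g t| <= Cg) ->
    (\int[mu]_(t in circle) (f t * D2 g t s) = (1 - cos s)^-1 *
    (\int[mu]_(t in circle) (f t * g (t + s)) + \int[mu]_(t in circle) (f t * g (t - s))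
     - 2 * \int[mu]_(t in circle) (f t * g (t + 0))))%R.
  move=> mf mg bf bg.
  have I1 := I f g Cf Cg s mf mg bf bg; have I2 := I f g Cf Cg (- s) mf mg bf bg.
  have I3 := I f g Cf Cg 0 mf mg bf bg.
  rewrite -Rint_D// -Rint_Z// -Rint_B//; last 2 first.
  - exact: intgD.
  - exact: intgZ.
  rewrite -Rint_Z//; last by apply: intgB => //; [exact: intgD|exact: intgZ].
  by apply: eq_Rint => t _; rewrite D2E addr0; ring.
rewrite (key v psi Cv C)// (key psi v C Cv)//.
rewrite (sw v psi Cv C s)// (sw v psi Cv C (- s))// (sw v psi Cv C 0)//.
by rewrite opprK oppr0; apply: (congr1 (fun z => _ * (z - _))); rewrite addrC.
Qed.

(** By Fubini it suffices to move the second differences from psi to v at fixed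
    s, which is a translation of th. *)
Lemma circle_hlap_symmetric (v psi : R -> R) Cv C : C2per v Cv -> C2per psi C ->
  (\int[mu]_(th in circle) (v th * circle_hlap psi th) = \int[mu]_(th in circle) (psi th * circle_hlap v th))%R.
Proof.
move=> hv h.
have key (f g : R -> R) (Cf Cg : R) : C2per f Cf -> C2per g Cg ->
   intg circle (fun th => \int[mu]_(s in circle) (f th * D2 g th s))%R /\
   (\int[mu]_(th in circle) \int[mu]_(s in circle) (f th * D2 g th s) =
    \int[mu]_(s in circle) \int[mu]_(th in circle) (f th * D2 g th s))%R.
  move=> hf hg.
  apply: (@Rint_Fubini R circle circle _ (cst (Cf * (64 * Cg))) (cst 1)) => //.
  - apply: measurable_funM; last exact: meas_D2 hg.
    by apply: measurableT_comp => //; exact: C2per_meas hf.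
  - move=> x y _ _; rewrite mulr1 normrM ler_pM//; last exact: D2_le.
    by have [_ _ b _ _] := hf; have [] := b x.
  - exact: intg_cst mu_circle_lty.
  - exact: intg_cst mu_circle_lty.
have E (f g : R -> R) (Cf Cg : R) : C2per f Cf -> C2per g Cg ->
   (\int[mu]_(th in circle) (f th * circle_hlap g th) =
   - (4 * pi)^-1 * \int[mu]_(s in circle) \int[mu]_(th in circle) (f th * D2 g th s))%R.
  move=> hf hg; have [I <-] := key f g Cf Cg hf hg.
  rewrite -Rint_Z//; apply: eq_Rint => th _; rewrite (circle_hlap_D2 th hg) mulrCA; congr (_ * _).
  rewrite Rint_Z//; apply: (@intg_circle_bounded _ _ (64 * Cg)); last by move=> t; exact: D2_le.
  have mT := meas_sin_quot th (C2per_meas hg); apply: measurable_funD => //.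
  exact: (measurableT_comp mT).
apply: (etrans (E v psi Cv C hv h)); apply: (etrans _ (esym (E psi v C Cv h hv))).
apply: (congr1 (fun z => - (4 * pi)^-1 * z)).
by apply: eq_Rint => s _; exact: (shift_swap s hv h).
Qed.

(** The circle integral of a bounded jointly measurable function of (th, s) is
    measurable in th. The weight 1 / (1 + th^2) makes it integrable over all
    th, as Fubini's theorem asks, and is removed afterwards. *)
Lemma meas_circle_hlap psi C : C2per psi C -> measurable_fun setT (circle_hlap psi).
Proof.
move=> h; apply: measurable_funM => //.
have mH : measurable_fun setT (fun th => (\int[mu]_(s in circle) ((1 + th ^+ 2)^-1 * sin_quot psi th s))%R).
  apply: intg_meas; apply: (proj1 (@Rint_Fubini R setT circle (fun th s => (1 + th ^+ 2)^-1 * sin_quot psi th s)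
   (fun th => (1 + th ^+ 2)^-1) (cst (32 * C)) measurableT measurable_circle _ _ intg_cauchy _)).
  - apply: measurable_funM; last exact: meas_sin_quot2 h.
    apply: (measurableT_comp meas_inv); apply: measurable_funD => //; exact: measurable_funX.
  - move=> x y _ _; rewrite normrM ger0_norm ?invr_ge0 ?(ltW (oneDsqr_gt0 _))//.
    by rewrite ler_wpM2l ?invr_ge0 ?(ltW (oneDsqr_gt0 _))//; exact: sin_quot_le.
  - exact: intg_cst mu_circle_lty.
rewrite (_ : (fun th => _) = (fun th => (1 + th ^+ 2) *
    (\int[mu]_(s in circle) ((1 + th ^+ 2)^-1 * sin_quot psi th s))%R)).
  by apply: measurable_funM => //; apply: measurable_funD => //; exact: measurable_funX.
by apply/funext => th; rewrite Rint_Z// ?mulVKf ?oneDsqr_neq0//; exact: intg_sin_quot h.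
Qed.

(** The quotient is 1 except at s = 0, the only zero of 1 - cos s in the
    period. *)
Lemma Rint_quot_one : (\int[mu]_(s in circle) ((1 - cos s) / (1 - cos s)))%R = 2 * pi.
Proof.
have m : measurable_fun setT (fun s : R => (1 - cos s) / (1 - cos s)).
  have mc : measurable_fun setT (fun s : R => 1 - cos s).
    by apply: measurable_funB => //; exact: cont_meas (@continuous_cos R).
  by apply: measurable_funM => //; exact: measV.
have b (s : R) : `|(1 - cos s) / (1 - cos s)| <= 1.
  by apply: div_le_bound => //; rewrite ?mul1r ?ger0_norm ?one_sub_cos_ge0.
have p (s : R) : (1 - cos (s + 2 * pi)) / (1 - cos (s + 2 * pi)) = (1 - cos s) / (1 - cos s).
  by rewrite per_cos.
rewrite /circle (period_shift mia 0 pi2_gt0 m b p) add0r.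
have I : intg `[0, 2 * pi] (fun s : R => (1 - cos s) / (1 - cos s)).
  by apply: (@intg_bounded _ _ _ 1) => //; [exact: mu_itv_lty|exact: measurable_funTS].
have I0 (c d : bool) : intg [set` Interval (BSide c (0 : R)) (BSide d (2 * pi))] (fun s : R => (1 - cos s) / (1 - cos s)).
  apply: (@intg_bounded _ _ _ 1) => //; [exact: mu_itv_lty|exact: measurable_funTS].
rewrite -Rintegral_itv_obnd_cbnd; last exact: I0.
transitivity (\int[mu]_(s in `]0%R, 2 * pi[) (1 : R))%R.
  apply: eq_Rint => s; rewrite /= in_itv/= => /andP[s0 s1].
  rewrite divff// one_sub_cosE mulf_neq0// expf_neq0// gt_eqF// sin_gt0_pi//.
  by rewrite divr_gt0//= ltr_pdivrMr// mulrC.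
rewrite Rintegral_cst//= lebesgue_measure_itv/= lte_fin pi2_gt0/= subr0.
by rewrite mul1r.
Qed.

(** When the remainder of f is f th * (cos s - 1), the quotient is the constant
    -f th; this is the case of cos and sin by the addition formulas. *)
Let circle_hlap_eig (f : R -> R) th : (forall s, sin_rem f th s = f th * (cos s - 1)) -> circle_hlap f th = f th.
Proof.
move=> E; rewrite /circle_hlap.
have -> : (\int[mu]_(s in circle) sin_quot f th s)%R = - f th * (2 * pi).
  rewrite -Rint_quot_one -Rint_Z//.
    by apply: eq_Rint => s _; rewrite /sin_quot E -[cos s - 1]opprB mulrN !mulNr mulrA.
  apply: (@intg_circle_bounded _ _ 1).
    have mc : measurable_fun setT (fun s : R => 1 - cos s).
      by apply: measurable_funB => //; exact: cont_meas (@continuous_cos R).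
    by apply: measurable_funM => //; exact: measV.
  by move=> s; apply: div_le_bound => //; rewrite ?mul1r ?ger0_norm ?one_sub_cos_ge0.
have pn0 : pi != 0 :> R by rewrite gt_eqF// pi_gt0.
by move: (f th) (pi : R) pn0 => c p pn0; field.
Qed.

Lemma derive1_val (f : R -> R) (x a : R) : is_derive x 1 f a -> derive1 f x = a.
Proof. by move=> d; rewrite derive1E derive_val. Qed.

Lemma circle_hlap_cos th : circle_hlap cos th = cos th.
Proof.
apply: circle_hlap_eig => s; rewrite /sin_rem (derive1_val (is_derive_cos th)) cosD; ring.
Qed.

Lemma circle_hlap_sin th : circle_hlap sin th = sin th.
Proof.
apply: circle_hlap_eig => s; rewrite /sin_rem (derive1_val (is_derive_sin th)) sinD; ring.
Qed.

Lemma circle_hlap_cst (c : R) th : circle_hlap (fun _ => c) th = 0.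
Proof.
rewrite /circle_hlap (_ : (\int[mu]_(s in circle) _)%R = 0) ?mulr0//.
rewrite -[RHS](@Rint0 _ circle); apply: eq_Rint => s _.
by rewrite /sin_quot /sin_rem (derive1_val (dC c th)) subrr mul0r subrr mul0r.
Qed.

Lemma circle_hlap_lin (f g : R -> R) (c th : R) : ctest f -> ctest g ->
  circle_hlap (fun t => f t + c * g t) th = circle_hlap f th + c * circle_hlap g th.
Proof.
move=> tf tg; have [Cf hf] := ctest_C2per tf; have [Cg hg] := ctest_C2per tg.
have df := rsmooth_is_derive th tf.1; have dg := rsmooth_is_derive th tg.1.
rewrite /circle_hlap mulrCA -mulrDr; congr (_ * _).
rewrite -Rint_Z//; last exact: intg_sin_quot hg.
rewrite -Rint_D//; [|exact: intg_sin_quot hf|by apply: intgZ => //; exact: intg_sin_quot hg].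
apply: eq_Rint => s _; rewrite /sin_quot /sin_rem (derive1_val (dD df (dZ c dg))); ring.
Qed.

(** Symmetry against the constant 1, which the half-Laplacian kills. *)
Lemma Rint_circle_hlap psi : ctest psi -> (\int[mu]_(th in circle) circle_hlap psi th)%R = 0.
Proof.
move=> tp; have [C h] := ctest_C2per tp; have [C1 h1] := ctest_C2per (ctest_cst (1 : R)).
transitivity (\int[mu]_(th in circle) (1 * circle_hlap psi th))%R.
  by apply: eq_Rint => th _; rewrite mul1r.
rewrite (circle_hlap_symmetric h1 h) -[RHS](@Rint0 _ circle); apply: eq_Rint => th _.
by rewrite circle_hlap_cst mulr0.
Qed.

End Symmetry.

(** * Integrability of the logarithm of the conformal factor *)

Section LogIntegrable.
Context {R : realType}.
Local Notation mu := (@lebesgue_measure R).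
Local Notation circle := (@circle R).
Local Notation arc := (@arc R).
Implicit Types (x y t : R).

Lemma meas_lnsqr (c : R) : measurable_fun setT (fun x : R => ln (1 + (c * x) ^+ 2)).
Proof.
apply: measurableT_comp => //; apply: measurable_funD => //; apply: measurable_funX.
exact: measurable_funM.
Qed.

(** -(1 + x^2)^(-1/4), a function with a finite limit whose derivative
    dominates the logarithm against 1 / (1 + x^2). *)
Let F x : R := - expR (- (4^-1 * ln (1 + x ^+ 2))).
Let f x : R := 2^-1 * x * (1 + x ^+ 2)^-1 * expR (- (4^-1 * ln (1 + x ^+ 2))).

Let dF x : is_derive x 1 F (f x).
Proof.
have x0 := oneDsqr_gt0 x.
have dl : is_derive (1 + x ^+ 2) 1 (@ln R) (1 + x ^+ 2)^-1 by exact: is_derive1_ln.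
have d1 := @dcomp R (@ln R) (fun t => 1 + t ^+ 2) x _ _ dl (dD (dC 1 x) (dX 2 (dI x))).
have d2 := dN (dZ 4^-1 d1).
apply: (is_derive_eq (dN (@dcomp R expR (fun t => - (4^-1 * ln (1 + t ^+ 2))) x _ _ (is_derive_expR _) d2))).
by rewrite /f /= expr1; move: (expR _) (1 + x ^+ 2)^-1 => E c; field.
Qed.

Let F_cvg : F x @[x --> +oo] --> 0.
Proof.
rewrite -[X in _ --> X]oppr0; apply: cvgN.
apply: (@cvg_comp _ _ _ (fun x : R => 4^-1 * ln (1 + x ^+ 2)) (fun z : R => expR (- z)) _ (pinfty_nbhs R)); last exact: cvgr_expR.
apply/cvgryPge => A; near=> x.
rewrite ler_pdivlMl//.
have x0 : expR (2 * A) <= x by near: x; exact: nbhs_pinfty_ge.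
rewrite -[X in X <= _]expRK ler_ln ?posrE ?expR_gt0 ?oneDsqr_gt0//.
have -> : expR (4 * A) = expR (2 * A) ^+ 2.
  by rewrite expr2 -expRD; congr expR; ring.
have := expR_ge0 (2 * A); nra.
Unshelve. all: by end_near. Qed.

Let intg_f : intg `[0, +oo[ f.
Proof.
have cf : continuous f.
  move=> x; have x0 := oneDsqr_neq0 x.
  have cs : {for x, continuous (fun t : R => 1 + t ^+ 2)}.
    by apply: cvgD; [exact: cvg_cst|exact: exprn_continuous].
  apply: cvgM; first apply: cvgM; first apply: cvgM; [exact: cvg_cst|exact: cvg_id|exact: cvgV|].
  have : continuous (fun t => - F t).
    by move=> t; apply: cvgN; exact: (deriv_cont dF).
  by rewrite /F; under eq_fun do rewrite opprK; exact.
have mf : measurable_fun setT f by exact: cont_meas.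
have f0 x : 0 <= x -> 0 <= f x.
  by move=> x0; rewrite /f !mulr_ge0 ?expR_ge0// invr_ge0 ltW// oneDsqr_gt0.
have H := @ge0_continuous_FTC2y R f F 0 0 f0 _ F_cvg _ _ _.
apply/integrableP; split; first by apply/measurable_EFinP; exact: measurable_funTS.
have -> : (\int[mu]_(x in `[0%R, +oo[) `|(EFin \o f) x| = \int[mu]_(x in `[0%R, +oo[) (f x)%:E)%E.
  apply: eq_integral => x; rewrite inE/= in_itv/= andbT => x0.
  by rewrite ger0_norm// f0.
have -> : (\int[mu]_(x in `[0%R, +oo[) (f x)%:E)%E = (0%:E - (F 0)%:E)%E; last by rewrite -EFinB ltry.
apply: H.
- by apply: continuous_subspaceT; exact: cf.
- by move=> x _; have d := dF x; exact: ex_derive.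
- by apply: cvg_at_right_filter; exact: (deriv_cont dF).
- by move=> x _; exact: derive1_val.
Qed.

(** The logarithm is dominated by the power 1/4 of its argument; near 0, where
    the derivative of F vanishes, by a constant. *)
Let ln_le_f x : 0 <= x -> ln (1 + x ^+ 2) / (1 + x ^+ 2) <= 32 * f x + (1 + x ^+ 2)^-1.
Proof.
move=> x0; have p0 := oneDsqr_gt0 x.
set M := ln (1 + x ^+ 2).
have M0 : 0 <= M by rewrite ln_ge0// lerDl sqr_ge0.
have EM : expR M = 1 + x ^+ 2 by rewrite lnK.
have fx0 : 0 <= f x by rewrite /f !mulr_ge0 ?expR_ge0// invr_ge0 ltW.
have [x1|x1] := lerP x 1.
  have M1 : M <= 1.
    rewrite (le_trans (le_ln1Dx _))//; last nra.
    by rewrite (lt_le_trans _ (sqr_ge0 x))// ltrN10.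
  have : M / (1 + x ^+ 2) <= (1 + x ^+ 2)^-1 by rewrite ler_piMl// invr_ge0 ltW.
  lra.
have e4 : M * expR (- (4^-1 * M)) <= 4.
  have := @expR_decay R 0 (4^-1 * M); rewrite expr1 (_ : 1`!%:R = 1 :> R)//.
  by rewrite mulr_ge0// => /(_ isT); lra.
have e2 : expR (2^-1 * M) <= 2 * x.
  rewrite -(@ler_pXn2r _ 2) ?nnegrE ?expR_ge0 ?mulr_ge0//.
  rewrite (_ : expR (2^-1 * M) ^+ 2 = 1 + x ^+ 2); first nra.
  by rewrite expr2 -expRD -EM; congr expR; field.
have key : M <= 32 * (2^-1 * x * expR (- (4^-1 * M))).
  have rp : expR (- (4^-1 * M)) * expR (4^-1 * M) = 1 by rewrite -expRD addNr expR0.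
  have qp : expR (2^-1 * M) * expR (- (4^-1 * M)) = expR (4^-1 * M).
    by rewrite -expRD; congr expR; field.
  have p0' := expR_ge0 (- (4^-1 * M)); have r0 := expR_ge0 (4^-1 * M).
  move: (expR (- _)) (expR (4^-1 * M)) (expR (2^-1 * M)) e4 e2 rp qp p0' r0 => p r q e4 e2 rp qp p0' r0.
  have -> : M = M * p * r by rewrite -mulrA rp mulr1.
  have h1 := ler_wpM2r r0 e4; have h2 := ler_wpM2r p0' e2; rewrite qp in h2.
  have : 0 <= x * p by rewrite mulr_ge0.
  lra.
rewrite (@le_trans _ _ (32 * f x))//; last by rewrite lerDl invr_ge0 ltW.
rewrite ler_pdivrMr// (le_trans key)// /f -/M.
rewrite (_ : 32 * (2^-1 * x * (1 + x ^+ 2)^-1 * _) * _ = 32 * (2^-1 * x * expR (- (4^-1 * M)))) //.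
by field; rewrite gt_eqF.
Qed.

Lemma intg_ln_stereo : intg arc (fun th => ln (1 + stereo th ^+ 2)).
Proof.
have m1 : measurable_fun setT (fun x : R => ln (1 + x ^+ 2)).
  by have := meas_lnsqr 1; under eq_fun do rewrite mul1r.
have mi : measurable_fun setT (fun x : R => (1 + x ^+ 2)^-1).
  by apply: measV; apply: measurable_funD => //; exact: measurable_funX.
have : intg setT (fun x : R => 2 * (ln (1 + x ^+ 2) / (1 + x ^+ 2))).
  apply: intgZ => //.
  have If : intg setT (f \_ `[0, +oo[) by exact: intg_mkcond.
  have mF := intg_meas If.
  have If' := intg_opp mF If.
  apply: (@intg_le _ _ _ (fun x => 32 * ((f \_ `[0, +oo[) x + (f \_ `[0, +oo[) (- x)) + (1 + x ^+ 2)^-1)) => //.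
  - exact: measurable_funM.
  - move=> x _; rewrite ger0_norm; last first.
      by rewrite mulr_ge0// ?ln_ge0 ?lerDl ?sqr_ge0// invr_ge0 ltW// oneDsqr_gt0.
    have f0 y : 0 <= (f \_ `[0, +oo[) y.
      rewrite patchE; case: ifPn => //; rewrite inE/= in_itv/= andbT => y0.
      by rewrite /f !mulr_ge0 ?expR_ge0// invr_ge0 ltW// oneDsqr_gt0.
    have := f0 x; have := f0 (- x).
    have [x0|x0] := lerP 0 x.
      have -> : (f \_ `[0, +oo[) x = f x by rewrite patchE ifT// inE/= in_itv/= x0.
      by have := ln_le_f x0; lra.
    have -> : (f \_ `[0, +oo[) (- x) = f (- x) by rewrite patchE ifT// inE/= in_itv/= oppr_ge0 ltW.
    have nx0 : 0 <= - x by rewrite oppr_ge0 ltW.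
    by have := ln_le_f nx0; rewrite sqrrN; lra.
  - by apply: intgD => //; [apply: intgZ => //; exact: intgD|exact: intg_cauchy].
move=> /(proj1 (stereo_intg _)) H.
apply: eq_intg (H _); first exact: measurable_arc.
  move=> th at_ /=.
  have s0 : 1 + sin th = 2 / (1 + stereo th ^+ 2) by rewrite -oneDsin_ster_inv stereoK.
  have := oneDsqr_neq0 (stereo th) => n0.
  by rewrite s0; move: (ln _) => l; field.
by apply: measurable_funM => //; apply: measurable_funM.
Qed.

End LogIntegrable.

(** * The half-Laplacian of the logarithm *)

Section LogTransform.
Context {R : realType}.
Local Notation mu := (@lebesgue_measure R).
Local Notation circle := (@circle R).
Local Notation arc := (@arc R).
Local Notation mia := (@minus_i_angle R).
Implicit Types (x y t a th : R) (psi : R -> R).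

Lemma arc_oneDsin th : arc th -> 1 + sin th = 2 / (1 + stereo th ^+ 2).
Proof. by move=> at_; rewrite -oneDsin_ster_inv stereoK. Qed.

Lemma ln_oneDsin th : arc th -> ln (1 + sin th) = ln 2 - ln (1 + stereo th ^+ 2).
Proof.
move=> at_; rewrite arc_oneDsin// lnM ?posrE ?invr_gt0 ?oneDsqr_gt0//.
by rewrite lnV// posrE oneDsqr_gt0.
Qed.

(** 1 + sin after the dilation y |-> a y of the line ([dilated_factor_ster]),
    written on the circle so that its smoothness at the pole is visible. *)
Definition dilated_factor a th := 2 * (1 + sin th) * ((1 + sin th) + a ^+ 2 * (1 - sin th))^-1.

Lemma mobius_den_gt0 a th : 0 < a -> 0 < (1 + sin th) + a ^+ 2 * (1 - sin th).
Proof.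
move=> a0; have a2 : 0 < a ^+ 2 by rewrite exprn_gt0.
have := oneDsin_ge0 th; have := sin_le1 th.
have [->|s1] := eqVneq (sin th) (-1); first by move=> *; nra.
move=> h1 h2; have : 0 < 1 + sin th by rewrite lt_def h2 andbT addrC addr_eq0.
nra.
Qed.

Lemma ctest_mobius_den a : ctest (fun th => (1 + sin th) + a ^+ 2 * (1 - sin th)).
Proof.
apply: ctestD; first by apply: ctestD; [exact: ctest_cst|exact: ctest_sin].
apply: ctestM; first exact: ctest_cst.
by apply: ctestB; [exact: ctest_cst|exact: ctest_sin].
Qed.

Lemma ctest_dilated_factor a : 0 < a -> ctest (dilated_factor a).
Proof.
move=> a0; apply: ctestM; last first.
  by apply: ctestV; [move=> th; rewrite gt_eqF// mobius_den_gt0|exact: ctest_mobius_den].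
apply: ctestM; first exact: ctest_cst.
by apply: ctestD; [exact: ctest_cst|exact: ctest_sin].
Qed.

Lemma dilated_factor_ster a y : 0 < a -> dilated_factor a (ster_inv y) = 2 / (1 + (a * y) ^+ 2).
Proof.
move=> a0; rewrite /dilated_factor sin_ster_inv; have n1 := oneDsqr_neq0 y; have n2 := oneDsqr_neq0 (a * y).
rewrite (_ : 1 + (1 - y ^+ 2) / (1 + y ^+ 2) + _ = 2 * (1 + (a * y) ^+ 2) / (1 + y ^+ 2)); last by field.
by rewrite invf_div; field; rewrite n1 n2.
Qed.

(** 1 + sin and its half-Laplacian sin, transported by the dilation. *)
Lemma circle_hlap_dilated_factor a x : 0 < a ->
  circle_hlap (dilated_factor a) (ster_inv x) = a * (1 + x ^+ 2) * (1 - (a * x) ^+ 2) / (1 + (a * x) ^+ 2) ^+ 2.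
Proof.
move=> a0; have [C1 h1] := ctest_C2per (ctest_dilated_factor a0).
have t1 : ctest (fun th : R => 1 + 1 * sin th).
  by apply: ctestD; [exact: ctest_cst|apply: ctestM; [exact: ctest_cst|exact: ctest_sin]].
have [C2 h2] := ctest_C2per t1.
rewrite (circle_hlap_dilation x a0 h2 h1).
  rewrite (circle_hlap_lin _ _ (ctest_cst 1) (@ctest_sin R)) circle_hlap_cst circle_hlap_sin add0r mul1r sin_ster_inv.
  by have n2 := oneDsqr_neq0 (a * x); field.
by move=> y; rewrite dilated_factor_ster// mul1r oneDsin_ster_inv.
Qed.

Let tau t : R := expR (- t).

Let tau_le1 t : 0 <= t -> tau t <= 1.
Proof. by move=> t0; rewrite -expR0 ler_expR oppr_le0. Qed.

Let dtau t : is_derive t 1 tau (- tau t).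
Proof. by apply: (is_derive_eq (dcomp (is_derive_expR _) (dN (dI t)))); rewrite mulrN1. Qed.

Let taux_cont x : continuous (fun t => 1 + (tau t * x) ^+ 2).
Proof.
move=> t; apply: cvgD; first exact: cvg_cst.
by apply: (@cvgM _ _ (nbhs t)); apply: cvgM; [exact: (deriv_cont dtau)|exact: cvg_cst|
  exact: (deriv_cont dtau)|exact: cvg_cst].
Qed.

(** The dilation parameter is a = exp (-t), the parametrization for which
    dilated factors integrate to logarithms. Letting n tend to infinity makes a
    tend to 0. *)
Let intV x (n : R) : 0 <= n ->
  (\int[mu]_(t in `[0, n]) (2 / (1 + (tau t * x) ^+ 2)))%R =
  2 * n + ln (1 + (tau n * x) ^+ 2) - ln (1 + x ^+ 2).
Proof.
move=> n0; apply: (etrans (@Rint_FTC _ _ (fun t => 2 * t + ln (1 + (tau t * x) ^+ 2)) 0 n n0 _ _)); last first.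
- by rewrite mulr0 add0r [tau 0](_ : _ = 1) ?mul1r// /tau oppr0 expR0.
- move=> t; apply: cvgM; first exact: cvg_cst.
  by apply: cvgV; [exact: oneDsqr_neq0|exact: taux_cont].
- move=> t; have p0 := oneDsqr_gt0 (tau t * x).
  have dl : is_derive (1 + (tau t * x) ^+ 2) 1 (@ln R) (1 + (tau t * x) ^+ 2)^-1 by exact: is_derive1_ln.
  have d1 := @dcomp R (@ln R) (fun t => 1 + (tau t * x) ^+ 2) t _ _ dl (dD (dC 1 t) (dX 2 (dM (dtau t) (dC x t)))).
  apply: (is_derive_eq (dD (dZ 2 (dI t)) d1)).
  rewrite /= expr1; have := oneDsqr_neq0 (tau t * x); move: (tau t) => a n1; field; exact: n1.
Qed.

Let two_div_le (c : R) : `|2 / (1 + c ^+ 2)| <= 2.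
Proof.
have p0 := oneDsqr_gt0 c; rewrite ger0_norm ?divr_ge0 ?(ltW p0)// ler_pdivrMr//.
by rewrite ler_peMr// lerDl sqr_ge0.
Qed.

Let E a x := a * (1 + x ^+ 2) * (1 - (a * x) ^+ 2) / (1 + (a * x) ^+ 2) ^+ 2.

Let intE x (n : R) : 0 <= n ->
  (\int[mu]_(t in `[0, n]) E (tau t) x)%R = 1 - tau n * (1 + x ^+ 2) / (1 + (tau n * x) ^+ 2).
Proof.
move=> n0.
apply: (etrans (@Rint_FTC _ _ (fun t => - (tau t * (1 + x ^+ 2) * (1 + (tau t * x) ^+ 2)^-1)) 0 n n0 _ _)).
- move=> t; have n1 := oneDsqr_neq0 (tau t * x).
  have dv := @dV R (fun t => 1 + (tau t * x) ^+ 2) t _ n1 (dD (dC 1 t) (dX 2 (dM (dtau t) (dC x t)))).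
  apply: (is_derive_eq (dN (dM (dM (dtau t) (dC (1 + x ^+ 2) t)) dv))).
  by rewrite /E /= expr1; move: (tau t) n1 => a n1; field; exact: n1.
- move=> t; apply: cvgM.
    apply: cvgM; first by apply: cvgM; [exact: (deriv_cont dtau)|exact: cvg_cst].
    apply: cvgB; first exact: cvg_cst.
    by apply: (@cvgM _ _ (nbhs t)); apply: cvgM; [exact: (deriv_cont dtau)|exact: cvg_cst|
      exact: (deriv_cont dtau)|exact: cvg_cst].
  apply: cvgV; first by rewrite expf_neq0// oneDsqr_neq0.
  by apply: (@cvgM _ _ (nbhs t)); exact: taux_cont.
- have -> : tau 0 = 1 by rewrite /tau oppr0 expR0.
  by rewrite !mul1r mulfV ?oneDsqr_neq0// opprK addrC.
Qed.

Let E_le x t (n : R) : 0 <= t <= n -> `|E (tau t) x| <= expR n.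
Proof.
move=> /andP[t0 tn]; have p0 := oneDsqr_gt0 (tau t * x).
have a0 : 0 < tau t by exact: expR_gt0.
have a1 := tau_le1 t0; have x0 := oneDsqr_gt0 x.
apply: (@le_trans _ _ (tau t)^-1); last by rewrite /tau -expRN opprK ler_expR.
rewrite /E normrM normfV (gtr0_norm (exprn_gt0 _ p0)) ler_pdivrMr ?exprn_gt0//.
rewrite normrM (gtr0_norm (mulr_gt0 a0 x0)) mulrC -ler_pdivlMr ?mulr_gt0//.
have h1 : `|1 - (tau t * x) ^+ 2| <= 1 + (tau t * x) ^+ 2.
  by rewrite (le_trans (ler_normB _ _))// !ger0_norm ?sqr_ge0.
apply: (le_trans h1); rewrite ler_pdivlMr ?mulr_gt0// mulrC expr2 mulrA ler_pM2r//.
rewrite [X in _ <= X]mulrC ler_pdivlMr// mulrC.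
have : tau t ^+ 2 <= 1 by rewrite exprn_ile1// ltW.
have := sqr_ge0 x; rewrite exprMn expr2; nra.
Qed.

Let meas_taux : measurable_fun setT (fun z : R * R => tau z.2 * stereo z.1).
Proof.
apply: measurable_funM; last exact: (measurableT_comp (@meas_stereo R)).
by apply: (measurableT_comp (@measurable_expR R)); exact: measurableT_comp.
Qed.

Let meas_tauxsq : measurable_fun setT (fun z : R * R => 1 + (tau z.2 * stereo z.1) ^+ 2).
Proof. by apply: measurable_funD => //; exact: measurable_funX. Qed.

Let mu_n (n : R) : (mu `[0%R, n] < +oo)%E. Proof. exact: mu_itv_lty. Qed.
Let mu_arc : (mu arc < +oo)%E. Proof. exact: mu_itv_lty. Qed.

(** Symmetry of the half-Laplacian applied to psi and the dilated conformal
    factor, integrated over the dilation parameter; both integrals in t are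
    explicit. The constant 2 n disappears because half-Laplacians have mean
    zero. *)
Let log_identity psi (n : R) : ctest psi -> 0 <= n ->
  (\int[mu]_(th in arc) (circle_hlap psi th * (ln (1 + (tau n * stereo th) ^+ 2) - ln (1 + stereo th ^+ 2))) =
   \int[mu]_(th in arc) (psi th * (1 - tau n * (1 + stereo th ^+ 2) / (1 + (tau n * stereo th) ^+ 2))))%R.
Proof.
move=> tp n0; have [C h] := ctest_C2per tp.
have mT := meas_circle_hlap h; have bT th := circle_hlap_le th h.
have mp := C2per_meas h.
have bp t : `|psi t| <= C by have [_ _ b _ _] := h; have [] := b t.
have C0 := C2per_ge0 h.
have [I1 F1] : intg arc (fun th => \int[mu]_(t in `[0, n]) (circle_hlap psi th * (2 / (1 + (tau t * stereo th) ^+ 2))))%R /\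
   (\int[mu]_(th in arc) \int[mu]_(t in `[0, n]) (circle_hlap psi th * (2 / (1 + (tau t * stereo th) ^+ 2))) =
    \int[mu]_(t in `[0, n]) \int[mu]_(th in arc) (circle_hlap psi th * (2 / (1 + (tau t * stereo th) ^+ 2))))%R.
  apply: (@Rint_Fubini R arc `[0, n] _ (cst (32 * C * 2)) (cst 1)).
  - exact: measurable_arc.
  - exact: measurable_itv.
  - apply: measurable_funM; first exact: (measurableT_comp mT).
    by apply: measurable_funM => //; exact: (measurableT_comp meas_inv).
  - by move=> th t _ _; rewrite mulr1 normrM ler_pM.
  - by apply: intg_cst; [exact: measurable_arc|exact: mu_arc].
  - by apply: intg_cst; [exact: measurable_itv|exact: mu_n].
have [I2 F2] : intg arc (fun th => \int[mu]_(t in `[0, n]) (psi th * E (tau t) (stereo th)))%R /\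
   (\int[mu]_(th in arc) \int[mu]_(t in `[0, n]) (psi th * E (tau t) (stereo th)) =
    \int[mu]_(t in `[0, n]) \int[mu]_(th in arc) (psi th * E (tau t) (stereo th)))%R.
  apply: (@Rint_Fubini R arc `[0, n] _ (cst (C * expR n)) (cst 1)).
  - exact: measurable_arc.
  - exact: measurable_itv.
  - apply: measurable_funM; first exact: (measurableT_comp mp).
    apply: measurable_funM; last by apply: (measurableT_comp meas_inv); exact: measurable_funX.
    have ms : measurable_fun setT (fun z : R * R => stereo z.1) by exact: (measurableT_comp (@meas_stereo R)).
    apply: measurable_funM; last by apply: measurable_funB => //; exact: measurable_funX.
    apply: measurable_funM; last by apply: measurable_funD => //; exact: measurable_funX.
    by apply: (measurableT_comp (@measurable_expR R)); exact: measurableT_comp.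
  - move=> th t _; rewrite /= in_itv/= => tn; rewrite mulr1 normrM ler_pM//.
    exact: E_le tn.
  - by apply: intg_cst; [exact: measurable_arc|exact: mu_arc].
  - by apply: intg_cst; [exact: measurable_itv|exact: mu_n].
have m2 x : measurable_fun setT (fun t : R => 2 / (1 + (tau t * x) ^+ 2)).
  apply: cont_meas => t; apply: cvgM; first exact: cvg_cst.
  by apply: cvgV; [exact: oneDsqr_neq0|exact: taux_cont].
have IV x : intg `[0, n] (fun t => 2 / (1 + (tau t * x) ^+ 2)).
  apply: (@intg_bounded _ _ _ 2); [exact: measurable_itv|exact: mu_n|exact: measurable_funTS|].
  by move=> t _; exact: two_div_le.
have IE x : intg `[0, n] (fun t => E (tau t) x).
  apply: (@intg_bounded _ _ _ (expR n)); [exact: measurable_itv|exact: mu_n| |].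
    have mt : measurable_fun setT tau by exact: cont_meas (deriv_cont dtau).
    apply: measurable_funTS; apply: measurable_funM; last first.
      apply: measV; apply: measurable_funX; apply: measurable_funD => //.
      by apply: measurable_funX; exact: measurable_funM.
    apply: measurable_funM; first exact: measurable_funM.
    by apply: measurable_funB => //; apply: measurable_funX; exact: measurable_funM.
  by move=> t; rewrite /= in_itv/= => tn; exact: E_le tn.
have K : (\int[mu]_(th in arc) \int[mu]_(t in `[0%R, n]) (circle_hlap psi th * (2 / (1 + (tau t * stereo th) ^+ 2))))%R =
   (\int[mu]_(th in arc) \int[mu]_(t in `[0%R, n]) (psi th * E (tau t) (stereo th)))%R.
  rewrite F1 F2; clear I1 F1 I2 F2 IV IE m2; apply: eq_Rint => t; rewrite /= in_itv/= => /andP[t0 tn].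
  have a0 : 0 < tau t by exact: expR_gt0.
  have [Cv hv] := ctest_C2per (ctest_dilated_factor a0).
  have mV := C2per_meas hv.
  have bV s : `|dilated_factor (tau t) s| <= Cv by have [_ _ b _ _] := hv; have [] := b s.
  have S := circle_hlap_symmetric hv h.
  transitivity (\int[mu]_(th in arc) (dilated_factor (tau t) th * circle_hlap psi th))%R.
    by apply: eq_Rint => th at_; rewrite -(dilated_factor_ster _ a0) (stereoK at_) mulrC.
  rewrite Rint_arc_circle; last first.
    apply: (@intg_circle_bounded _ _ (Cv * (32 * C))); first exact: measurable_funM.
    by move=> s; rewrite normrM ler_pM.
  rewrite S -Rint_arc_circle; last first.
    apply: (@intg_circle_bounded _ _ (C * (32 * Cv))).
      by apply: measurable_funM; [exact: mp|exact: (meas_circle_hlap hv)].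
    by move=> s; rewrite normrM; apply: ler_pM; [exact: normr_ge0|exact: normr_ge0|exact: bp|exact: circle_hlap_le hv].
  by apply: eq_Rint => th at_; rewrite -{2}(stereoK at_) circle_hlap_dilated_factor.
have TI : intg arc (circle_hlap psi) by apply/intg_arc_circle; exact: intg_circle_bounded mT bT.
have IL : intg arc (fun th => circle_hlap psi th * (2 * n + ln (1 + (tau n * stereo th) ^+ 2) - ln (1 + stereo th ^+ 2))).
  apply: (eq_intg _ _ I1); first exact: measurable_arc.
  by move=> th _; rewrite Rint_Z ?intV//.
have Kl : (\int[mu]_(th in arc) \int[mu]_(t in `[0%R, n]) (circle_hlap psi th * (2 / (1 + (tau t * stereo th) ^+ 2))))%R =
  (\int[mu]_(th in arc) (circle_hlap psi th * (2 * n + ln (1 + (tau n * stereo th) ^+ 2) - ln (1 + stereo th ^+ 2))))%R.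
  by apply: eq_Rint => th _; rewrite Rint_Z ?intV//.
have Kr : (\int[mu]_(th in arc) \int[mu]_(t in `[0%R, n]) (psi th * E (tau t) (stereo th)))%R =
  (\int[mu]_(th in arc) (psi th * (1 - tau n * (1 + stereo th ^+ 2) / (1 + (tau n * stereo th) ^+ 2))))%R.
  by apply: eq_Rint => th _; rewrite Rint_Z ?intE//.
rewrite -Kr -K Kl; clear I1 F1 I2 F2 m2 IV IE K Kl Kr.
have Z : (\int[mu]_(th in arc) (2 * n * circle_hlap psi th))%R = 0.
  rewrite Rint_Z//; last exact: measurable_arc.
  by rewrite Rint_arc_circle ?Rint_circle_hlap ?mulr0//; apply/intg_arc_circle.
rewrite -[LHS]subr0 -Z.
transitivity (\int[mu]_(th in arc) (circle_hlap psi th * (2 * n + ln (1 + (tau n * stereo th) ^+ 2) - ln (1 + stereo th ^+ 2))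
   - 2 * n * circle_hlap psi th) - 0)%R.
  by rewrite subr0 Z subr0; apply: eq_Rint => th _; ring.
by rewrite subr0 Rint_B ?Z ?subr0//; [exact: measurable_arc|apply: intgZ => //; exact: measurable_arc].
Qed.

Let intg_lnarc : intg arc (fun th => ln (1 + stereo th ^+ 2)) := intg_ln_stereo.

Let ln_side psi : ctest psi ->
  (fun n : nat => \int[mu]_(th in arc) (circle_hlap psi th * (ln (1 + (tau n%:R * stereo th) ^+ 2) - ln (1 + stereo th ^+ 2))))%R
  @ \oo --> - (\int[mu]_(th in arc) (circle_hlap psi th * ln (1 + stereo th ^+ 2)))%R.
Proof.
move=> tp; have [C h] := ctest_C2per tp.
have mT := meas_circle_hlap h; have bT th := circle_hlap_le th h.
have C0 := C2per_ge0 h.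
have IT : intg arc (fun th => circle_hlap psi th * ln (1 + stereo th ^+ 2)).
  have : intg arc (fun th => ln (1 + stereo th ^+ 2) * circle_hlap psi th).
    by apply: (intgM_bounded _ _ _ bT); [exact: measurable_arc| |exact: measurable_funTS].
  by apply: eq_intg; [exact: measurable_arc|move=> th _; rewrite mulrC].
have mls : measurable_fun setT (fun th : R => ln (1 + stereo th ^+ 2)).
  apply: (measurableT_comp (@measurable_ln R)); apply: measurable_funD => //.
  by apply: measurable_funX; exact: meas_stereo.
rewrite -RintN//; last exact: measurable_arc.
apply: (proj2 (@Rint_dct _ arc _ _ (fun th => (32 * C) * ln (1 + stereo th ^+ 2)) (measurable_arc) _ _ _ _)).
- move=> n; apply: measurable_funTS; apply: measurable_funM => //; apply: measurable_funB => //.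
  exact: (measurableT_comp (meas_lnsqr (tau n%:R)) (@meas_stereo R)).
- move=> th _; rewrite -mulrN; apply: cvgM; first exact: cvg_cst.
  rewrite -[X in _ --> X]sub0r; apply: cvgB; last exact: cvg_cst.
  rewrite -ln1; apply: (@continuous_cvg _ _ _ _ _ _ (@ln R)); first by apply: continuous_ln.
  rewrite -[X in _ --> X]addr0; apply: cvgD; first exact: cvg_cst.
  have t0 : (fun n : nat => tau n%:R * stereo th) @ \oo --> (0 : R).
    apply: (@cvg0_harmonic _ _ `|stereo th|) => n.
    rewrite normrM ger0_norm ?expR_ge0// mulrC ler_wpM2l// /tau expRN lef_pV2 ?posrE ?expR_gt0//.
    by rewrite -natr1 addrC expR_ge1Dx.
  by rewrite -[X in _ --> X](mulr0 0); apply: cvgM.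
- move=> n th _; rewrite normrM ler_pM//.
  have h1 : 0 <= ln (1 + (tau n%:R * stereo th) ^+ 2) by rewrite ln_ge0// lerDl sqr_ge0.
  have h2 : ln (1 + (tau n%:R * stereo th) ^+ 2) <= ln (1 + stereo th ^+ 2).
    rewrite ler_ln ?posrE ?oneDsqr_gt0// lerD2l exprMn ler_piMl ?sqr_ge0//.
    by rewrite exprn_ile1 ?expR_ge0// tau_le1.
  by rewrite ler0_norm ?subr_le0// opprB gerBl.
- by apply: intgZ => //; exact: measurable_arc.
Qed.

Let psi_near psi C y : C2per psi C -> `|psi (ster_inv y) - psi mia| <= 132 * C / (1 + `|y|).
Proof.
move=> h; have C0 := C2per_ge0 h; have p0 := oneDsqr_gt0 y.
have s1 : cos (ster_inv y - mia) = 1 - 2 / (1 + y ^+ 2).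
  have := oneDsin_ster_inv y; rewrite /minus_i_angle opprK cosDpihalf => <-; ring.
have s2 : sin (ster_inv y - mia) = 2 * y / (1 + y ^+ 2).
  by rewrite /minus_i_angle opprK sinDpihalf cos_ster_inv.
have := sin_rem_le mia (ster_inv y - mia) h; rewrite s1 /sin_rem s2 (_ : mia + (ster_inv y - mia) = ster_inv y); last by ring.
move=> hr.
have d1 : `|derive1 psi mia| <= C by have [_ _ b _ _] := h; have [] := b mia.
have y1 : 0 < 1 + `|y| by rewrite ltr_pwDl.
have yy : y ^+ 2 = `|y| ^+ 2 by rewrite real_normK ?num_real.
have : `|derive1 psi mia * (2 * y / (1 + y ^+ 2))| <= C * (2 * `|y| / (1 + y ^+ 2)).
  by rewrite !normrM normfV (gtr0_norm p0) (ger0_norm (ler0n _ 2)) ler_wpM2r// divr_ge0 ?mulr_ge0// ltW.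
move: hr; set a := psi (ster_inv y) - psi mia; move: (derive1 psi mia * _) => b hr hb.
have ha : `|a| <= `|a - b| + `|b| by rewrite -{1}(subrK b a) ler_normD.
apply: (le_trans ha); rewrite ler_pdivlMr//.
apply: (@le_trans _ _ ((32 * C * (1 - (1 - 2 / (1 + y ^+ 2))) + C * (2 * `|y| / (1 + y ^+ 2))) * (1 + `|y|))).
  by rewrite ler_wpM2r ?(ltW y1)// lerD.
rewrite (_ : _ * (1 + `|y|) = C * ((64 + 2 * `|y|) * (1 + `|y|)) / (1 + y ^+ 2)); last by field; rewrite gt_eqF.
rewrite ler_pdivrMr// (_ : 132 * C * _ = C * (132 * (1 + y ^+ 2))); last by ring.
rewrite ler_wpM2l//.
rewrite yy; have := normr_ge0 y; have := sqr_ge0 (`|y| - 1); move: `|y| => z; nra.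
Qed.

(** The kernel is a Poisson kernel of total mass 2 pi that concentrates at the
    pole as the dilation parameter tends to 0; in the rescaled variable z only
    the values of psi move. *)
Let mass_side psi : ctest psi ->
  (fun n : nat => \int[mu]_(th in arc) (psi th * (tau n%:R * (1 + stereo th ^+ 2) / (1 + (tau n%:R * stereo th) ^+ 2))))%R
  @ \oo --> 2 * pi * psi mia.
Proof.
move=> tp; have [C h] := ctest_C2per tp; have C0 := C2per_ge0 h.
have mp := C2per_meas h.
have bp t : `|psi t| <= C by have [_ _ b _ _] := h; have [] := b t.
have mc : measurable_fun setT (fun z : R => 2 / (1 + z ^+ 2)).
  apply: measurable_funM => //; apply: measV; apply: measurable_funD => //; exact: measurable_funX.
have I2 : intg setT (fun z : R => 2 / (1 + z ^+ 2)) by apply: intgZ => //; exact: intg_cauchy.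
have mass : (\int[mu]_z (2 / (1 + z ^+ 2)))%R = 2 * pi.
  rewrite (stereo_Rint mc).
  transitivity (\int[mu]_(th in arc) (1 : R))%R.
    apply: eq_Rint => th at_; rewrite arc_oneDsin// divff// mulf_neq0 ?invr_eq0 ?oneDsqr_neq0//.
  rewrite Rint_arc_circle; last by apply: intg_cst => //; exact: mu_circle_lty.
  transitivity (1 * fine (mu circle)); last by rewrite mu_circle/= mul1r.
  by apply: Rintegral_cst; exact: measurable_circle.
pose d n z : R := (psi (ster_inv ((tau n%:R)^-1 * z)) - psi mia) * (2 / (1 + z ^+ 2)).
have md n : measurable_fun setT (d n).
  apply: measurable_funM => //; apply: measurable_funB => //; apply: (measurableT_comp mp).
  by apply: (measurableT_comp (@meas_ster_inv R)); exact: measurable_funM.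
have bd n z : `|d n z| <= 2 * C * (2 / (1 + z ^+ 2)).
  have p0 := oneDsqr_gt0 z.
  rewrite normrM [X in _ * X]ger0_norm ?divr_ge0 ?(ltW p0)// ler_wpM2r ?divr_ge0 ?(ltW p0)//.
  by rewrite (le_trans (ler_normB _ _))// (_ : 2 * C = C + C) ?lerD//; ring.
have Ib : intg setT (fun z : R => 2 * C * (2 / (1 + z ^+ 2))) by exact: intgZ.
have Id n : intg setT (d n) by apply: (@intg_le _ _ _ (fun z => 2 * C * (2 / (1 + z ^+ 2)))).
have EE n : (\int[mu]_(th in arc) (psi th * (tau n%:R * (1 + stereo th ^+ 2) / (1 + (tau n%:R * stereo th) ^+ 2))))%R
   = (\int[mu]_(z in `]0%R, +oo[) (d n z + d n (- z)))%R + 2 * pi * psi mia.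
  have t0 : 0 < tau n%:R by exact: expR_gt0.
  have mf : measurable_fun setT (fun y => psi (ster_inv y) * (2 / (1 + (tau n%:R * y) ^+ 2) * tau n%:R)).
    apply: measurable_funM; first exact: (measurableT_comp mp (@meas_ster_inv R)).
    by apply: measurable_funM => //; apply: (measurableT_comp mc); exact: measurable_funM.
  transitivity (\int[mu]_y (psi (ster_inv y) * (2 / (1 + (tau n%:R * y) ^+ 2) * tau n%:R)))%R.
    rewrite (stereo_Rint mf); apply: eq_Rint => th at_; rewrite stereoK// arc_oneDsin//.
    have n1 := oneDsqr_neq0 (stereo th); have n2 := oneDsqr_neq0 (tau n%:R * stereo th).
    by move: (tau _) n2 => a n2; field; rewrite n1 n2.
  have mg : measurable_fun setT (fun z => psi (ster_inv ((tau n%:R)^-1 * z)) * (2 / (1 + z ^+ 2))).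
    apply: measurable_funM => //; apply: (measurableT_comp mp).
    by apply: (measurableT_comp (@meas_ster_inv R)); exact: measurable_funM.
  transitivity (\int[mu]_z (psi (ster_inv ((tau n%:R)^-1 * z)) * (2 / (1 + z ^+ 2))))%R.
    rewrite (Rint_affine 0 t0 mg); apply: eq_Rint => y _.
    by rewrite addr0 mulKf ?gt_eqF// mulrA.
  transitivity (\int[mu]_z (d n z + psi mia * (2 / (1 + z ^+ 2))))%R.
    by apply: eq_Rint => z _; rewrite /d; ring.
  rewrite Rint_D//; last exact: intgZ.
  rewrite Rint_Z// mass [psi mia * _]mulrC Rint_even0// Rintegral_itv_obnd_cbnd//.
  apply: intgD => //; apply: (@intgS _ _ setT) => //.
  exact: intg_opp.
rewrite (_ : (fun n : nat => _) = (fun n => (\int[mu]_(z in `]0%R, +oo[) (d n z + d n (- z)))%R + 2 * pi * psi mia)); last exact/funext.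
rewrite -[X in _ --> X]add0r; apply: cvgD; last exact: cvg_cst.
rewrite -[X in _ --> X](@Rint0 _ `]0, +oo[).
have mopp n : measurable_fun setT (fun z : R => d n (- z)) by exact: (measurableT_comp (md n)).
apply: (proj2 (@Rint_dct _ `]0, +oo[ (fun n z => d n z + d n (- z)) (fun _ => 0)
  (fun z => 2 * C * (2 / (1 + z ^+ 2)) + 2 * C * (2 / (1 + z ^+ 2))) (measurable_itv _) _ _ _ _)).
- by move=> n; apply: measurable_funTS; exact: measurable_funD.
- move=> z; rewrite /= in_itv/= andbT => z0.
  have key (w : R) : `|w| = z -> (fun n => d n w) @ \oo --> (0 : R).
    move=> wz; apply: (@cvg0_harmonic _ _ (132 * C / z * 2)) => n.
    rewrite normrM; apply: (le_trans (ler_wpM2l (normr_ge0 _) (two_div_le w))).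
    rewrite mulrAC ler_wpM2r//; apply: (le_trans (psi_near _ h)).
    rewrite -[X in _ <= X]mulrA -invfM ler_wpM2l ?mulr_ge0// lef_pV2 ?posrE ?ltr_pwDl ?mulr_gt0//.
    rewrite normrM wz normfV ger0_norm ?expR_ge0// /tau -expRN opprK.
    have : 1 + n%:R <= expR (n%:R : R) by exact: expR_ge1Dx.
    rewrite -[n.+1%:R]natr1; nra.
  rewrite -[X in _ --> X]addr0; apply: cvgD; apply: key; rewrite ?normrN gtr0_norm//.
- by move=> n z _; rewrite (le_trans (ler_normD _ _))// lerD// (le_trans (bd n (- z)))// sqrrN.
- by apply: intgD => //; apply: (@intgS _ _ setT).
Qed.

(** The limit of [log_identity] as the dilation parameter tends to 0: up to the
    constant ln 2, ln (1 + sin) is -ln (1 + Pi^2). *)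
Lemma circle_hlap_ln psi : ctest psi ->
  intg circle (fun th : R => ln (1 + sin th)) /\
  (\int[mu]_(th in circle) (ln (1 + sin th) * circle_hlap psi th) =
   \int[mu]_(th in circle) psi th - 2 * pi * psi mia)%R.
Proof.
move=> tp; have [C h] := ctest_C2per tp.
have mT := meas_circle_hlap h; have bT th := circle_hlap_le th h.
have mp := C2per_meas h.
have bp t : `|psi t| <= C by have [_ _ b _ _] := h; have [] := b t.
have Il : intg circle (fun th : R => ln (1 + sin th)).
  apply/intg_arc_circle.
  apply: (@eq_intg _ _ (fun th => ln 2 - ln (1 + stereo th ^+ 2))); first exact: measurable_arc.
    by move=> th at_; rewrite ln_oneDsin.
  apply: intgB; [exact: measurable_arc| |exact: intg_lnarc].
  by apply: intg_cst; [exact: measurable_arc|exact: mu_arc].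
split=> //.
have ILT : intg circle (fun th => ln (1 + sin th) * circle_hlap psi th).
  by apply: (intgM_bounded _ Il _ bT) => //; exact: measurable_funTS.
have Ip : intg circle psi by exact: intg_circle_bounded mp bp.
have IT : intg circle (circle_hlap psi) by exact: intg_circle_bounded mT bT.
have IlT : intg arc (fun th => circle_hlap psi th * ln (1 + stereo th ^+ 2)).
  have : intg arc (fun th => ln (1 + stereo th ^+ 2) * circle_hlap psi th).
    by apply: (intgM_bounded _ intg_lnarc _ bT); [exact: measurable_arc|exact: measurable_funTS].
  by apply: eq_intg; [exact: measurable_arc|move=> th _; rewrite mulrC].
have L1 := ln_side tp; have L2 := mass_side tp.
have L3 : (fun n : nat => \int[mu]_(th in arc) (circle_hlap psi th * (ln (1 + (tau n%:R * stereo th) ^+ 2) - ln (1 + stereo th ^+ 2))))%R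
  @ \oo --> (\int[mu]_(th in circle) psi th)%R - 2 * pi * psi mia.
  have IP n : intg arc (fun th => psi th * (tau n%:R * (1 + stereo th ^+ 2) / (1 + (tau n%:R * stereo th) ^+ 2))).
    have t0 : 0 < tau n%:R by exact: expR_gt0.
    have ms := @meas_stereo R.
    apply: (@intg_bounded _ _ _ (C * (tau n%:R)^-1)); [exact: measurable_arc|exact: mu_arc| |].
      apply: measurable_funTS; apply: measurable_funM => //; apply: measurable_funM.
        by apply: measurable_funM => //; apply: measurable_funD => //; exact: measurable_funX.
      by apply: measV; apply: measurable_funD => //; apply: measurable_funX; exact: measurable_funM.
    move=> th _; rewrite normrM ler_pM//.
    have q0 := oneDsqr_gt0 (tau n%:R * stereo th); have r0 := oneDsqr_gt0 (stereo th).
    have t1 : tau n%:R <= 1 by exact: tau_le1.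
    rewrite ger0_norm ?divr_ge0 ?mulr_ge0 ?(ltW t0) ?(ltW q0) ?(ltW r0)// ler_pdivrMr//.
    rewrite [X in _ <= X]mulrC ler_pdivlMr//.
    move: (tau _) (stereo th) t0 t1 => a x a0 a1; have := sqr_ge0 x; rewrite exprMn; nra.
  rewrite (_ : (fun n : nat => _) = (fun n : nat => (\int[mu]_(th in circle) psi th)%R -
    (\int[mu]_(th in arc) (psi th * (tau n%:R * (1 + stereo th ^+ 2) / (1 + (tau n%:R * stereo th) ^+ 2))))%R)).
    by apply: cvgB; [exact: cvg_cst|exact: L2].
  apply/funext => n; rewrite log_identity//.
  have Ipa : intg arc psi by apply/intg_arc_circle.
  rewrite -Rint_arc_circle// -Rint_B//; last exact: measurable_arc.
  by apply: eq_Rint => th _; rewrite mulrBr mulr1.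
have HE : - (\int[mu]_(th in arc) (circle_hlap psi th * ln (1 + stereo th ^+ 2)))%R = (\int[mu]_(th in circle) psi th)%R - 2 * pi * psi mia.
  by apply: (cvg_unique _ L1 L3).
rewrite -HE -Rint_arc_circle//.
transitivity (\int[mu]_(th in arc) (ln 2 * circle_hlap psi th - circle_hlap psi th * ln (1 + stereo th ^+ 2)))%R.
  by apply: eq_Rint => th at_; rewrite ln_oneDsin//; ring.
have ITa : intg arc (circle_hlap psi) by apply/intg_arc_circle.
rewrite Rint_B//; [|exact: measurable_arc|by apply: intgZ => //; exact: measurable_arc].
rewrite Rint_Z//; last exact: measurable_arc.
by rewrite Rint_arc_circle// Rint_circle_hlap// mulr0 sub0r.
Qed.

End LogTransform.

(** * Transfer of test functions *)

Section Transfer.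
Context {R : realType}.
Local Notation mu := (@lebesgue_measure R).
Local Notation circle := (@circle R).
Local Notation arc := (@arc R).
Local Notation mia := (@minus_i_angle R).
Implicit Types (x y t th : R) (a psi : R -> R).

Lemma derive1n_lin (f g : R -> R) (c : R) n : rsmooth f -> rsmooth g ->
  derive1n n (fun x => f x + c * g x) = (fun x => derive1n n f x + c * derive1n n g x).
Proof.
move=> sf sg; elim: n => [//|n IH]; apply/funext => x; rewrite derive1nS IH.
apply: derive1_val; rewrite !derive1nS; apply: dD; last apply: dZ.
  by apply: rsmooth_is_derive; exact: rsmooth_derive1n.
by apply: rsmooth_is_derive; exact: rsmooth_derive1n.
Qed.

Lemma sch_lin (f g : R -> R) (c : R) : rschwartz f -> rschwartz g -> rschwartz (fun x => f x + c * g x).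
Proof.
move=> [sf bf] [sg bg]; split.
  by apply: rsmoothD; [exact: sf|apply: rsmoothM; [exact: rsmooth_cst|exact: sg]].
move=> m n; have [C1 h1] := bf m n; have [C2 h2] := bg m n.
exists (C1 + `|c| * C2) => x; rewrite derive1n_lin//.
have x0 : 0 <= `|x| ^+ m by rewrite exprn_ge0.
apply: (le_trans (ler_wpM2l x0 (ler_normD _ _))); rewrite mulrDr lerD//.
by rewrite normrM mulrCA ler_wpM2l.
Qed.

Lemma rsmooth_id : rsmooth (fun x : R => x).
Proof. by apply/rsmoothP => n x; exact: Cn_id. Qed.

Lemma derive1n_mulx (f : R -> R) n : rsmooth f ->
  derive1n n.+1 (fun x => x * f x) = (fun x => x * derive1n n.+1 f x + n.+1%:R * derive1n n f x).
Proof.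
move=> sf; have d k x : is_derive x 1 (derive1n k f) (derive1n k.+1 f x).
  by rewrite derive1nS; apply: rsmooth_is_derive; exact: rsmooth_derive1n.
elim: n => [|n IH]; apply/funext => x; rewrite derive1nS.
  by apply: derive1_val; apply: (is_derive_eq (dM (dI x) (d 0%N x))); rewrite !mul1r addrC.
rewrite IH; apply: derive1_val.
apply: (is_derive_eq (dD (dM (dI x) (d n.+1 x)) (dZ n.+1%:R (d n x)))).
by rewrite -[n.+2%:R]natr1; ring.
Qed.

Lemma sch_mulx (f : R -> R) : rschwartz f -> rschwartz (fun x => x * f x).
Proof.
move=> [sf bf]; split; first by apply: rsmoothM => //; exact: rsmooth_id.
move=> m [|n].
  have [C h] := bf m.+1 0%N; exists C => x; have := h x.
  by rewrite /= normrM exprSr mulrA.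
have [C1 h1] := bf m.+1 n.+1; have [C2 h2] := bf m n.
exists (C1 + n.+1%:R * C2) => x; rewrite derive1n_mulx//.
have x0 : 0 <= `|x| ^+ m by rewrite exprn_ge0.
apply: (le_trans (ler_wpM2l x0 (ler_normD _ _))); rewrite mulrDr lerD//.
  by rewrite normrM mulrA -exprSr.
by rewrite normrM ger0_norm// mulrCA ler_wpM2l.
Qed.

(** Conjugate of d/dth under the projection: the derivative of a o Pi is
    (circle_deriv a) o Pi. *)
Definition circle_deriv a x : R := - 2^-1 * (1 + x ^+ 2) * derive1 a x.

Lemma sch_circle_deriv a : rschwartz a -> rschwartz (circle_deriv a).
Proof.
move=> sa; have s1 := sch_derive1 sa; have s2 := sch_mulx (sch_mulx s1).
have s3 := sch_lin (- 2^-1 - 1) s1 s1; have s4 := sch_lin (- 2^-1) s3 s2.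
rewrite (_ : circle_deriv a = (fun x => derive1 a x + (- 2^-1 - 1) * derive1 a x + - 2^-1 * (x * (x * derive1 a x))))//.
by apply/funext => x; rewrite /circle_deriv; ring.
Qed.

(** a o Pi, extended by its limit 0 at the pole. *)
Definition pole_ext a th : R := if 1 + sin th == 0 then 0 else a (stereo th).

Lemma pole_ext_ster a x : pole_ext a (ster_inv x) = a x.
Proof.
by rewrite /pole_ext oneDsin_ster_inv mulf_eq0 invr_eq0 pnatr_eq0/= (negbTE (oneDsqr_neq0 x)) ster_invK.
Qed.

Lemma oneD_stereo_sqr th : 1 + sin th != 0 -> 1 + stereo th ^+ 2 = 2 / (1 + sin th).
Proof.
by move=> s0; rewrite /stereo expr_div_n cos2sin2; field.
Qed.

Lemma pole_ext_le a (C th : R) : (forall x, `|a x| <= C * (1 + x ^+ 2)^-1) -> `|pole_ext a th| <= C * (1 + sin th).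
Proof.
move=> h; rewrite /pole_ext; case: eqP => [->|/eqP s0]; first by rewrite normr0 mulr0.
have := h (stereo th); rewrite oneD_stereo_sqr// invf_div => /le_trans; apply.
have C0 : 0 <= C by have := le_trans (normr_ge0 _) (h 0); rewrite expr0n addr0 invr1 mulr1.
rewrite mulrA ler_pdivrMr// mulr_natr mulr2n lerDl mulr_ge0//; exact: oneDsin_ge0.
Qed.

Lemma one_sub_cos_le (s : R) : 1 - cos s <= s ^+ 2.
Proof.
rewrite one_sub_cosE.
have h := @MVT_bound _ sin cos 1 0 (s / 2) (fun x => is_derive_sin x) (fun z _ => cos_max z).
rewrite sin0 !subr0 mul1r in h.
have := ler_pM (normr_ge0 _) (normr_ge0 _) h h; rewrite -!normrM -!expr2 !ger0_norm ?sqr_ge0//.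
have := sqr_ge0 s; lra.
Qed.

(** At the pole, a = O(1 / (1 + x^2)) becomes a bound by 1 + sin, which is
    quadratic there. *)
Lemma is_derive_pole_ext a th : rschwartz a -> is_derive th 1 (pole_ext a) (pole_ext (circle_deriv a) th).
Proof.
move=> sa; have [s0|s0] := eqVneq (1 + sin th) 0.
  rewrite {2}/pole_ext s0 eqxx.
  have [C h] := sch_le sa.
  have C0 : 0 <= C by have := le_trans (normr_ge0 _) (h 0); rewrite expr0n addr0 invr1 mulr1.
  apply: (@is_derive_flat _ _ _ C) => s; apply: (le_trans (pole_ext_le _ h)); rewrite ler_wpM2l//.
  have sth : sin th = -1 by apply/eqP; rewrite -addr_eq0 addrC s0.
  have cth : cos th = 0 by apply/eqP; rewrite -sqrf_eq0 cos2sin2 sth sqrrN expr1n subrr.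
  (* 1 + sin (th + s) = 1 - cos s at the pole. *)
  by rewrite sinD sth cth mul0r addr0 mulN1r one_sub_cos_le.
have da := rsmooth_is_derive (stereo th) sa.1.
have d1 := dcomp da (is_derive_stereo s0).
have {d1}d1 : is_derive th 1 (fun t => a (stereo t)) (pole_ext (circle_deriv a) th).
  apply: (is_derive_eq d1); rewrite /pole_ext (negbTE s0) /circle_deriv oneD_stereo_sqr//.
  by field.
apply: near_eq_is_derive d1.
have cs : {for th, continuous (fun t : R => 1 + sin t)}.
  by apply: cvgD; [exact: cvg_cst|exact: continuous_sin].
have : \forall t \near th, 1 + sin t != 0 by exact: (cvgr_neq0 _ cs).
by apply: filterS => t t0; rewrite /pole_ext (negbTE t0).
Qed.

(** Rapid decay makes a o Pi flat at the pole. The Schwartz class is stable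
    under [circle_deriv], so that one derivative suffices. *)
Lemma ctest_pole_ext a : rschwartz a -> ctest (pole_ext a).
Proof.
move=> sa; split; last first.
  by move=> t; rewrite /pole_ext /stereo per_sin per_cos.
have key n : exists b, rschwartz b /\ derive1n n (pole_ext a) = pole_ext b.
  elim: n => [|n [b [sb E]]]; first by exists a.
  exists (circle_deriv b); split; first exact: sch_circle_deriv.
  by rewrite derive1nS E; apply/funext => x; apply: derive1_val; exact: is_derive_pole_ext.
move=> n x; have [b [sb ->]] := key n.
by have d := is_derive_pole_ext x sb; exact: ex_derive.
Qed.

Lemma rsmooth_ster_inv : rsmooth (@ster_inv R).
Proof.
apply: rsmoothB; first exact: rsmooth_cst.
by apply: rsmoothM; [exact: rsmooth_cst|exact: rsmooth_atan].
Qed.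

(** A neighbourhood of the pole is a neighbourhood of infinity: these functions
    have compact support on the line. *)
Lemma punctured_sch psi : ctest psi -> (\forall t \near mia, psi t = 0) ->
  rschwartz (fun x => psi (ster_inv x)).
Proof.
move=> [sp pp] /nbhs_ballP[e /= e0 he].
have hM : exists M : R, forall x, M < x -> pi / 2 - atan x < e / 2.
  have e2 : 0 < e / 2 by rewrite divr_gt0.
  have := @cvgy_atan R => /cvgrPdist_lt /(_ _ e2) [M [_ hM]].
  exists M => x /hM /=; apply: le_lt_trans; exact: ler_norm.
have [M {}hM] := hM.
apply: (@compact_support_rschwartz _ _ M); first exact: rsmooth_comp rsmooth_ster_inv.
have key x : M < x -> psi (ster_inv x) = 0 /\ psi (ster_inv (- x)) = 0.
  move=> Mx; have h := hM x Mx; have a1 := @atan_ltpi2 R x.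
  split.
    apply: he; rewrite /ball/= /ster_inv /minus_i_angle.
    rewrite ler0_norm; first lra.
    by have := pi_gt0 R; lra.
  rewrite /ster_inv atanN -pp -(_ : ster_inv (- x) - 2 * pi + 2 * pi + 2 * pi = pi / 2 - 2 * - atan x + 2 * pi); last first.
    by rewrite /ster_inv atanN; ring.
  rewrite !pp; apply: he; rewrite /ball/= /ster_inv /minus_i_angle atanN.
  rewrite ger0_norm; lra.
move=> x; have [x0|x0] := lerP 0 x.
  by rewrite ger0_norm// => /key[].
by rewrite ltr0_norm// => /key[_]; rewrite opprK.
Qed.

Lemma line_hlap_pole_ext a x : rschwartz a ->
  line_hlap a x = 2 / (1 + x ^+ 2) * circle_hlap (pole_ext a) (ster_inv x).
Proof.
move=> sa; have [C h] := ctest_C2per (ctest_pole_ext sa).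
by apply: (line_hlap_circle x sa h) => y; rewrite pole_ext_ster.
Qed.

Lemma line_hlap_punctured psi x : ctest psi -> (\forall t \near mia, psi t = 0) ->
  line_hlap (fun x => psi (ster_inv x)) x = 2 / (1 + x ^+ 2) * circle_hlap psi (ster_inv x).
Proof.
move=> tp p0; have [C h] := ctest_C2per tp.
by apply: (line_hlap_circle x (punctured_sch tp p0) h).
Qed.

(** Stated for a product because w is a function of the line, defined at the
    pole only by convention, while h lives on the circle. *)
Lemma pull_intg (w h : R -> R) : measurable_fun setT w -> measurable_fun setT h ->
  intg setT (fun x => w x * (2 / (1 + x ^+ 2) * h (ster_inv x))) <->
  intg circle (fun th => w (stereo th) * h th).
Proof.
move=> mw mh.
have m : measurable_fun setT (fun x => w x * (2 / (1 + x ^+ 2) * h (ster_inv x))).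
  apply: measurable_funM => //; apply: measurable_funM; last exact: (measurableT_comp mh (@meas_ster_inv R)).
  apply: measurable_funM => //; apply: measV; apply: measurable_funD => //; exact: measurable_funX.
have E th : arc th -> w (stereo th) * (2 / (1 + stereo th ^+ 2) * h (ster_inv (stereo th))) / (1 + sin th)
   = w (stereo th) * h th.
  move=> at_; have s0 := lt0r_neq0 (oneDsin_gt0 at_); rewrite (stereoK at_) -(arc_oneDsin at_).
  by field.
rewrite (stereo_intg m) -intg_arc_circle; split; apply: eq_intg; try exact: measurable_arc.
  by move=> th /E.
by move=> th /E.
Qed.

Lemma pull_Rint (w h : R -> R) : measurable_fun setT w -> measurable_fun setT h ->
  intg circle (fun th => w (stereo th) * h th) ->
  (\int[mu]_x (w x * (2 / (1 + x ^+ 2) * h (ster_inv x))) = \int[mu]_(th in circle) (w (stereo th) * h th))%R.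
Proof.
move=> mw mh I.
have m : measurable_fun setT (fun x => w x * (2 / (1 + x ^+ 2) * h (ster_inv x))).
  apply: measurable_funM => //; apply: measurable_funM; last exact: (measurableT_comp mh (@meas_ster_inv R)).
  apply: measurable_funM => //; apply: measV; apply: measurable_funD => //; exact: measurable_funX.
rewrite (stereo_Rint m) -Rint_arc_circle//; apply: eq_Rint => th at_.
have s0 := lt0r_neq0 (oneDsin_gt0 at_); rewrite (stereoK at_) -(arc_oneDsin at_).
by field.
Qed.

End Transfer.

(** * Extension through the pole *)

Section Cutoff.
Context {R : realType}.
Local Notation mu := (@lebesgue_measure R).
Local Notation circle := (@circle R).
Local Notation arc := (@arc R).
Local Notation mia := (@minus_i_angle R).
Implicit Types (x y t th s : R) (psi : R -> R).

Lemma bumpk_bound k y : bumpk k y <= k`!%:R.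
Proof.
rewrite /bumpk; case: ifPn => // y0.
have i0 : 0 <= y^-1 by rewrite invr_ge0 ltW.
case: k => [|k]; last exact: expR_decay.
by rewrite expr0 mul1r -expR0 ler_expR oppr_le0.
Qed.

Lemma mul_bumpk k y : y * bumpk k.+1 y = bumpk k y.
Proof.
rewrite /bumpk; case: ifPn => // [y0|]; last by rewrite mulr0.
by rewrite exprS -mulrA mulVKf// gt_eqF.
Qed.

Let b2 y : 0 <= bumpk 2 y <= 2. Proof. by rewrite bumpk_ge0/=; exact: bumpk_bound. Qed.

(** Multiplication by y lowers the index of [bumpk]; so powers of 1 + y are
    absorbed although y is unbounded. *)
Lemma bump_deriv_bounds y : -1 <= y -> 0 <= (1 + y) ^+ 2 * bumpk 2 y <= 10 /\
  `|(1 + y) ^+ 2 * (bumpk 4 y - 2 * bumpk 3 y)| <= 100.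
Proof.
move=> y1.
have e4 : (1 + y) ^+ 2 * bumpk 4 y = bumpk 4 y + 2 * bumpk 3 y + bumpk 2 y.
  by rewrite -(mul_bumpk 2 y) -(mul_bumpk 3 y); ring.
have e3 : (1 + y) ^+ 2 * bumpk 3 y = bumpk 3 y + 2 * bumpk 2 y + bumpk 1 y.
  by rewrite -(mul_bumpk 1 y) -(mul_bumpk 2 y); ring.
have e2 : (1 + y) ^+ 2 * bumpk 2 y = bumpk 2 y + 2 * bumpk 1 y + bumpk 0 y.
  by rewrite -(mul_bumpk 0 y) -(mul_bumpk 1 y); ring.
have h0 := bumpk_bound 0 y; have h1 := bumpk_bound 1 y; have h2 := bumpk_bound 2 y.
have h3 := bumpk_bound 3 y; have h4 := bumpk_bound 4 y.
have g0 := bumpk_ge0 0 y; have g1 := bumpk_ge0 1 y; have g2 := bumpk_ge0 2 y.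
have g3 := bumpk_ge0 3 y; have g4 := bumpk_ge0 4 y.
rewrite (_ : 0`!%:R = 1 :> R) // in h0; rewrite (_ : 1`!%:R = 1 :> R) // in h1.
rewrite (_ : 2`!%:R = 2 :> R) // in h2; rewrite (_ : 3`!%:R = 6 :> R) // in h3.
rewrite (_ : 4`!%:R = 24 :> R) // in h4.
split; first by rewrite e2; lra.
rewrite mulrBr mulrCA e4 e3 ler_norml; lra.
Qed.

Lemma cos_sub_mia th : 1 - cos (th - mia) = 1 + sin th.
Proof. by rewrite /minus_i_angle opprK cosDpihalf opprK. Qed.
Lemma sin_sub_mia th : sin (th - mia) = cos th.
Proof. by rewrite /minus_i_angle opprK sinDpihalf. Qed.
Lemma sin_mia : sin mia = -1 :> R. Proof. by rewrite /minus_i_angle sinN sin_pihalf. Qed.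
Lemma cos_mia : cos mia = 0 :> R. Proof. by rewrite /minus_i_angle cosN cos_pihalf. Qed.

Lemma cos_sqr_le th : cos th ^+ 2 <= 2 * (1 + sin th).
Proof. by rewrite cos2sin2; have := oneDsin_ge0 th; have := sin_le1 th; nra. Qed.

Lemma bump_cvg s : 0 < s -> (fun n : nat => bump (n%:R * s - 1)) @ \oo --> (1 : R).
Proof.
move=> s0.
rewrite -[X in _ --> X]subr0.
rewrite (_ : (fun n : nat => bump (n%:R * s - 1)) = (fun n : nat => 1 - (1 - bump (n%:R * s - 1)))); last by apply/funext => n; rewrite subKr.
apply: cvgB; first exact: cvg_cst.
apply: (@cvg0_harmonic _ _ (4 / s + 1)) => n.
have c0 : 0 <= bump (n%:R * s - 1) by exact: bumpk_ge0.
have c1 : bump (n%:R * s - 1) <= 1 by exact: bumpk_bound.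
rewrite ger0_norm ?subr_ge0// ler_pdivlMr// -[n.+1%:R]natr1.
have n0 : 0 <= n%:R :> R by [].
have is0 : 0 < s^-1 by rewrite invr_gt0.
have ss : s * s^-1 = 1 by rewrite mulfV// gt_eqF.
have [h|h] := ltP (n%:R * s) 2.
  have : n%:R <= 2 / s by rewrite ler_pdivlMr// ltW.
  by nra.
have n1 : 1 <= n%:R :> R.
  by rewrite ler1n lt0n; apply/eqP => n1; move: h; rewrite n1 mul0r; lra.
have a0 : 0 < n%:R * s - 1 by lra.
have cE : 1 - (n%:R * s - 1)^-1 <= bump (n%:R * s - 1).
  by rewrite /bump /bumpk a0 expr0 mul1r; exact: expR_ge1Dx.
have : (n%:R * s - 1)^-1 <= 2 / (n%:R * s).
  rewrite -[X in X <= _]mul1r ler_pdivrMr// mulrAC ler_pdivlMr; last by lra.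
  by lra.
have -> : 2 / (n%:R * s) = 2 / s / n%:R by rewrite invfM; ring.
move=> hz.
have : 1 - bump (n%:R * s - 1) <= 2 / s / n%:R by lra.
rewrite ler_pdivlMr ?(lt_le_trans ltr01)// => hn.
nra.
Qed.

Section Flat.
Variables (psi : R -> R).
Hypotheses (tp : ctest psi) (p0 : psi mia = 0) (p1 : derive1 psi mia = 0).

(** Taylor expansion at the pole, where 1 + sin vanishes to second order and
    cos to first order. *)
Let flat0 : exists C : R, 0 <= C /\ forall th, `|psi th| <= C * (1 + sin th) /\
  `|derive1 psi th| <= C * (`|cos th| + (1 + sin th)).
Proof.
have [C h] := ctest_C2per tp; have [C' h'] := ctest_C2per (ctest_derive1 tp).
have C0 := C2per_ge0 h; have C0' := C2per_ge0 h'.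
exists (32 * C + 32 * C'); split; first by rewrite addr_ge0// mulr_ge0.
move=> th; have s0 := oneDsin_ge0 th; have c0 := normr_ge0 (cos th).
have := sin_rem_le mia (th - mia) h; have := sin_rem_le mia (th - mia) h'.
rewrite cos_sub_mia /sin_rem (_ : mia + (th - mia) = th); last by ring.
rewrite sin_sub_mia p0 p1 mul0r !subr0 => hr' hr; split; first nra.
have d2 : `|derive1 (derive1 psi) mia| <= C' by have [_ _ b _ _] := h'; have [] := b mia.
set b := derive1 (derive1 psi) mia * cos th in hr' *.
have hb : `|b| <= C' * `|cos th| by rewrite normrM ler_wpM2r.
have : `|derive1 psi th| <= `|derive1 psi th - b| + `|b| by rewrite -{1}(subrK b (derive1 psi th)) ler_normD.
move: hr' hb; rewrite /b; move: `|cos th| c0 => c c0 *; nra.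
Qed.

(** Vanishes where 1 + sin <= 1 / n and tends to 1 off the pole. *)
Definition cut n th : R := bump (n%:R * (1 + sin th) - 1).
Let arg n th : R := n%:R * (1 + sin th) - 1.
Let cut1 n th : R := bumpk 2 (arg n th) * (n%:R * cos th).
Let cut2 n th : R := (bumpk 4 (arg n th) - 2 * bumpk 3 (arg n th)) * (n%:R * cos th) ^+ 2
   - bumpk 2 (arg n th) * (n%:R * sin th).

Let darg n th : is_derive th 1 (arg n) (n%:R * cos th).
Proof.
apply: (is_derive_eq (dB (dZ n%:R (dD (dC 1 th) (is_derive_sin th))) (dC 1 th))).
by rewrite add0r subr0.
Qed.

Let dcut n th : is_derive th 1 (cut n) (cut1 n th).
Proof.
apply: (is_derive_eq (@dcomp R bump (arg n) th _ _ (bumpk_derive 0 (arg n th)) (darg n th))).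
by rewrite mul0r subr0.
Qed.

Let dcut1 n th : is_derive th 1 (cut1 n) (cut2 n th).
Proof.
have d1 := @dcomp R (bumpk 2) (arg n) th _ _ (bumpk_derive 2 (arg n th)) (darg n th).
apply: (is_derive_eq (dM d1 (dZ n%:R (is_derive_cos th)))).
by rewrite /cut2; ring.
Qed.

Let ctest_cut n : ctest (cut n).
Proof.
split; last by move=> t; rewrite /cut per_sin.
apply: rsmooth_comp; first exact: rsmooth_bump.
apply: rsmoothB; last exact: rsmooth_cst.
apply: rsmoothM; first exact: rsmooth_cst.
by apply: rsmoothD; [exact: rsmooth_cst|exact: rsmooth_sin].
Qed.

Let arg_ge n th : -1 <= arg n th.
Proof. by rewrite /arg lerDr mulr_ge0// oneDsin_ge0. Qed.

Let argE n th : 1 + arg n th = n%:R * (1 + sin th).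
Proof. by rewrite /arg; ring. Qed.

Let f n th := psi th * cut n th.
Let f1 n th := derive1 psi th * cut n th + psi th * cut1 n th.
Let f2 n th := derive1 (derive1 psi) th * cut n th + 2 * (derive1 psi th * cut1 n th) + psi th * cut2 n th.

Let df n th : is_derive th 1 (f n) (f1 n th).
Proof. exact: (dM (rsmooth_is_derive th tp.1) (dcut n th)). Qed.

Let df1 n th : is_derive th 1 (f1 n) (f2 n th).
Proof.
have d1 := rsmooth_is_derive th tp.1.
have d2 := rsmooth_is_derive th (rsmooth_derive1 tp.1).
apply: (is_derive_eq (dD (dM d2 (dcut n th)) (dM d1 (dcut1 n th)))).
by rewrite /f2; ring.
Qed.

(** Each derivative of the cutoff costs a factor n^(1/2) on the scale 1 + sin ~
    1 / n, which the vanishing of psi to second order compensates. So the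
    second derivatives stay bounded, without tending to a limit at the pole. *)
Let f_bound : exists C : R, forall n, C2per (f n) C.
Proof.
have [C0 [C00 h0]] := flat0; have [C h] := ctest_C2per tp.
have CC := C2per_ge0 h; have [_ _ b bb _] := h.
exists (C + 400 * C0) => n.
have cut01 th : 0 <= cut n th <= 1 by rewrite bumpk_ge0/=; exact: bumpk_bound.
have E1 x : derive1 (f n) x = f1 n x by apply: derive1_val; exact: df.
have E2 : derive1 (f n) = f1 n by apply/funext.
have E3 x : derive1 (derive1 (f n)) x = f2 n x by rewrite E2; apply: derive1_val; exact: df1.
have mix (p c : R) : 0 <= c <= 1 -> `|p| <= C -> `|p * c| <= C.
  by move=> /andP[c0 c1] pC; rewrite normrM (ger0_norm c0) (le_trans _ pC)// ler_piMr.
have ks th : 0 <= n%:R * (1 + sin th) * bumpk 2 (arg n th) <= 20.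
  have [hb _] := bump_deriv_bounds (arg_ge n th); have /andP[b0 b2'] := b2 (arg n th).
  rewrite -argE; have ya := arg_ge n th; move: hb b2' b0; move: (arg n th) (bumpk 2 _) ya => y k ya /andP[_ hb] k2 k0.
  by apply/andP; split; nra.
have n0 : 0 <= n%:R :> R by [].
have q1 th : `|psi th * cut1 n th| <= 20 * C0.
  have [hp _] := h0 th; have /andP[b0 _] := b2 (arg n th); have /andP[_ hs] := ks th.
  rewrite /cut1 !normrM (ger0_norm b0) (ger0_norm n0).
  have hc : `|psi th| * (bumpk 2 (arg n th) * (n%:R * `|cos th|)) <= `|psi th| * (bumpk 2 (arg n th) * n%:R).
    by rewrite ler_wpM2l// ler_wpM2l// ler_piMr// cos_max.
  apply: (le_trans hc).
  apply: (le_trans (ler_wpM2r (mulr_ge0 b0 n0) hp)).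
  by rewrite (_ : C0 * _ * _ = C0 * (n%:R * (1 + sin th) * bumpk 2 (arg n th))); [rewrite mulrC ler_wpM2r|ring].
have q2 th : `|derive1 psi th * cut1 n th| <= 60 * C0.
  have [_ hp] := h0 th; have /andP[b0 _] := b2 (arg n th); have /andP[_ hs] := ks th.
  have s0 := oneDsin_ge0 th; have c2 := cos_sqr_le th; have c1 := cos_max th; have c0 := normr_ge0 (cos th).
  rewrite /cut1 !normrM (ger0_norm b0) (ger0_norm n0).
  have k0 : 0 <= bumpk 2 (arg n th) * (n%:R * `|cos th|) by rewrite !mulr_ge0.
  apply: (le_trans (ler_wpM2r k0 hp)).
  have cc : (`|cos th| + (1 + sin th)) * `|cos th| <= 3 * (1 + sin th).
    by rewrite -(real_normK (num_real (cos th))) in c2; nra.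
  have := ler_wpM2l (mulr_ge0 C00 (mulr_ge0 n0 b0)) cc.
  move=> /(fun H => le_trans H) X; rewrite (_ : C0 * _ * _ = C0 * (n%:R * bumpk 2 (arg n th)) *
     ((`|cos th| + (1 + sin th)) * `|cos th|)); last by ring.
  apply: X; rewrite [X in X <= _](_ : _ = 3 * C0 * (n%:R * (1 + sin th) * bumpk 2 (arg n th))); last by ring.
  by rewrite (_ : 60 * C0 = 3 * C0 * 20); [rewrite ler_wpM2l// mulr_ge0|ring].
have q3 th : `|psi th * cut2 n th| <= 220 * C0.
  have [hp _] := h0 th; have /andP[b0 _] := b2 (arg n th); have /andP[_ hs] := ks th.
  have s0 := oneDsin_ge0 th; have c2 := cos_sqr_le th.
  have [_ hb] := bump_deriv_bounds (arg_ge n th); rewrite argE in hb.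
  rewrite normrM; apply: (le_trans (ler_wpM2r (normr_ge0 _) hp)).
  rewrite -[X in X <= _]mulrA [220 * C0]mulrC ler_wpM2l//.
  rewrite -[X in X * _](ger0_norm s0) -normrM /cut2 mulrBr.
  apply: (le_trans (ler_normB _ _)); rewrite (_ : 220 = 200 + 20); last by ring.
  apply: lerD; last first.
    rewrite (_ : (1 + sin th) * _ = n%:R * (1 + sin th) * bumpk 2 (arg n th) * sin th); last by ring.
    rewrite normrM (ger0_norm (_ : 0 <= n%:R * (1 + sin th) * bumpk 2 (arg n th))) ?mulr_ge0//.
    by rewrite (le_trans _ hs)// ler_piMr ?mulr_ge0// sin_max.
  set B := bumpk 4 _ - _ in hb *.
  rewrite (_ : (1 + sin th) * _ = (n%:R ^+ 2 * (1 + sin th) * B) * cos th ^+ 2); last by ring.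
  rewrite normrM (ger0_norm (sqr_ge0 (cos th))).
  apply: (le_trans (ler_wpM2l (normr_ge0 _) c2)).
  rewrite -[X in _ * X](ger0_norm (mulr_ge0 (ler0n _ 2) s0)) -normrM.
  rewrite (_ : n%:R ^+ 2 * (1 + sin th) * B * _ = 2 * ((n%:R * (1 + sin th)) ^+ 2 * B)); last by ring.
  by rewrite normrM (ger0_norm (ler0n _ 2)); lra.
have b0 x : `|psi x| <= C by have [] := b x.
have b1 x : `|derive1 psi x| <= C by have [] := b x.
split.
- by move=> x; have d := df n x; exact: ex_derive.
- by move=> x; rewrite E2; have d := df1 n x; exact: ex_derive.
- move=> x; split.
    by apply: (le_trans (mix _ _ (cut01 x) (b0 x))); rewrite lerDl; exact: (mulr_ge0 (ler0n _ _) C00).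
  rewrite E1 /f1 (le_trans (ler_normD _ _))//.
  have := mix _ _ (cut01 x) (b1 x); have := q1 x; lra.
- move=> x; rewrite E3 /f2 (le_trans (ler_normD _ _))//.
  have := ler_normD (derive1 (derive1 psi) x * cut n x) (2 * (derive1 psi x * cut1 n x)).
  rewrite (normrM 2) (ger0_norm (ler0n _ 2)).
  have b2'' : `|derive1 (derive1 psi) x| <= C by have [_ _ _ b3 _] := h.
  have := mix _ _ (cut01 x) b2''; have := q2 x; have := q3 x; lra.
- by have [] := ctestM tp (ctest_cut n).
Qed.

Let cut_cvg th : 0 < 1 + sin th -> (fun n => cut n th) @ \oo --> (1 : R).
Proof. exact: bump_cvg. Qed.

Let cut1_cvg th : 0 < 1 + sin th -> (fun n => cut1 n th) @ \oo --> (0 : R).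
Proof.
move=> s0; apply: (@cvg0_harmonic _ _ (20 / (1 + sin th) ^+ 2)) => n.
have /andP[b0 _] := b2 (arg n th).
have [/andP[_ hb] _] := bump_deriv_bounds (arg_ge n th); rewrite argE exprMn in hb.
have n0 : 0 <= n%:R :> R by [].
rewrite /cut1 !normrM (ger0_norm b0) (ger0_norm n0).
apply: (@le_trans _ _ (bumpk 2 (arg n th) * n%:R)).
  by rewrite ler_wpM2l// ler_piMr// cos_max.
rewrite ler_pdivlMr// ler_pdivlMr ?exprn_gt0// -[n.+1%:R]natr1.
have [->|n1] := eqVneq n 0%N; first by rewrite mulr0 !mul0r.
have {}n1 : 1 <= n%:R :> R by rewrite ler1n lt0n.
have q0 : 0 <= (1 + sin th) ^+ 2 by rewrite sqr_ge0.
have h : 0 <= bumpk 2 (arg n th) * (1 + sin th) ^+ 2 by rewrite mulr_ge0.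
have : n%:R * (n%:R + 1) <= 2 * n%:R ^+ 2 :> R by nra.
move=> /(ler_wpM2l h); lra.
Qed.

Let f_cvg th : (fun n => f n th) @ \oo --> psi th /\ (fun n => f1 n th) @ \oo --> derive1 psi th.
Proof.
have [C0 [C00 h0]] := flat0; have [hp hp1] := h0 th.
have s0 := oneDsin_ge0 th.
have [s1|s1] := eqVneq (1 + sin th) 0.
  have c0 : cos th = 0.
    by apply/eqP; rewrite -sqrf_eq0 eq_le sqr_ge0 andbT; have := cos_sqr_le th; rewrite s1 mulr0.
  rewrite s1 mulr0 normr_le0 in hp; rewrite s1 c0 normr0 addr0 mulr0 normr_le0 in hp1.
  rewrite /f /f1 (eqP hp) (eqP hp1); split.
    by under eq_fun do rewrite mul0r; exact: cvg_cst.
  by under eq_fun do rewrite !mul0r addr0; exact: cvg_cst.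
have {}s1 : 0 < 1 + sin th by rewrite lt_def s1.
split.
  by rewrite -[X in _ --> X]mulr1; apply: cvgM; [exact: cvg_cst|exact: cut_cvg].
rewrite -[X in _ --> X]addr0 -[X in _ --> X + _]mulr1 -[X in _ --> _ + X](mulr0 (psi th)).
apply: cvgD; apply: cvgM; first exact: cvg_cst; first exact: cut_cvg; first exact: cvg_cst.
exact: cut1_cvg.
Qed.

(** Convergence of the first derivatives and a uniform C^2 bound are enough for
    the half-Laplacians to converge. *)
Lemma flat_cutoff : exists (g : nat -> R -> R) (C : R),
  [/\ forall n, ctest (g n) /\ \forall t \near mia, g n t = 0,
   forall n, C2per (g n) C, forall th, (fun n => g n th) @ \oo --> psi th &
   forall th, (fun n => circle_hlap (g n) th) @ \oo --> circle_hlap psi th].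
Proof.
have [C hC] := f_bound; exists f, C; split=> //.
- move=> n; split; first by apply: ctestM.
  have cs : {for mia, continuous (fun t : R => 1 + sin t)}.
    by apply: cvgD; [exact: cvg_cst|exact: continuous_sin].
  have : \forall t \near mia, 1 + sin t < n.+1%:R^-1.
    by apply: (cvgr_lt _ cs); rewrite sin_mia subrr invr_gt0.
  apply: filterS => t ht; rewrite /f /cut /bump /bumpk ifF ?mulr0//.
  apply/negbTE; rewrite -leNgt subr_le0.
  have := oneDsin_ge0 t; move: ht; rewrite -[X in _ < X]mul1r ltr_pdivlMr// -[n.+1%:R]natr1.
  have n0 : 0 <= n%:R :> R by []; nra.
- by move=> th; have [] := f_cvg th.
- move=> th; apply: (circle_hlap_dct hC) => s.
  rewrite /sin_rem; apply: cvgB.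
    by apply: cvgB; [have [] := f_cvg (th + s)|have [] := f_cvg th].
  apply: cvgM; last exact: cvg_cst.
  rewrite (_ : (fun n => derive1 (f n) th) = (fun n => f1 n th)); first by have [] := f_cvg th.
  by apply/funext => n; apply: derive1_val; exact: df.
Qed.

End Flat.

Section Extend.
Variables (v G : R -> R).
Hypotheses (Iv : intg circle v) (IG : intg circle G).
Hypothesis punctured : forall psi, ctest psi -> (\forall t \near mia, psi t = 0) ->
  (\int[mu]_(th in circle) (v th * circle_hlap psi th) = \int[mu]_(th in circle) (G th * psi th))%R.

Let mv := intg_meas Iv.
Let mG := intg_meas IG.

Let IvT psi C : C2per psi C -> intg circle (fun th => v th * circle_hlap psi th).
Proof.
move=> h; apply: (intgM_bounded _ Iv _ (fun th => circle_hlap_le th h)) => //.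
by apply: measurable_funTS; exact: meas_circle_hlap h.
Qed.

Let IGp psi : ctest psi -> intg circle (fun th => G th * psi th).
Proof.
move=> tp; have [C h] := ctest_C2per tp; have [_ _ b _ _] := h.
apply: (@intgM_bounded _ _ _ _ C) => //; last by move=> x; have [] := b x.
by apply: measurable_funTS; exact: C2per_meas h.
Qed.

Let dct_v (F : nat -> R -> R) (F0 : R -> R) (w : R -> R) (D : set R) (C : R) : measurable D -> intg D w ->
  (forall n, measurable_fun D (F n)) -> (forall n th, D th -> `|F n th| <= C) ->
  (forall th, D th -> (fun n => F n th) @ \oo --> F0 th) ->
  (fun n => \int[mu]_(th in D) (w th * F n th))%R @ \oo --> (\int[mu]_(th in D) (w th * F0 th))%R.
Proof.
move=> mD Iw mF bF cF; have mw := intg_meas Iw.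
apply: (proj2 (@Rint_dct _ D _ _ (fun th => C * `|w th|) mD _ _ _ _)).
- by move=> n; apply: measurable_funM.
- by move=> th Dt; apply: cvgM; [exact: cvg_cst|exact: cF].
- by move=> n th Dt; rewrite normrM mulrC ler_wpM2r// bF.
- by apply: intgZ => //; exact: intg_norm.
Qed.

Let flat_case psi : ctest psi -> psi mia = 0 -> derive1 psi mia = 0 ->
  (\int[mu]_(th in circle) (v th * circle_hlap psi th) = \int[mu]_(th in circle) (G th * psi th))%R.
Proof.
move=> tp p0 p1; have [g [C [tg hC cg cT]]] := flat_cutoff tp p0 p1.
have L1 := @dct_v (fun n => circle_hlap (g n)) (circle_hlap psi) v circle (32 * C) (@measurable_circle R) Iv.
have L2 := @dct_v g psi G circle C (@measurable_circle R) IG.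
have {}L1 : (fun n => \int[mu]_(th in circle) (v th * circle_hlap (g n) th))%R @ \oo -->
  (\int[mu]_(th in circle) (v th * circle_hlap psi th))%R.
  apply: L1.
  - by move=> n; apply: measurable_funTS; exact: meas_circle_hlap (hC n).
  - by move=> n th _; exact: circle_hlap_le (hC n).
  - by move=> th _; exact: cT.
have {}L2 : (fun n => \int[mu]_(th in circle) (G th * g n th))%R @ \oo -->
  (\int[mu]_(th in circle) (G th * psi th))%R.
  apply: L2.
  - by move=> n; apply: measurable_funTS; exact: C2per_meas (hC n).
  - by move=> n th _; have [_ _ b _ _] := hC n; have [] := b th.
  - by move=> th _; exact: cg.
have E : (fun n => \int[mu]_(th in circle) (v th * circle_hlap (g n) th))%R =
   (fun n => \int[mu]_(th in circle) (G th * g n th))%R.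
  by apply/funext => n; have [t1 t2] := tg n; exact: punctured.
rewrite E in L1.
by apply: (cvg_unique _ L1 L2).
Qed.

Let eps n : R := n.+1%:R^-1.
(** A dilated cosine. It has the same derivative as cos at the pole, yet tends
    to 0 together with its half-Laplacian off the pole. *)
Let ceps n th : R := 2 * eps n ^+ 2 * ((1 + sin th) + eps n ^+ 2 * (1 - sin th))^-1 * cos th.

Let eps0 n : 0 < eps n. Proof. by rewrite invr_gt0. Qed.
Let eps1 n : eps n <= 1. Proof. by rewrite invf_le1// ler1n. Qed.

Let ctest_P n : ctest (fun th => 2 * eps n ^+ 2 * ((1 + sin th) + eps n ^+ 2 * (1 - sin th))^-1).
Proof.
apply: ctestM; first exact: ctest_cst.
by apply: ctestV; [move=> th; rewrite gt_eqF// mobius_den_gt0|exact: ctest_mobius_den].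
Qed.

Let ctest_ceps n : ctest (ceps n).
Proof. by apply: ctestM; [exact: ctest_P|exact: ctest_cos]. Qed.

Let ceps_ster n y : ceps n (ster_inv y) = eps n * cos (ster_inv (eps n * y)).
Proof.
have e0 := eps0 n; rewrite /ceps sin_ster_inv !cos_ster_inv.
have n1 := oneDsqr_neq0 y; have n2 := oneDsqr_neq0 (eps n * y).
rewrite (_ : 1 + (1 - y ^+ 2) / (1 + y ^+ 2) + _ = 2 * (1 + (eps n * y) ^+ 2) / (1 + y ^+ 2)); last by field.
by rewrite invf_div; move: (eps n) n2 => e n2; field; rewrite n1 n2.
Qed.

Let circle_hlap_ceps n x : circle_hlap (ceps n) (ster_inv x) =
  eps n ^+ 2 * (1 + x ^+ 2) / (1 + (eps n * x) ^+ 2) * cos (ster_inv (eps n * x)).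
Proof.
have [C h] := ctest_C2per (ctest_ceps n).
have te : ctest (fun th : R => 0 + eps n * cos th).
  by apply: ctestD; [exact: ctest_cst|apply: ctestM; [exact: ctest_cst|exact: ctest_cos]].
have [C' h'] := ctest_C2per te.
rewrite (circle_hlap_dilation x (eps0 n) h' h); last by move=> y; rewrite ceps_ster add0r.
rewrite (circle_hlap_lin _ _ (ctest_cst 0) (@ctest_cos R)) circle_hlap_cst circle_hlap_cos add0r.
have n2 := oneDsqr_neq0 (eps n * x).
by move: (eps n) (cos _) n2 => e c n2; field.
Qed.

Let ceps_arc_le n th : arc th -> `|ceps n th| <= eps n.
Proof.
move=> at_; rewrite -(stereoK at_) ceps_ster normrM (ger0_norm (ltW (eps0 n))).
by rewrite ler_piMr ?cos_max// ltW.
Qed.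

(** The first bound dominates, the second gives convergence to 0 off the pole.
    *)
Let circle_hlap_ceps_le n th : arc th -> `|circle_hlap (ceps n) th| <= 1 /\
  `|circle_hlap (ceps n) th| <= eps n * (1 + stereo th ^+ 2).
Proof.
move=> at_; rewrite -{1 2}(stereoK at_) circle_hlap_ceps; move: (stereo th) => x.
have e0 := eps0 n; have e1 := eps1 n.
have p0 := oneDsqr_gt0 (eps n * x); have x0 := oneDsqr_gt0 x.
have ee : eps n ^+ 2 <= 1 by rewrite exprn_ile1// ltW.
have q0 : 0 <= eps n ^+ 2 * (1 + x ^+ 2) / (1 + (eps n * x) ^+ 2).
  by apply: divr_ge0; [apply: mulr_ge0; [exact: sqr_ge0|exact: ltW]|exact: ltW].
rewrite normrM (ger0_norm q0).
have h : eps n ^+ 2 * (1 + x ^+ 2) / (1 + (eps n * x) ^+ 2) * `|cos (ster_inv (eps n * x))| <=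
   eps n ^+ 2 * (1 + x ^+ 2) / (1 + (eps n * x) ^+ 2) by rewrite ler_piMr// cos_max.
split; apply: (le_trans h); rewrite ler_pdivrMr//.
  by rewrite mul1r exprMn; have := sqr_ge0 x; nra.
have h2 : eps n ^+ 2 * (1 + x ^+ 2) <= eps n * (1 + x ^+ 2).
  by rewrite ler_wpM2r ?(ltW x0)// expr2 ler_piMl// ltW.
apply: (le_trans h2); rewrite ler_peMr// ?lerDl ?sqr_ge0//.
by rewrite mulr_ge0 ?ltW.
Qed.

Let flat_ceps n : cos mia - 1 * ceps n mia = 0 /\ derive1 (fun th => cos th + -1 * ceps n th) mia = 0.
Proof.
rewrite /ceps cos_mia !mulr0 subr0; split=> //; apply: derive1_val.
have dP := rsmooth_is_derive mia (ctest_P n).1.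
apply: (is_derive_eq (dD (is_derive_cos mia) (dZ (-1) (dM dP (is_derive_cos mia))))).
rewrite cos_mia sin_mia mulr0 add0r; have e0 := lt0r_neq0 (eps0 n).
by move: (eps n) e0 => e e0; field; rewrite e0.
Qed.

(** cos - ceps vanishes to second order at the pole, and ceps contributes
    nothing in the limit because v is a function. This rules out a derivative
    of the Dirac mass. *)
Let cos_case : (\int[mu]_(th in circle) (v th * cos th) = \int[mu]_(th in circle) (G th * cos th))%R.
Proof.
have mc : measurable_fun setT (@cos R) by exact: cont_meas (@continuous_cos R).
have Iva : intg arc v by apply/intg_arc_circle.
have IGa : intg arc G by apply/intg_arc_circle.
have Ivc : intg circle (fun th => v th * cos th).
  by apply: (@intgM_bounded _ _ _ _ 1) => //; [exact: measurable_funTS|move=> x; exact: cos_max].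
have IGc : intg circle (fun th => G th * cos th) by apply: IGp; exact: ctest_cos.
have td n : ctest (fun th => cos th + -1 * ceps n th).
  by apply: ctestD; [exact: ctest_cos|apply: ctestM; [exact: ctest_cst|exact: ctest_ceps]].
have E n : ((\int[mu]_(th in circle) (v th * cos th))%R - (\int[mu]_(th in arc) (v th * circle_hlap (ceps n) th))%R =
   (\int[mu]_(th in circle) (G th * cos th))%R - (\int[mu]_(th in arc) (G th * ceps n th)))%R.
  have [f0 f1] := flat_ceps n.
  have [C h] := ctest_C2per (ctest_ceps n).
  have I1 := IvT h; have I2 := IGp (ctest_ceps n).
  rewrite !Rint_arc_circle// -!Rint_B//.
  transitivity (\int[mu]_(th in circle) (v th * circle_hlap (fun th => cos th + -1 * ceps n th) th))%R.
    apply: eq_Rint => th _; rewrite (circle_hlap_lin _ _ (@ctest_cos R) (ctest_ceps n)) circle_hlap_cos; ring.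
  rewrite flat_case//; last by rewrite mulN1r -[ceps n mia]mul1r.
  by apply: eq_Rint => th _; ring.
have L1 : (fun n => \int[mu]_(th in arc) (v th * circle_hlap (ceps n) th))%R @ \oo --> (\int[mu]_(th in arc) (v th * 0))%R.
  apply: (@dct_v _ (fun _ => 0) v arc 1) => //; first exact: measurable_arc.
  - move=> n; have [C h] := ctest_C2per (ctest_ceps n).
    by apply: measurable_funTS; exact: meas_circle_hlap h.
  - by move=> n th at_; have [] := circle_hlap_ceps_le n at_.
  - move=> th at_; apply: (@cvg0_harmonic _ _ (1 + stereo th ^+ 2)) => n.
    by have [_] := circle_hlap_ceps_le n at_; rewrite mulrC.
have L2 : (fun n => \int[mu]_(th in arc) (G th * ceps n th))%R @ \oo --> (\int[mu]_(th in arc) (G th * 0))%R.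
  apply: (@dct_v _ (fun _ => 0) G arc 1) => //; first exact: measurable_arc.
  - move=> n; have [C h] := ctest_C2per (ctest_ceps n).
    by apply: measurable_funTS; exact: C2per_meas h.
  - by move=> n th at_; exact: (le_trans (ceps_arc_le n at_)).
  - by move=> th at_; apply: (@cvg0_harmonic _ _ 1) => n; rewrite mul1r; exact: ceps_arc_le.
have Z (w : R -> R) : (\int[mu]_(th in arc) (w th * 0))%R = 0.
  by rewrite -[RHS](@Rint0 _ arc); apply: eq_Rint => th _; rewrite mulr0.
rewrite Z in L1; rewrite Z in L2.
have M1 : (fun n => (\int[mu]_(th in circle) (v th * cos th))%R - (\int[mu]_(th in arc) (v th * circle_hlap (ceps n) th))%R)
   @ \oo --> (\int[mu]_(th in circle) (v th * cos th))%R.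
  by rewrite -[X in _ --> X]subr0; apply: cvgB; [exact: cvg_cst|exact: L1].
have M2 : (fun n => (\int[mu]_(th in circle) (G th * cos th))%R - (\int[mu]_(th in arc) (G th * ceps n th))%R)
   @ \oo --> (\int[mu]_(th in circle) (G th * cos th))%R.
  by rewrite -[X in _ --> X]subr0; apply: cvgB; [exact: cvg_cst|exact: L2].
rewrite (_ : (fun n => _) = (fun n => (\int[mu]_(th in circle) (G th * cos th))%R - (\int[mu]_(th in arc) (G th * ceps n th))%R)) in M1; last exact/funext.
by apply: (cvg_unique _ M1 M2).
Qed.

(** Subtracting psi mia and the multiple psi' mia of cos from psi makes it
    vanish to second order at the pole. The constants are killed by the half-
    Laplacian, which fixes the weight of the Dirac mass. *)
Lemma extend_through_pole psi : ctest psi ->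
  (\int[mu]_(th in circle) (v th * circle_hlap psi th) =
   \int[mu]_(th in circle) (G th * (psi th - psi mia)))%R.
Proof.
(* The derivative of cos at the pole is 1. *)
move=> tp; pose c := derive1 psi mia; pose d := psi mia.
have t1 : ctest (fun th => psi th + - c * cos th).
  by apply: ctestD => //; apply: ctestM; [exact: ctest_cst|exact: ctest_cos].
have t2 : ctest (fun th => psi th + - c * cos th + - d * 1).
  by apply: ctestD => //; exact: ctest_cst.
have [C h] := ctest_C2per tp.
have I1 := IvT h.
have mc : measurable_fun setT (@cos R) by exact: cont_meas (@continuous_cos R).
have Ivc : intg circle (fun th => v th * cos th).
  by apply: (@intgM_bounded _ _ _ _ 1) => //; [exact: measurable_funTS|move=> x; exact: cos_max].
have IGc : intg circle (fun th => G th * cos th) by apply: IGp; exact: ctest_cos.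
have IGd : intg circle (fun th => G th * (psi th - d)).
  by apply: IGp; apply: ctestB => //; exact: ctest_cst.
have E := flat_case t2 _ _.
have f0 : psi mia + - c * cos mia + - d * 1 = 0 by rewrite cos_mia /d; ring.
have f1 : derive1 (fun th => psi th + - c * cos th + - d * 1) mia = 0.
  apply: derive1_val; have dp := rsmooth_is_derive mia tp.1.
  apply: (is_derive_eq (dD (dD dp (dZ (- c) (is_derive_cos mia))) (dC (- d * 1) mia))).
  by rewrite sin_mia /c; ring.
have {}E := E f0 f1.
have L : (\int[mu]_(th in circle) (v th * circle_hlap (fun th => psi th + - c * cos th + - d * 1) th) =
   \int[mu]_(th in circle) (v th * circle_hlap psi th) - c * \int[mu]_(th in circle) (v th * cos th))%R.
  rewrite -Rint_Z// -Rint_B//; last exact: intgZ.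
  apply: eq_Rint => th _.
  rewrite (circle_hlap_lin _ _ t1 (ctest_cst 1)) (circle_hlap_lin _ _ tp (@ctest_cos R)) circle_hlap_cst circle_hlap_cos; ring.
have Rr : (\int[mu]_(th in circle) (G th * (psi th + - c * cos th + - d * 1)) =
   \int[mu]_(th in circle) (G th * (psi th - d)) - c * \int[mu]_(th in circle) (G th * cos th))%R.
  rewrite -Rint_Z// -Rint_B//; last exact: intgZ.
  by apply: eq_Rint => th _; ring.
have K := etrans (esym L) (etrans E Rr); rewrite cos_case in K.
exact: (addIr _ K).
Qed.

End Extend.
End Cutoff.

(** * The fundamental lemma of the calculus of variations *)

Section Fundamental.
Context {R : realType}.
Local Notation mu := (@lebesgue_measure R).
Implicit Types (f g a : R -> R).

Lemma ae_intg f g : measurable_fun setT g -> {ae mu, forall x, f x = g x} ->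
  intg setT f -> intg setT g.
Proof.
move=> mg fg /integrableP[mf fy]; apply/integrableP; split; first exact/measurable_EFinP.
rewrite (@ae_eq_integral _ _ R mu setT (fun x => `|(EFin \o f) x|)%E (fun x => `|(EFin \o g) x|)%E)//.
- by apply: measurableT_comp => //; exact/measurable_EFinP.
- exact: measurableT_comp.
- have [N [mN N0 hN]] := fg; exists N; split=> // x nx; apply: hN => /= fx.
  by apply: nx => /= _; rewrite fx.
Qed.

Lemma ae_Rint f g : measurable_fun setT f -> measurable_fun setT g ->
  {ae mu, forall x, f x = g x} -> (\int[mu]_x f x = \int[mu]_x g x)%R.
Proof.
move=> mf mg fg; rewrite /Rintegral; congr fine.
apply: ae_eq_integral => //; [exact/measurable_EFinP|exact/measurable_EFinP|].
have [N [mN N0 hN]] := fg; exists N; split=> // x nx; apply: hN => /= fx.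
by apply: nx => /= _; rewrite fx.
Qed.

(** On a ball where g has mean zero, the mean oscillation around g x is at
    least |g x|; at a Lebesgue point it tends to 0. *)
Let ball_zero g x (r : R) : 0 < r -> intg (ball x r) g -> (\int[mu]_(y in ball x r) g y)%R = 0 ->
  (`|g x|%:E <= davg g x r)%E.
Proof.
move=> r0 Ig g0; rewrite /davg /iavg (lebesgue_measure_ball x (ltW r0)).
have mB : measurable (ball x r) := measurable_ball x r.
have fB : (mu (ball x r) < +oo)%E by rewrite (lebesgue_measure_ball x (ltW r0)) ltry.
have Ic : intg (ball x r) (cst (g x)) by exact: intg_cst.
have Id : intg (ball x r) (fun y => g y - g x) by exact: intgB.
have In := intg_norm Id.
have -> : (\int[mu]_(y in ball x r) `|((center (g x) \o g) y)%:E| =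
   (\int[mu]_(y in ball x r) `|g y - g x|)%R%:E)%E.
  by rewrite /Rintegral fineK//; exact: integrable_fin_num.
have r2 : r *+ 2 != 0 by rewrite mulrn_eq0/= gt_eqF.
rewrite inver (negbTE r2) -EFinM lee_fin mulrC ler_pdivlMr ?mulrn_wgt0//.
have <- : `|(\int[mu]_(y in ball x r) (g y - g x))%R| = `|g x| * (r *+ 2).
  have Ec : (\int[mu]_(y in ball x r) g x)%R = g x * fine (mu (ball x r)) by exact: Rintegral_cst.
  rewrite Rint_B// g0 sub0r normrN Ec normrM (lebesgue_measure_ball x (ltW r0))/=.
  by rewrite [X in _ * X]ger0_norm// mulrn_wge0// ltW.
exact: (@le_normr_Rintegral _ _ _ mu (ball x r)).
Qed.

Let bump1 y : 1 <= y -> expR (-1) <= @bump R y.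
Proof.
move=> y1; have y0 : 0 < y by rewrite (lt_le_trans ltr01).
by rewrite /bump /bumpk y0 expr0 mul1r ler_expR lerN2 invf_le1.
Qed.

(** Serves to extract local integrability of g from the hypothesis on test
    functions. *)
Let plateau (c d : R) : exists a, [/\ rsmooth a, exists M : R, forall x, M < `|x| -> a x = 0 &
  exists2 k, 0 < k & forall x, c <= x <= d -> k <= a x].
Proof.
exists (fun x => bump (x - (c - 1)) * bump ((d + 1) - x)); split.
- apply: rsmoothM.
    exact: (rsmooth_comp (@rsmooth_bump R) (rsmoothB (@rsmooth_id R) (@rsmooth_cst R (c - 1)))).
  exact: (rsmooth_comp (@rsmooth_bump R) (rsmoothB (@rsmooth_cst R (d + 1)) (@rsmooth_id R))).
- exists (`|c - 1| + `|d + 1|) => x hx.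
  have [x0|x0] := lerP 0 x.
    have : d + 1 - x <= 0.
      by move: hx; rewrite (ger0_norm x0); have := ler_norm (d + 1); have := normr_ge0 (c - 1); lra.
    by move=> h; rewrite [X in _ * X]/bump /bumpk ltNge h mulr0.
  have : x - (c - 1) <= 0.
    by move: hx; rewrite (ltr0_norm x0); have := ler_norm (- (c - 1)); rewrite normrN; have := normr_ge0 (d + 1); lra.
  by move=> h; rewrite [X in X * _]/bump /bumpk ltNge h mul0r.
- exists (expR (-1) * expR (-1)); first by rewrite mulr_gt0 ?expR_gt0.
  by move=> x /andP[cx xd]; rewrite ler_pM ?expR_ge0//; apply: bump1; lra.
Qed.

(** Tends to the indicator function of the open interval from c to d. *)
Let bumps (c d : R) (n : nat) x : R := bump (n%:R * (x - c) - 1) * bump (n%:R * (d - x) - 1).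

Let bumps_smooth c d n : rsmooth (bumps c d n).
Proof.
have sn (h : R -> R) : rsmooth h -> rsmooth (fun x => bump (n%:R * h x - 1)).
  move=> sh; apply: (rsmooth_comp (@rsmooth_bump R)).
  exact: (rsmoothB (rsmoothM (@rsmooth_cst R n%:R) sh) (@rsmooth_cst R 1)).
apply: rsmoothM; apply: sn.
  exact: (rsmoothB (@rsmooth_id R) (@rsmooth_cst R c)).
exact: (rsmoothB (@rsmooth_cst R d) (@rsmooth_id R)).
Qed.

Let bumps_out c d n x : ~ (c < x < d) -> bumps c d n x = 0.
Proof.
move=> h; have n0 : 0 <= n%:R :> R by [].
have [xc|cx] := lerP x c.
  rewrite /bumps [X in X * _]/bump /bumpk ltNge (_ : _ <= 0)/= ?mul0r//.
  by have := mulr_ge0 n0 (_ : 0 <= c - x); rewrite subr_ge0 => /(_ xc); lra.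
have dx : d <= x by rewrite leNgt; apply/negP => xd; apply: h; rewrite cx.
rewrite /bumps [X in _ * X]/bump /bumpk ltNge (_ : _ <= 0)/= ?mulr0//.
by have := mulr_ge0 n0 (_ : 0 <= x - d); rewrite subr_ge0 => /(_ dx); lra.
Qed.

Let bumps_le c d n x : 0 <= bumps c d n x <= 1.
Proof. by rewrite /bumps mulr_ge0 ?bumpk_ge0//= mulr_ile1 ?bumpk_ge0//; exact: bumpk_bound. Qed.

(** The products of g with test functions are assumed integrable, rather than
    g, because this is all that an equation with right-hand side K e^u
    provides. Bumps show that g has integral 0 on every interval, and
    Lebesgue's differentiation theorem concludes. *)
Lemma fundamental g : measurable_fun setT g ->
  (forall a, rsmooth a -> (exists M : R, forall x, M < `|x| -> a x = 0) ->
    intg setT (fun x => g x * a x) /\ (\int[mu]_x (g x * a x))%R = 0) ->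
  {ae mu, forall x, g x = 0}.
Proof.
move=> mg H.
have Igcd (c d : R) : intg `[c, d] g.
  have [a [sa ca [k k0 ka]]] := plateau c d; have [Ia _] := H a sa ca.
  apply: (@intg_le _ _ _ (fun x => k^-1 * `|g x * a x|)) => //.
  - exact: measurable_funTS.
  - move=> x; rewrite /= in_itv/= => /ka kx; rewrite mulrC ler_pdivlMr// normrM.
    by rewrite ler_wpM2l// (le_trans kx)// ler_norm.
  - apply: intgZ => //; apply: intg_norm; apply: (@intgS _ _ setT) => //.
have Zcd (c d : R) : (\int[mu]_(x in `]c, d[) g x)%R = 0.
  rewrite Rintegral_mkcond.
  have L : (fun n => \int[mu]_x (g x * bumps c d n x))%R @ \oo --> (\int[mu]_x (g \_ `]c, d[) x)%R.
    apply: (proj2 (@Rint_dct _ setT _ _ (fun x => `|(g \_ `[c, d]) x|) measurableT _ _ _ _)).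
    - by move=> n; apply: measurable_funM => //; apply: cont_meas; exact: rsmooth_cont.
    - move=> x _; have [xcd|xcd] := boolP (c < x < d).
        rewrite patchE ifT; last by rewrite inE /= in_itv.
        rewrite -[X in _ --> X]mulr1; apply: cvgM; first exact: cvg_cst.
        move/andP: xcd => [cx xd]; rewrite -[X in _ --> X]mulr1.
        by apply: cvgM; apply: bump_cvg; rewrite subr_gt0.
      rewrite patchE ifF; last by apply/negbTE; rewrite notin_setE /= in_itv/=; exact/negP.
      rewrite (_ : (fun n => _) = (fun _ => 0)); last first.
        by apply/funext => n; rewrite bumps_out ?mulr0//; exact/negP.
      exact: cvg_cst.
    - move=> n x _; have [xcd|xcd] := boolP (c < x < d); last first.
        by rewrite bumps_out ?mulr0 ?normr0//; exact/negP.
      rewrite patchE ifT; last by rewrite inE /= in_itv/=; move/andP: xcd => [/ltW -> /ltW ->].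
      have /andP[b0 b1] := bumps_le c d n x.
      by rewrite normrM (ger0_norm b0) ler_piMr.
    - by apply: intg_norm; apply: intg_mkcond => //; exact: Igcd.
  have Z0 : (fun n => \int[mu]_x (g x * bumps c d n x))%R = (fun _ => 0).
    apply/funext => n; apply: (H _ _ _).2; first exact: bumps_smooth.
    exists (`|c| + `|d|) => x hx; apply: bumps_out => /andP[cx xd].
    move: hx; have := ler_norm d; have := ler_norm (- c); rewrite normrN.
    have := normr_ge0 c; have := normr_ge0 d.
    have [x0|x0] := lerP 0 x; [rewrite (ger0_norm x0)|rewrite (ltr0_norm x0)]; lra.
  rewrite Z0 in L; by apply: (cvg_unique _ L (cvg_cst _)).
have lg : locally_integrable setT g.
  split => //; first exact: openT.
  move=> K _ cK; have [M [_ hM]] := compact_bounded cK.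
  have KM : K `<=` `[- (`|M| + 1), `|M| + 1].
    move=> x Kx; rewrite /= in_itv/= -ler_norml; apply: (hM (`|M| + 1)) => //.
    by rewrite (le_lt_trans (ler_norm M))// ltrDl.
  have IK : intg K g by apply: (intgS _ _ KM (Igcd _ _)) => //; exact: compact_measurable.
  by have /integrableP[_] := IK.
(* At a Lebesgue point, |g x| is at most averages that tend to 0. *)
have [N [mN N0 hN]] := lebesgue_differentiation lg; exists N; split=> // x nx; apply: hN => /= hx.
apply: nx.
apply/eqP; rewrite -normr_eq0 eq_le normr_ge0 andbT -lee_fin.
apply: (cvge_ge _ hx).
near=> r.
have r0 : 0 < r by near: r; exact: nbhs_right_gt.
apply: ball_zero => //.
  rewrite ball_itv; apply: (intgS _ _ _ (Igcd (x - r) (x + r))) => //.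
  by move=> y; rewrite /= !in_itv/= => /andP[/ltW -> /ltW ->].
by rewrite ball_itv; exact: Zcd.
Unshelve. all: by end_near. Qed.

End Fundamental.

(** * The equations on the line and on the circle *)

Section RealForm.
Context {R : realType}.
Local Notation mu := (@lebesgue_measure R).
Local Notation circle := (@circle R).
Local Notation arc := (@arc R).
Local Notation mia := (@minus_i_angle R).
Implicit Types (f g u v a psi : R -> R).

(** [half_lap_line_eq] tested against real Schwartz functions. *)
Definition line_eq u f := forall a, rschwartz a ->
  intg setT (fun x => f x * a x) /\
  (\int[mu]_x (u x * line_hlap a x) = \int[mu]_x (f x * a x))%R.

Lemma rschwartz0 : rschwartz (fun _ : R => 0 : R).
Proof. by apply: (@compact_support_rschwartz _ _ 0) => //; exact: rsmooth_cst. Qed.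

Lemma half_lap_line_eqP u f : half_lap_line_eq u f <-> line_eq u f.
Proof.
have RI (r : R) (z : R[i]) : complex.Re (r%:C * z) = r * complex.Re z /\ complex.Im (r%:C * z) = r * complex.Im z.
  by rewrite Re_M Im_M /= !mul0r subr0 addr0.
split=> [H a sa|H phi [s1 s2]].
  have [|[I _]] := H (fun x => a x +i* 0).
    by split => //=; exact: rschwartz0.
  move=> /(congr1 (@complex.Re R)) E; split.
    by apply: eq_intg I => // x _; rewrite (RI _ _).1.
  transitivity (\int[mu]_x complex.Re ((u x)%:C * half_lap_line (fun x => a x +i* 0) x))%R.
    by apply: eq_Rint => x _; rewrite (RI _ _).1 (half_lap_line_real _ sa rschwartz0).
  by apply: (etrans E); apply: eq_Rint => x _; rewrite (RI _ _).1.
have [I1 E1] := H _ s1; have [I2 E2] := H _ s2; split.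
  by split; [apply: eq_intg I1 => // x _; rewrite /= (RI _ _).1|apply: eq_intg I2 => // x _; rewrite /= (RI _ _).2].
have phiE : phi = (fun x => complex.Re (phi x) +i* complex.Im (phi x)) by apply/funext => x; case: (phi x).
rewrite /half_lap_line_pairing /cintegral; congr (_ +i* _).
  transitivity (\int[mu]_x (u x * line_hlap (fun x => complex.Re (phi x)) x))%R.
    by apply: eq_Rint => x _; rewrite (RI _ _).1 {1}phiE (half_lap_line_real _ s1 s2).
  by rewrite E1; apply: eq_Rint => x _; rewrite (RI _ _).1.
transitivity (\int[mu]_x (u x * line_hlap (fun x => complex.Im (phi x)) x))%R.
  by apply: eq_Rint => x _; rewrite (RI _ _).2 {1}phiE (half_lap_line_real _ s1 s2).
by rewrite E2; apply: eq_Rint => x _; rewrite (RI _ _).2.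
Qed.

Lemma complex_eqD (r s r' s' : R) (z : R[i]) :
  r +i* s = r' +i* s' + z <-> r = r' + complex.Re z /\ s = s' + complex.Im z.
Proof. by case: z => z1 z2 /=; split; move=> [-> ->]. Qed.

Lemma circle_pairingE (v g : R -> R) (c : R) (phi : R -> R[i]) : circle_test phi ->
  (half_lap_circle_pairing v phi = cintegral circle (fun t => (g t)%:C * phi t) + c%:C * phi mia) <->
  (\int[mu]_(t in circle) (v t * circle_hlap (fun t => complex.Re (phi t)) t) =
   \int[mu]_(t in circle) (g t * complex.Re (phi t)) + c * complex.Re (phi mia))%R /\
  (\int[mu]_(t in circle) (v t * circle_hlap (fun t => complex.Im (phi t)) t) =
   \int[mu]_(t in circle) (g t * complex.Im (phi t)) + c * complex.Im (phi mia))%R.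
Proof.
move=> tphi.
have RI (r : R) (z : R[i]) : complex.Re (r%:C * z) = r * complex.Re z /\ complex.Im (r%:C * z) = r * complex.Im z.
  by rewrite Re_M Im_M /= !mul0r subr0 addr0.
rewrite /half_lap_circle_pairing /cintegral.
have -> : (\int[mu]_(x in circle) complex.Re ((v x)%:C * half_lap_circle phi x))%R =
   (\int[mu]_(t in circle) (v t * circle_hlap (fun t => complex.Re (phi t)) t))%R.
  by apply: eq_Rint => x _; rewrite (RI _ _).1 half_lap_circleE.
have -> : (\int[mu]_(x in circle) complex.Im ((v x)%:C * half_lap_circle phi x))%R =
   (\int[mu]_(t in circle) (v t * circle_hlap (fun t => complex.Im (phi t)) t))%R.
  by apply: eq_Rint => x _; rewrite (RI _ _).2 half_lap_circleE.
have -> : (\int[mu]_(x in circle) complex.Re ((g x)%:C * phi x))%R =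
   (\int[mu]_(t in circle) (g t * complex.Re (phi t)))%R.
  by apply: eq_Rint => x _; rewrite (RI _ _).1.
have -> : (\int[mu]_(x in circle) complex.Im ((g x)%:C * phi x))%R =
   (\int[mu]_(t in circle) (g t * complex.Im (phi t)))%R.
  by apply: eq_Rint => x _; rewrite (RI _ _).2.
have [e1 e2] := RI c (phi mia).
rewrite -e1 -e2; move: (c%:C * phi mia) => z.
exact: complex_eqD.
Qed.

Lemma circle_test_real psi : ctest psi -> circle_test (fun t => psi t +i* 0).
Proof. by move=> tp; apply/circle_testP; split=> //=; exact: ctest_cst. Qed.

Lemma half_lap_circle_eqP v g (c : R) : half_lap_circle_eq v g c <->
  intg circle g /\ forall psi, ctest psi ->
   (\int[mu]_(t in circle) (v t * circle_hlap psi t) = \int[mu]_(t in circle) (g t * psi t) + c * psi mia)%R.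
Proof.
split=> [[Ig H]|[Ig H]]; split=> //.
  move=> psi tp; have tt := circle_test_real tp.
  by have [] := (circle_pairingE v g c tt).1 (H _ tt).
move=> phi tphi; apply/(circle_pairingE v g c tphi).
by have [t1 t2] := (circle_testP phi).1 tphi; split; exact: H.
Qed.

Lemma punctured_L1P v : half_lap_circle_punctured_L1 v <->
  exists g, intg circle g /\ forall psi, ctest psi -> (\forall t \near mia, psi t = 0) ->
   (\int[mu]_(t in circle) (v t * circle_hlap psi t) = \int[mu]_(t in circle) (g t * psi t))%R.
Proof.
split=> [[g [Ig H]]|[g [Ig H]]]; exists g; split=> //.
  move=> psi tp p0; have tt := circle_test_real tp.
  have pt : punctured_circle_test (fun t => psi t +i* 0).
    by split=> //; apply: filterS p0 => t ->.
  have E := H _ pt.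
  have := (circle_pairingE v g 0 tt).1; rewrite mul0r addr0 => /(_ E) [+ _].
  by rewrite /= mul0r addr0.
move=> phi [tphi p0].
rewrite -[RHS]addr0 -(mul0r (phi mia)); apply/(circle_pairingE v g 0 tphi).
have [t1 t2] := (circle_testP phi).1 tphi; rewrite !mul0r !addr0; split; apply: H => //.
  by apply: filterS p0 => t ->.
by apply: filterS p0 => t ->.
Qed.

Lemma dens_intg (h : R -> R) : measurable_fun setT h ->
  intg setT (fun x => 2 / (1 + x ^+ 2) * h (ster_inv x)) <-> intg circle h.
Proof.
move=> mh; have m1 : measurable_fun setT (fun _ : R => 1 : R) by exact: measurable_cst.
have [H1 H2] := pull_intg m1 mh; split=> I.
  apply: (@eq_intg _ _ (fun th => 1 * h th)) => //; first by move=> x _; rewrite mul1r.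
  by apply: H1; apply: eq_intg I => // x _; rewrite mul1r.
apply: (@eq_intg _ _ (fun x => 1 * (2 / (1 + x ^+ 2) * h (ster_inv x)))) => //; first by move=> x _; rewrite mul1r.
by apply: H2; apply: eq_intg I => // x _; rewrite mul1r.
Qed.

Lemma dens_Rint (h : R -> R) : measurable_fun setT h -> intg circle h ->
  (\int[mu]_x (2 / (1 + x ^+ 2) * h (ster_inv x)) = \int[mu]_(th in circle) h th)%R.
Proof.
move=> mh I; have m1 : measurable_fun setT (fun _ : R => 1 : R) by exact: measurable_cst.
have I1 : intg circle (fun th => 1 * h th) by apply: eq_intg I => // x _; rewrite mul1r.
have := pull_Rint m1 mh I1; under eq_Rint do rewrite mul1r; move=> ->.
by apply: eq_Rint => th _; rewrite mul1r.
Qed.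

(** The function g such that f dx corresponds to g dth. *)
Definition circle_density f th : R := f (stereo th) / (1 + sin th).

Lemma meas_circle_density f : measurable_fun setT f -> measurable_fun setT (circle_density f).
Proof.
move=> mf; apply: measurable_funM; first exact: (measurableT_comp mf (@meas_stereo R)).
apply: measV; apply: measurable_funD => //; exact: cont_meas (@continuous_sin R).
Qed.

Lemma circle_densityE f x : 2 / (1 + x ^+ 2) * circle_density f (ster_inv x) = f x.
Proof.
rewrite /circle_density ster_invK oneDsin_ster_inv; have n1 := oneDsqr_neq0 x.
by field; rewrite n1.
Qed.

Lemma circle_density_intg f : measurable_fun setT f -> intg setT f <-> intg circle (circle_density f).
Proof.
move=> mf; rewrite -(dens_intg (meas_circle_density mf)).
by split; apply: eq_intg => // x _; rewrite circle_densityE.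
Qed.

Lemma circle_density_Rint f psi : measurable_fun setT f -> measurable_fun setT psi ->
  intg circle (fun th => circle_density f th * psi th) ->
  (\int[mu]_x (f x * psi (ster_inv x)) = \int[mu]_(th in circle) (circle_density f th * psi th))%R.
Proof.
move=> mf mp I; have mG := meas_circle_density mf.
rewrite -dens_Rint//; last exact: measurable_funM.
by apply: eq_Rint => x _; rewrite mulrA circle_densityE.
Qed.

Lemma pole_ext_mia a : pole_ext a mia = 0.
Proof. by rewrite /pole_ext sin_mia subrr eqxx. Qed.

Lemma L_half_intg u : L_half u <-> measurable_fun setT u /\ intg setT (fun x => u x * (2 / (1 + x ^+ 2))).
Proof.
have mi : measurable_fun setT (fun x : R => 2 / (1 + x ^+ 2)).
  by apply: measurable_funM => //; apply: measV; apply: measurable_funD => //; exact: measurable_funX.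
have e x : `|u x| / (1 + x ^+ 2) = 2^-1 * `|u x * (2 / (1 + x ^+ 2))|.
  have p0 := oneDsqr_gt0 x; rewrite normrM [X in _ * (_ * X)]ger0_norm ?divr_ge0 ?ltW//.
  by field; rewrite gt_eqF.
split=> [[[mu_ _ _] fin]|[mu_ I]].
  split=> //.
  have I : intg setT (fun x => `|u x| / (1 + x ^+ 2)).
    apply/integrableP; split.
      apply/measurable_EFinP; apply: measurable_funM; first exact: measurableT_comp.
      by apply: measV; apply: measurable_funD => //; exact: measurable_funX.
    apply: le_lt_trans fin; rewrite le_eqVlt; apply/orP; left; apply/eqP.
    apply: eq_integral => x _ /=; rewrite ger0_norm// divr_ge0// ltW// oneDsqr_gt0//.
  apply: (@intg_le _ _ _ (fun x => 2 * (`|u x| / (1 + x ^+ 2)))) => //.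
  - exact: measurable_funM.
  - by move=> x _; rewrite e; lra.
  - exact: intgZ.
split.
  split=> //; first exact: openT.
  move=> K _ cK; have [M [_ hM]] := compact_bounded cK.
  have mK := compact_measurable cK.
  have : intg K u.
    apply: (@intg_le _ _ _ (fun x => (1 + (`|M| + 1) ^+ 2) * `|u x * (2 / (1 + x ^+ 2))|)) => //.
    - exact: measurable_funTS.
    - move=> x Kx; have xM : `|x| <= `|M| + 1.
        by apply: (hM (`|M| + 1)) => //; rewrite (le_lt_trans (ler_norm M))// ltrDl.
      have p0 := oneDsqr_gt0 x.
      rewrite normrM [X in _ * (_ * X)]ger0_norm ?divr_ge0 ?(ltW p0)// mulrCA ler_peMr//.
      rewrite mulrA ler_pdivlMr// mul1r.
      have : x ^+ 2 <= (`|M| + 1) ^+ 2.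
        by rewrite -(real_normK (num_real x)) ler_pXn2r ?nnegrE ?addr_ge0.
      have := sqr_ge0 (`|M| + 1); lra.
    - apply: intgZ => //; apply: intg_norm; exact: (intgS mK measurableT _ I).
  by move=> /integrableP[_].
have /integrableP[_] := intgZ 2^-1 measurableT (intg_norm I).
apply: le_lt_trans; rewrite le_eqVlt; apply/orP; left; apply/eqP.
by apply: eq_integral => x _; rewrite e; congr (_%:E); apply/esym/ger0_norm; rewrite mulr_ge0.
Qed.

Lemma L_half_circle u : L_half u <-> measurable_fun setT u /\ intg circle (u \o stereo).
Proof.
rewrite L_half_intg; split=> [[mu_ I]|[mu_ I]]; split=> //.
  have m1 : measurable_fun setT (fun _ : R => 1 : R) by exact: measurable_cst.
  have H : intg circle (fun th => u (stereo th) * 1).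
    by apply/(pull_intg mu_ m1); apply: eq_intg I => // x _; rewrite mulr1.
  by apply: eq_intg H => // th _; rewrite /= mulr1.
have m1 : measurable_fun setT (fun _ : R => 1 : R) by exact: measurable_cst.
have H : intg circle (fun th => u (stereo th) * 1) by apply: eq_intg I => // th _; rewrite mulr1.
by move/(pull_intg mu_ m1): H; apply: eq_intg => // x _; rewrite mulr1.
Qed.

Let Il : intg circle (fun th : R => ln (1 + sin th)).
Proof. by have [] := circle_hlap_ln (ctest_cst (0 : R)). Qed.

(** The weight 1 / (1 + x^2) is half the density of the projection, and ln (1 +
    sin) is integrable. *)
Lemma L_half_lift u : L_half u <-> L1_circle (lift_circle u).
Proof.
rewrite L_half_circle; split=> [[mu_ Iv]|Ila]; first exact: intgB Iv Il.
have Iv : intg circle (u \o stereo).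
  have := intgD (@measurable_circle R) Ila Il; apply: eq_intg => // th _.
  by rewrite /lift_circle subrK.
split=> //.
have mvc : measurable_fun setT ((u \o stereo) \_ circle).
  exact: (intg_meas (intg_mkcond (@measurable_circle R) Iv)).
(* u is recovered from its lift, which is how its measurability follows from
   that of lambda. *)
have -> : u = ((u \o stereo) \_ circle) \o (@ster_inv R).
  apply/funext => x /=; rewrite patchE ifT /= ?ster_invK// inE.
  by apply: arc_circle; exact: ster_inv_arc.
exact: (measurableT_comp mvc (@meas_ster_inv R)).
Qed.

Section Correspondence.
Variables (u : R -> R) (Lu : L_half u).
Local Notation v := (u \o stereo).
Local Notation lam := (lift_circle u).

Let mu_ : measurable_fun setT u := ((L_half_circle u).1 Lu).1.
Let Iv : intg circle v := ((L_half_circle u).1 Lu).2.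

Let Iw (w : R -> R) psi : intg circle w -> ctest psi -> intg circle (fun th => w th * psi th).
Proof.
move=> I tp; have [C h] := ctest_C2per tp; have [_ _ b _ _] := h.
apply: (@intgM_bounded _ _ _ _ C) => //; last by move=> x; have [] := b x.
by apply: measurable_funTS; exact: C2per_meas h.
Qed.

Let IwT (w : R -> R) psi : intg circle w -> ctest psi -> intg circle (fun th => w th * circle_hlap psi th).
Proof.
move=> I tp; have [C h] := ctest_C2per tp.
apply: (intgM_bounded _ I _ (fun th => circle_hlap_le th h)) => //.
by apply: measurable_funTS; exact: meas_circle_hlap h.
Qed.

(** [circle_hlap_ln] is all that separates lambda from u o Pi. *)
Lemma lift_pairing psi : ctest psi ->
  (\int[mu]_(th in circle) (lam th * circle_hlap psi th) =
   \int[mu]_(th in circle) (v th * circle_hlap psi th) - \int[mu]_(th in circle) psi th + 2 * pi * psi mia)%R.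
Proof.
move=> tp; have [_ E] := circle_hlap_ln tp.
have -> : (\int[mu]_(th in circle) (lam th * circle_hlap psi th) =
   \int[mu]_(th in circle) (v th * circle_hlap psi th) - \int[mu]_(th in circle) (ln (1 + sin th) * circle_hlap psi th))%R.
  rewrite -Rint_B//; [|exact: IwT|exact: IwT].
  by apply: eq_Rint => th _; rewrite /lift_circle mulrBl.
by rewrite E; ring.
Qed.

Let u_pairing a : rschwartz a ->
  (\int[mu]_x (u x * line_hlap a x) = \int[mu]_(th in circle) (v th * circle_hlap (pole_ext a) th))%R.
Proof.
move=> sa; have [C h] := ctest_C2per (ctest_pole_ext sa).
rewrite -(pull_Rint mu_ (meas_circle_hlap h)); last exact: IwT (ctest_pole_ext sa).
by apply: eq_Rint => x _; rewrite line_hlap_pole_ext.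
Qed.

Let f_pairing f a : measurable_fun setT f -> intg circle (circle_density f) -> rschwartz a ->
  intg setT (fun x => f x * a x) /\
  (\int[mu]_x (f x * a x) = \int[mu]_(th in circle) (circle_density f th * pole_ext a th))%R.
Proof.
move=> mf If sa; have tl := ctest_pole_ext sa; have [C h] := ctest_C2per tl.
have mG := meas_circle_density mf; have I := Iw If tl.
have E x : 2 / (1 + x ^+ 2) * (circle_density f (ster_inv x) * pole_ext a (ster_inv x)) = f x * a x.
  by rewrite mulrA circle_densityE pole_ext_ster.
have mp : measurable_fun setT (fun th => circle_density f th * pole_ext a th).
  by apply: measurable_funM => //; exact: C2per_meas h.
split; first by move/(dens_intg mp): I; apply: eq_intg => // x _; exact: E.
by rewrite -(dens_Rint mp I); apply: eq_Rint => x _; rewrite -E.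
Qed.

(** Test functions that vanish near the pole are Schwartz on the line. *)
Lemma line_eq_punctured f : intg setT f -> line_eq u f ->
  forall psi, ctest psi -> (\forall t \near mia, psi t = 0) ->
  (\int[mu]_(th in circle) (v th * circle_hlap psi th) = \int[mu]_(th in circle) (circle_density f th * psi th))%R.
Proof.
move=> If H psi tp p0; have mf := intg_meas If; have IG := (circle_density_intg mf).1 If.
have sa := punctured_sch tp p0; have [_ E] := H _ sa.
have [C h] := ctest_C2per tp.
rewrite -(pull_Rint mu_ (meas_circle_hlap h)); last exact: IwT.
rewrite -(circle_density_Rint mf (C2per_meas h)); last exact: Iw.
by rewrite -E; apply: eq_Rint => x _; rewrite line_hlap_punctured.
Qed.

(** Schwartz functions need not vanish near the pole on the circle; but they
    vanish at the pole, so that the Dirac mass of [extend_through_pole] is not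
    seen. *)
Lemma punctured_line_eq f : intg setT f ->
  (forall psi, ctest psi -> (\forall t \near mia, psi t = 0) ->
  (\int[mu]_(th in circle) (v th * circle_hlap psi th) = \int[mu]_(th in circle) (circle_density f th * psi th))%R) ->
  line_eq u f.
Proof.
move=> If H a sa; have mf := intg_meas If; have IG := (circle_density_intg mf).1 If.
have [I E] := f_pairing mf IG sa; split=> //.
rewrite E u_pairing// (extend_through_pole Iv IG H (ctest_pole_ext sa)).
by apply: eq_Rint => th _; rewrite pole_ext_mia subr0.
Qed.

(** The densities correspond by g = G - 1, where G is the density of f. *)
Lemma L1_correspondence : half_lap_line_L1 u <-> half_lap_circle_punctured_L1 lam.
Proof.
split=> [[f [If /half_lap_line_eqP H]]|/punctured_L1P[g [Ig H]]].
  apply/punctured_L1P; have IG := (circle_density_intg (intg_meas If)).1 If.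
  exists (fun th => circle_density f th - 1); split.
    by apply: intgB => //; exact: intg_cst mu_circle_lty.
  move=> psi tp p0; rewrite lift_pairing// (line_eq_punctured If H tp p0) (nbhs_singleton p0) mulr0 addr0.
  have [C h] := ctest_C2per tp; have Ip := intg_circle_cont (C2per_cont h) tp.2.
  by rewrite -Rint_B//; [apply: eq_Rint => th _; ring|exact: Iw].
(* g is only known on one period: outside, G is set to 0 to be measurable on
   the line. *)
pose G := (fun th => g th + 1) \_ circle.
have Ig1 : intg circle (fun th => g th + 1).
  by apply: intgD => //; exact: intg_cst mu_circle_lty.
have mG : measurable_fun setT G by exact: (intg_meas (intg_mkcond (@measurable_circle R) Ig1)).
have GE th : circle th -> G th = g th + 1 by move=> ct; rewrite /G patchE ifT// inE.
have IG : intg circle G by apply: eq_intg Ig1 => // th ct; rewrite GE.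
pose f x := 2 / (1 + x ^+ 2) * G (ster_inv x).
have If : intg setT f by apply/(dens_intg mG).
have GofG th : arc th -> circle_density f th = G th.
  move=> at_; rewrite /circle_density /f stereoK// -arc_oneDsin//.
  by rewrite mulrAC mulfV ?mul1r// lt0r_neq0// oneDsin_gt0.
exists f; split=> //; apply/half_lap_line_eqP; apply: punctured_line_eq => // psi tp p0.
have [C h] := ctest_C2per tp; have Ip := intg_circle_cont (C2per_cont h) tp.2.
have IGf := (circle_density_intg (intg_meas If)).1 If.
have := H psi tp p0; rewrite lift_pairing// (nbhs_singleton p0) mulr0 addr0.
move=> /(canRL (subrK _)) ->; rewrite -Rint_D//; last exact: Iw.
rewrite -(Rint_arc_circle (Iw IGf tp)) -Rint_arc_circle; last first.
  by apply: intgD => //; exact: Iw.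
apply: eq_Rint => th at_; rewrite GofG// GE; last exact: arc_circle.
by ring.
Qed.

Section Equation.
Variables (f : R -> R) (If : intg setT f) (Hf : line_eq u f).

(** The Dirac mass has weight 2 pi from the logarithm and -int f from
    [extend_through_pole]. *)
Lemma full_circle_equation psi : ctest psi ->
  (\int[mu]_(th in circle) (lam th * circle_hlap psi th) =
   \int[mu]_(th in circle) ((circle_density f th - 1) * psi th) + (2 * pi - \int[mu]_x f x) * psi mia)%R.
Proof.
move=> tp; have mf := intg_meas If; have IG := (circle_density_intg mf).1 If.
have [C h] := ctest_C2per tp; have Ip := intg_circle_cont (C2per_cont h) tp.2.
rewrite lift_pairing// (extend_through_pole Iv IG (line_eq_punctured If Hf) tp).
have IGp := Iw IG tp.
have -> : (\int[mu]_x f x = \int[mu]_(th in circle) circle_density f th)%R.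
  by rewrite -(dens_Rint (meas_circle_density mf) IG); apply: eq_Rint => x _; rewrite circle_densityE.
have -> : (\int[mu]_(th in circle) (circle_density f th * (psi th - psi mia)) =
   \int[mu]_(th in circle) (circle_density f th * psi th) - psi mia * \int[mu]_(th in circle) circle_density f th)%R.
  rewrite -Rint_Z// -Rint_B//; last exact: intgZ.
  by apply: eq_Rint => th _; ring.
have -> : (\int[mu]_(th in circle) ((circle_density f th - 1) * psi th) =
   \int[mu]_(th in circle) (circle_density f th * psi th) - \int[mu]_(th in circle) psi th)%R.
  by rewrite -Rint_B//; apply: eq_Rint => th _; ring.
ring.
Qed.

Variables (K : R -> R) (mK : measurable_fun setT K).
Let F x : R := K x * expR (u x).

Let mF : measurable_fun setT F.
Proof. by apply: measurable_funM => //; exact: (measurableT_comp (@measurable_expR R) mu_). Qed.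

Let mf := intg_meas If.

Let rhs_arc th : arc th -> (K \o stereo) th * expR (lam th) = circle_density F th.
Proof.
move=> at_; rewrite /circle_density /F /lift_circle /= expRB lnK ?mulrA//.
by rewrite posrE oneDsin_gt0.
Qed.

Lemma solves_line_ae : solves_line K u <-> {ae mu, forall x, F x = f x}.
Proof.
rewrite /solves_line half_lap_line_eqP -/F; split=> [H|E].
  have : {ae mu, forall x, F x - f x = 0}.
    apply: fundamental; first exact: measurable_funB.
    move=> a sa [M ca]; have sca := compact_support_rschwartz sa ca.
    have [I1 E1] := H a sca; have [I2 E2] := Hf sca.
    split.
      have := intgB measurableT I1 I2; apply: eq_intg => // x _; ring.
    transitivity (\int[mu]_x (F x * a x - f x * a x))%R.
      by apply: eq_Rint => x _; ring.
    by rewrite Rint_B// -E1 -E2 subrr.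
  move=> [N [mN N0 hN]]; exists N; split=> // x nx; apply: hN => /= /eqP.
  by rewrite subr_eq0 => /eqP fx; apply: nx.
move=> a sa; have [I2 E2] := Hf sa; have ma := sch_meas sa.
have Ea : {ae mu, forall x, f x * a x = F x * a x}.
  have [N [mN N0 hN]] := E; exists N; split=> // x nx; apply: hN => /= fx.
  by apply: nx; rewrite /= fx.
have m1 : measurable_fun setT (fun x => f x * a x) by exact: measurable_funM.
have m2 : measurable_fun setT (fun x => F x * a x) by exact: measurable_funM.
split; first exact: ae_intg m2 Ea I2.
by rewrite E2; exact: ae_Rint.
Qed.

(** Valid for any weight c, since Schwartz functions transferred to the circle
    vanish at the pole. *)
Lemma circle_ae (c : R) : solves_circle (K \o stereo) lam c -> {ae mu, forall x, F x = f x}.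
Proof.
move=> /half_lap_circle_eqP[Ig H].
have Ik : intg circle (fun th => (K \o stereo) th * expR (lam th)).
  have I1 : intg circle (cst (1 : R)) by exact: intg_cst mu_circle_lty.
  have := intgD (@measurable_circle R) Ig I1; apply: eq_intg => // th _.
  by rewrite /= subrK.
have IGF : intg circle (circle_density F).
  apply/intg_arc_circle; move/intg_arc_circle: Ik; apply: eq_intg; first exact: measurable_arc.
  by move=> th at_; rewrite rhs_arc.
have IF : intg setT F by apply/circle_density_intg.
have IG := (circle_density_intg mf).1 If.
have : {ae mu, forall x, F x - f x = 0}.
  apply: fundamental; first exact: measurable_funB.
  move=> a sa [M ca]; have sca := compact_support_rschwartz sa ca.
  have tl := ctest_pole_ext sca.
  have [I1 E1] := f_pairing mF IGF sca; have [I2 E2] := f_pairing mf IG sca.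
  split.
    have := intgB measurableT I1 I2; apply: eq_intg => // x _; ring.
  transitivity (\int[mu]_x (F x * a x - f x * a x))%R.
    by apply: eq_Rint => x _; ring.
  rewrite Rint_B// E1 E2; apply/eqP; rewrite subr_eq0; apply/eqP.
  have := H _ tl; rewrite (full_circle_equation tl) pole_ext_mia !mulr0 !addr0 => HE.
  have [C h] := ctest_C2per tl; have Ip := intg_circle_cont (C2per_cont h) tl.2.
  have IGl := Iw IG tl; have IGFl := Iw IGF tl; have Ikl := Iw Ik tl.
  have e1 : (\int[mu]_(th in circle) ((circle_density f th - 1) * pole_ext a th) =
     \int[mu]_(th in circle) (circle_density f th * pole_ext a th) - \int[mu]_(th in circle) pole_ext a th)%R.
    by rewrite -Rint_B//; apply: eq_Rint => th _; ring.
  have e2 : (\int[mu]_(th in circle) (((K \o stereo) th * expR (lam th) - 1) * pole_ext a th) =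
     \int[mu]_(th in circle) (circle_density F th * pole_ext a th) - \int[mu]_(th in circle) pole_ext a th)%R.
    have <- : (\int[mu]_(th in circle) ((K \o stereo) th * expR (lam th) * pole_ext a th) =
       \int[mu]_(th in circle) (circle_density F th * pole_ext a th))%R.
      rewrite -(Rint_arc_circle IGFl) -(Rint_arc_circle Ikl).
      by apply: eq_Rint => th at_; rewrite rhs_arc.
    by rewrite -Rint_B//; apply: eq_Rint => th _; ring.
  by move: HE; rewrite e1 e2 => /addIr.
move=> [N [mN N0 hN]]; exists N; split=> // x nx; apply: hN => /= /eqP.
by rewrite subr_eq0 => /eqP fx; apply: nx.
Qed.

Lemma ae_circle : {ae mu, forall x, F x = f x} -> solves_circle (K \o stereo) lam (\int[mu]_x f x)%R.
Proof.
move=> E.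
have E' : {ae mu, forall x, f x = F x}.
  have [N [mN N0 hN]] := E; exists N; split=> // x nx; apply: hN => /= fx.
  by apply: nx; rewrite /= fx.
have IF : intg setT F := ae_intg mF E' If.
have IGF := (circle_density_intg mF).1 IF; have IG := (circle_density_intg mf).1 If.
have Ik : intg circle (fun th => (K \o stereo) th * expR (lam th)).
  apply/intg_arc_circle; move/intg_arc_circle: IGF; apply: eq_intg; first exact: measurable_arc.
  by move=> th at_; rewrite rhs_arc.
apply/half_lap_circle_eqP; split.
  by apply: intgB => //; exact: intg_cst mu_circle_lty.
move=> psi tp; rewrite full_circle_equation//; congr (_ + _).
have [C h] := ctest_C2per tp; have Ip := intg_circle_cont (C2per_cont h) tp.2.
have mp := C2per_meas h.
have IGp := Iw IG tp; have IGFp := Iw IGF tp; have Ikp := Iw Ik tp.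
have e1 : (\int[mu]_(th in circle) ((circle_density f th - 1) * psi th) =
   \int[mu]_(th in circle) (circle_density f th * psi th) - \int[mu]_(th in circle) psi th)%R.
  by rewrite -Rint_B//; apply: eq_Rint => th _; ring.
have e2 : (\int[mu]_(th in circle) (((K \o stereo) th * expR (lam th) - 1) * psi th) =
   \int[mu]_(th in circle) (circle_density F th * psi th) - \int[mu]_(th in circle) psi th)%R.
  have <- : (\int[mu]_(th in circle) ((K \o stereo) th * expR (lam th) * psi th) =
     \int[mu]_(th in circle) (circle_density F th * psi th))%R.
    rewrite -(Rint_arc_circle IGFp) -(Rint_arc_circle Ikp).
    by apply: eq_Rint => th at_; rewrite rhs_arc.
  by rewrite -Rint_B//; apply: eq_Rint => th _; ring.
rewrite e1 e2; apply: (congr1 (fun z => z - _)).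
have mps : measurable_fun setT (fun x => psi (ster_inv x)) by exact: (measurableT_comp mp (@meas_ster_inv R)).
rewrite -(circle_density_Rint mf mp IGp) -(circle_density_Rint mF mp IGFp).
apply: ae_Rint; [exact: measurable_funM|exact: measurable_funM|].
have [N [mN N0 hN]] := E'; exists N; split=> // x nx; apply: hN => /= fx.
by apply: nx; rewrite /= fx.
Qed.

End Equation.
End Correspondence.

End RealForm.

Theorem proposition4p2 (R : realType) (K u : R -> R)
    (mu := @lebesgue_measure R)
    (lambda := lift_circle u) (kappa := K \o stereo) :
  K \in Lfun mu +oo%E ->
  (L_half u <-> L1_circle lambda) /\
  (L_half u ->
    (half_lap_line_L1 u <-> half_lap_circle_punctured_L1 lambda) /\
    (forall f : R -> R,
       mu.-integrable setT (EFin \o f) -> half_lap_line_eq u f ->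
       let c := fine 'N[mu]_1[EFin \o f]%E in
       (solves_line K u <-> solves_circle kappa lambda (\int[mu]_x f x)%R) /\
       (solves_circle kappa lambda c -> solves_line K u) /\
       ({ae mu, forall x, 0 <= K x} ->
          (solves_line K u <-> solves_circle kappa lambda c)))).
Proof.
move=> hK.
have mK : measurable_fun setT K.
  by have := sub_Lfun_mfun hK; rewrite inE.
split; first exact: L_half_lift.
move=> Lu; split; first exact: L1_correspondence.
move=> f If /half_lap_line_eqP Hf c.
have Fae := solves_line_ae Lu If Hf mK.
have main : solves_line K u <-> solves_circle kappa lambda (\int[mu]_x f x)%R.
  split; first by move=> /Fae; exact: ae_circle.
  by move=> /(circle_ae Lu If Hf mK)/Fae.
split=> //; split; first by move=> /(circle_ae Lu If Hf mK)/Fae.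
move=> K0; split; last by move=> /(circle_ae Lu If Hf mK)/Fae.
move=> sl; have E := Fae.1 sl.
suff -> : c = (\int[mu]_x f x)%R by exact/main.
rewrite /c Lnorm1; apply: esym.
have mf : measurable_fun setT f := intg_meas If.
have mnf : measurable_fun setT (fun x => `|f x|) by exact: measurableT_comp.
apply: (@ae_Rint R f (fun x => `|f x|)) => //.
have [N [mN N0 hN]] := E; have [N' [mN' N0' hN']] := K0.
exists (N `|` N'); split; first exact: measurableU.
  exact: (etrans (measureU0 mN mN' N0') N0).
move=> x nx; have [Fx|] := pselect (K x * expR (u x) = f x); last by move=> h; left; apply: hN.
have [Kx|] := boolP (0 <= K x); last by move=> /negP h; right; apply: hN'.
by exfalso; apply: nx; rewrite /= ger0_norm// -Fx mulr_ge0// expR_ge0.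
Qed.
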